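(* Let $F:M^n\to\mathcal{L}^{2n+k-1,1}$ be a flat lift, with flat normal bundle and uniform multiplicity one, of a conformally flat immersion $f:M^n\to S^{2n+k-2}$, and let $v_1,\dots,v_n$ be the curvature normals of $F$. Suppose that the induced connection on the subbundle $N_v^\perp$ of $N_F$ is flat, where $N_v=\langle v_1,\dots,v_n\rangle$. (i) If $(v_i,v_i)>0$ for all $1\le i\le n$, then, locally on $M$, there exist line of curvature co-ordinates $(x_1,\dots,x_n)$, a solution $\Xi:M^n\to\mathfrak{a}_+^\perp\cap\mathfrak{p}$ of the $\frac{\mathrm{O}(2n+k-1,1)}{\mathrm{O}(n)\times\mathrm{O}(n+k-1,1)}$-system defined by $\mathfrak{a}_+$, and an $\mathrm{O}(2n+k-1,1)$-frame $\Phi=(\mathbf{e}_1,\dots,\mathbf{e}_n,\mathbf{u}_1,\dots,\mathbf{u}_{n+k})$ such that 1. the $\mathbf{e}_i$ are principal curvature directions, $\mathbf{u}_i=v_i/(v_i,v_i)^{1/2}$ for $1\le i\le n$, and $(d\mathbf{u}_i,\mathbf{u}_j)=0$ if $n<i,j\le n+k$; 2. $\Phi^{-1}d\Phi=\sum_{i=1}^n(a_i+[a_i,\Xi])\,dx_i$. (ii) If $(v_n,v_n)<0$, then, locally on $M$, there exist line of curvature co-ordinates $(x_1,\dots,x_n)$, a solution $\Xi:M^n\to\mathfrak{a}_-^\perp\cap\mathfrak{p}$ of the $\frac{\mathrm{O}(2n+k-1,1)}{\mathrm{O}(n)\times\mathrm{O}(n+k-1,1)}$-system defined by $\mathfrak{a}_-$,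 and an $\mathrm{O}(2n+k-1,1)$-frame $\Phi=(\mathbf{e}_1,\dots,\mathbf{e}_n,\mathbf{u}_1,\dots,\mathbf{u}_{n+k})$ such that 1. the $\mathbf{e}_i$ are principal curvature directions, $\mathbf{u}_{k+i}=v_i/|(v_i,v_i)|^{1/2}$ for $1\le i\le n$, and $(d\mathbf{u}_i,\mathbf{u}_j)=0$ if $1\le i,j\le k$; 2. $\Phi^{-1}d\Phi=\sum_{i=1}^n(b_i+[b_i,\Xi])\,dx_i$. Moreover, in each case there is a constant null vector $\mathbf{c}\in\mathbb{R}^{n+k-1,1}$ such that $F=\Phi\begin{pmatrix}0\\ g_2^{-1}\mathbf{c}\end{pmatrix}$, where $g=\begin{pmatrix}g_1&0\\ 0&g_2\end{pmatrix}$, with values in $\mathrm{O}(n)\times\mathrm{O}(n+k-1,1)$, satisfies $g^{-1}dg=\sum_{i=1}^n[a_i,\Xi]\,dx_i$ in case (i) and $g^{-1}dg=\sum_{i=1}^n[b_i,\Xi]\,dx_i$ in case (ii).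
   Context: $\mathrm{I}_{m,1}=\operatorname{diag}(1,\dots,1,-1)$ (size $m+1$); $\mathbb{R}^{m,1}$ is $\mathbb{R}^{m+1}$ with $(x,y)=x^T\mathrm{I}_{m,1}y$; $\mathcal{L}^{2n+k-1,1}$ is the light-cone of $\mathbb{R}^{2n+k-1,1}$, $k\ge0$. Fix $t_0$ with $(t_0,t_0)=-1$; $S^{2n+k-2}$ is the unit sphere of the Euclidean space $t_0^\perp$. $f$ is conformally flat if $e^{2u}\mathrm{I}_f$ is flat for some function $u$; a flat lift of $f$ is a map $F$ into the light-cone with $f+t_0\in\langle F\rangle$ and flat induced metric. $N_F$ is the normal bundle of $F$ in $M\times\mathbb{R}^{2n+k-1,1}$. For flat normal bundle, curvature distributions are common eigenspaces $E_i$ of all shape operators $A_v$ ($A_v$ = tangential part of $-dv$), and curvature normals are defined by $A_v|_{E_i}=(v,v_i)\operatorname{Id}$. Uniform multiplicity one: the curvature distributions have constant ranks, all equal to one. $N_v$ is the subbundle spanned by the curvature normals and $N_v^\perp$ its orthogonal complement in $N_F$. Line of curvature co-ordinates: $\partial/\partial x_i\in E_i$. Let $J=\mathrm{I}_{n+k-1,1}$. The symmetric space $\frac{\mathrm{O}(2n+k-1,1)}{\mathrm{O}(n)\times\mathrm{O}(n+k-1,1)}$ has $\mathfrak{k}=\mathfrak{o}(n)\times\mathfrak{o}(n+k-1,1)$ and $\mathfrak{p}=\left\{\begin{pmatrix}0&\xi\\ -J\xi^T&0\end{pmatrix}:\xi\text{ an }n\times(n+k)\text{ real matrix}\right\}$.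 With $e_{ij}$ the elementary $(2n+k)\times(2n+k)$ matrices and $\epsilon_i=1$ for $i<n$, $\epsilon_n=-1$, put $a_i=e_{i,n+i}-e_{n+i,i}$ (used when $k\ge1$), $\mathfrak{a}_+=\langle a_1,\dots,a_n\rangle$ and $b_i=e_{i,n+k+i}-\epsilon_ie_{n+k+i,i}$, $\mathfrak{a}_-=\langle b_1,\dots,b_n\rangle$; these are maximal abelian subalgebras of $\mathfrak{p}$. With $\perp$ taken for the Killing form, $\mathfrak{a}_+^\perp\cap\mathfrak{p}$ consists of the elements of $\mathfrak{p}$ with $\xi_{ii}=0$, and $\mathfrak{a}_-^\perp\cap\mathfrak{p}$ of those with $\xi_{i,k+i}=0$, $1\le i\le n$. The system defined by a maximal abelian subalgebra of $\mathfrak{p}$ with basis $c_1,\dots,c_n$ is, for $\Xi$ with values in its orthogonal complement in $\mathfrak{p}$, $[c_i,\Xi_{x_j}]-[c_j,\Xi_{x_i}]-[[c_i,\Xi],[c_j,\Xi]]=0$, $i\ne j$. *)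

(* Defs.v *)
From HB Require Import structures.
From mathcomp Require Import all_boot all_order all_algebra.
From mathcomp Require Import all_classical all_reals all_analysis.

Set Implicit Arguments.
Unset Strict Implicit.
Unset Printing Implicit Defensive.

Import Order.TTheory GRing.Theory Num.Theory.
Import numFieldNormedType.Exports.

Local Open Scope classical_set_scope.
Local Open Scope ring_scope.

(** * Lorentzian linear algebra *)

(** I_(m-1,1) = diag(1, ..., 1, -1), indexed by its size m. *)
Definition lorentz (R : realType) (m : nat) : 'M[R]_m :=
  diag_mx (\row_(i < m) (if i.+1 == m then -1 else 1)).

Definition mink (R : realType) (m : nat) (x y : 'cV[R]_m) : R :=
  (x^T *m lorentz R m *m y) 0 0.

Definition light_cone (R : realType) (m : nat) : set 'cV[R]_m :=
  [set y | y != 0 /\ mink y y = 0].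

(** The group O(m-1,1). *)
Definition lorentz_group (R : realType) (m : nat) : set 'M[R]_m :=
  [set P | P^T *m lorentz R m *m P = lorentz R m].

Definition orthogonal_group (R : realType) (m : nat) : set 'M[R]_m :=
  [set P | P^T *m P = 1%:M].

Definition bracket (R : realType) (m : nat) (X Y : 'M[R]_m) : 'M[R]_m :=
  X *m Y - Y *m X.

(** * Smooth maps on open subsets of R^n *)

Definition partial (R : realType) (n : nat) (W : normedModType R) (i : 'I_n)
    (h : 'rV[R]_n -> W) : 'rV[R]_n -> W :=
  fun x => 'D_(delta_mx 0 i) h x.

Fixpoint class_C (R : realType) (n : nat) (W : normedModType R) (r : nat)
    (D : set 'rV[R]_n) (h : 'rV[R]_n -> W) : Prop :=
  match r with
  | 0 => forall x, D x -> {for x, continuous h}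
  | r'.+1 => (forall x, D x -> differentiable h x) /\
             (forall i, class_C r' D (partial i h))
  end.

(** Meaningful for open D; only the values of h on D matter. *)
Definition smooth_on (R : realType) (n : nat) (W : normedModType R)
    (D : set 'rV[R]_n) (h : 'rV[R]_n -> W) : Prop :=
  forall r, class_C r D h.

(** * Smooth manifolds *)

(** [cmap] is only used on [cdom], and [cinv] only on [cimg]. *)
Record chart (R : realType) (n : nat) (M : topologicalType) := Chart {
  cdom : set M;
  cmap : M -> 'rV[R]_n;
  cinv : 'rV[R]_n -> M }.

Definition cimg (R : realType) (n : nat) (M : topologicalType)
    (c : chart R n M) : set 'rV[R]_n := cmap c @` cdom c.

Definition is_chart (R : realType) (n : nat) (M : topologicalType)
    (c : chart R n M) : Prop :=
  [/\ open (cdom c), open (cimg c),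
      {within cdom c, continuous (cmap c)},
      {within cimg c, continuous (cinv c)} &
      forall p, cdom c p -> cinv c (cmap c p) = p].

Definition smooth_transition (R : realType) (n : nat) (M : topologicalType)
    (c c' : chart R n M) : Prop :=
  smooth_on (cmap c @` (cdom c `&` cdom c')) (cmap c' \o cinv c).

Definition smooth_manifold (R : realType) (n : nat) (M : topologicalType)
    (A : set (chart R n M)) : Prop :=
  [/\ hausdorff_space M, @second_countable M,
      forall c, A c -> is_chart c,
      forall p : M, exists2 c, A c & cdom c p &
      forall c c', A c -> A c' -> smooth_transition c c'].

(** Local co-ordinates, i.e. a chart of the maximal atlas. *)
Definition coordinates (R : realType) (n : nat) (M : topologicalType)
    (A : set (chart R n M)) (c : chart R n M) : Prop :=
  is_chart c /\
  forall c', A c' -> smooth_transition c c' /\ smooth_transition c' c.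

Definition smooth_map (R : realType) (n : nat) (M : topologicalType)
    (A : set (chart R n M)) (W : normedModType R) (h : M -> W) : Prop :=
  forall c, A c -> smooth_on (cimg c) (h \o cinv c).

(** * Flat metrics, in co-ordinates *)

(** The (l, j) entry of [christoffel gm i] is Gamma^l_(ij). *)
Definition christoffel (R : realType) (n : nat) (gm : 'rV[R]_n -> 'M[R]_n)
    (i : 'I_n) (x : 'rV[R]_n) : 'M[R]_n :=
  invmx (gm x) *m \matrix_(l, j) (2^-1 *
    (partial i (fun y => gm y j l) x + partial j (fun y => gm y i l) x
     - partial l (fun y => gm y i j) x)).

(** The Riemann tensor R(d_i, d_j) of the Levi-Civita connection vanishes. *)
Definition flat_metric (R : realType) (n : nat) (D : set 'rV[R]_n)
    (gm : 'rV[R]_n -> 'M[R]_n) : Prop :=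
  forall x, D x -> forall i j : 'I_n,
    partial i (christoffel gm j) x - partial j (christoffel gm i) x
    + bracket (christoffel gm i x) (christoffel gm j x) = 0.

Definition induced_metric (R : realType) (n N : nat)
    (X : 'rV[R]_n -> 'cV[R]_N) (x : 'rV[R]_n) : 'M[R]_n :=
  \matrix_(i, j) mink (partial i X x) (partial j X x).

(** * Extrinsic geometry of X : D -> R^(N-1,1), D open in R^n *)

Definition tangent_space (R : realType) (n N : nat)
    (X : 'rV[R]_n -> 'cV[R]_N) (x : 'rV[R]_n) : set 'cV[R]_N :=
  [set y | exists a : 'rV[R]_n, y = 'D_a X x].

Definition normal_space (R : realType) (n N : nat)
    (X : 'rV[R]_n -> 'cV[R]_N) (x : 'rV[R]_n) : set 'cV[R]_N :=
  [set y | forall a : 'rV[R]_n, mink y ('D_a X x) = 0].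

Definition section_of (R : realType) (n N : nat) (D : set 'rV[R]_n)
    (V : 'rV[R]_n -> set 'cV[R]_N) (s : 'rV[R]_n -> 'cV[R]_N) : Prop :=
  smooth_on D s /\ forall x, D x -> V x (s x).

(** t is the covariant derivative of s along d_i for the connection induced on
    the subbundle V of D x R^(N-1,1): the V-component of the derivative of s. *)
Definition induced_derivative (R : realType) (n N : nat) (D : set 'rV[R]_n)
    (V : 'rV[R]_n -> set 'cV[R]_N) (i : 'I_n) (s t : 'rV[R]_n -> 'cV[R]_N) :
    Prop :=
  section_of D V t /\
  forall x, D x -> forall w, V x w -> mink (partial i s x - t x) w = 0.

(** Vanishing curvature; [d_i, d_j] = 0, so there is no bracket term. *)
Definition flat_connection (R : realType) (n N : nat) (D : set 'rV[R]_n)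
    (V : 'rV[R]_n -> set 'cV[R]_N) : Prop :=
  forall (i j : 'I_n) (s si sj sij sji : 'rV[R]_n -> 'cV[R]_N),
    section_of D V s ->
    induced_derivative D V i s si -> induced_derivative D V j s sj ->
    induced_derivative D V i sj sij -> induced_derivative D V j si sji ->
    forall x, D x -> sij x = sji x.

(** t = dX(A_s a) for a normal field s and a tangent vector a at x:
    t is the tangential part of - ds(a). *)
Definition shape_operator (R : realType) (n N : nat)
    (X s : 'rV[R]_n -> 'cV[R]_N) (x a : 'rV[R]_n) (t : 'cV[R]_N) : Prop :=
  tangent_space X x t /\ normal_space X x (- 'D_a s x - t).

(** The common eigenspace at x of the shape operators with A_s = (s, w) Id. *)
Definition common_eigenspace (R : realType) (n N : nat) (D : set 'rV[R]_n)
    (X w : 'rV[R]_n -> 'cV[R]_N) (x : 'rV[R]_n) : set 'rV[R]_n :=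
  [set a | forall s, section_of D (normal_space X) s ->
     shape_operator X s x a (mink (s x) (w x) *: 'D_a X x)].

(** * Flat lifts *)

Definition spherical_immersion (R : realType) (n N : nat) (M : topologicalType)
    (A : set (chart R n M)) (t0 : 'cV[R]_N) (f : M -> 'cV[R]_N) : Prop :=
  [/\ smooth_map A f,
      forall p, mink (f p) t0 = 0 /\ mink (f p) (f p) = 1 &
      forall c, A c -> forall x, cimg c x ->
        forall a, 'D_a (f \o cinv c) x = 0 -> a = 0].

Definition conformally_flat (R : realType) (n N : nat) (M : topologicalType)
    (A : set (chart R n M)) (f : M -> 'cV[R]_N) : Prop :=
  exists2 u : M -> R, smooth_map A u &
    forall c, A c -> flat_metric (cimg c)
      (fun x => expR (2 * u (cinv c x)) *: induced_metric (f \o cinv c) x).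

Definition flat_lift (R : realType) (n N : nat) (M : topologicalType)
    (A : set (chart R n M)) (t0 : 'cV[R]_N) (f F : M -> 'cV[R]_N) : Prop :=
  [/\ smooth_map A F,
      forall p, light_cone (F p),
      forall p, exists r : R, f p + t0 = r *: F p &
      forall c, A c -> flat_metric (cimg c) (induced_metric (F \o cinv c))].

Definition flat_normal_bundle (R : realType) (n N : nat) (M : topologicalType)
    (A : set (chart R n M)) (F : M -> 'cV[R]_N) : Prop :=
  forall c, A c -> flat_connection (cimg c) (normal_space (F \o cinv c)).

(** The v_i are the curvature normals of F and every curvature distribution
    has rank one.  Eigenspaces belonging to distinct v_i are independent, so n
    of them exhaust the tangent space. *)
Definition uniform_multiplicity_one (R : realType) (n N : nat)
    (M : topologicalType) (A : set (chart R n M)) (F : M -> 'cV[R]_N)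
    (v : 'I_n -> M -> 'cV[R]_N) : Prop :=
  [/\ forall i, smooth_map A (v i),
      forall p i j, i != j -> v i p <> v j p &
      forall c, A c -> forall x, cimg c x -> forall i,
        normal_space (F \o cinv c) x (v i (cinv c x)) /\
        exists2 a : 'rV[R]_n, a != 0 &
          common_eigenspace (cimg c) (F \o cinv c) (v i \o cinv c) x =
          [set b | exists r : R, b = r *: a]].

(** The orthogonal complement of N_v = <v_1, ..., v_n> in the normal bundle. *)
Definition curvature_normals_complement (R : realType) (n N : nat)
    (X : 'rV[R]_n -> 'cV[R]_N) (w : 'I_n -> 'rV[R]_n -> 'cV[R]_N)
    (x : 'rV[R]_n) : set 'cV[R]_N :=
  [set y | normal_space X x y /\ forall i, mink y (w i x) = 0].

Definition flat_complement (R : realType) (n N : nat) (M : topologicalType)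
    (A : set (chart R n M)) (F : M -> 'cV[R]_N) (v : 'I_n -> M -> 'cV[R]_N) :
    Prop :=
  forall c, A c -> flat_connection (cimg c)
    (curvature_normals_complement (F \o cinv c) (fun i => v i \o cinv c)).

(** Co-ordinates c with d/dx_i in the i-th curvature distribution. *)
Definition line_of_curvature_coordinates (R : realType) (n N : nat)
    (M : topologicalType) (A : set (chart R n M)) (F : M -> 'cV[R]_N)
    (v : 'I_n -> M -> 'cV[R]_N) (c : chart R n M) : Prop :=
  coordinates A c /\
  forall x, cimg c x -> forall i,
    common_eigenspace (cimg c) (F \o cinv c) (v i \o cinv c) x (delta_mx 0 i).

(** * The symmetric space O(2n+k-1,1) / O(n) x O(n+k-1,1) *)

(** The index n + i (counted from 1) of the (2n+k)-dimensional space, i <= n+k. *)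
Definition nidx (n k : nat) (i : 'I_(n + k)) : 'I_(n + (n + k)) := rshift n i.

(** The index k + i (counted from 1) of the (n+k)-dimensional space, i <= n. *)
Definition kidx (n k : nat) (i : 'I_n) : 'I_(n + k) :=
  cast_ord (addnC k n) (rshift k i).

Definition pmat (R : realType) (n k : nat) (xi : 'M[R]_(n, n + k)) :
    'M[R]_(n + (n + k)) :=
  block_mx 0 xi (- (lorentz R (n + k) *m xi^T)) 0.

Definition a_basis (R : realType) (n k : nat) (i : 'I_n) :
    'M[R]_(n + (n + k)) :=
  delta_mx (lshift (n + k) i) (nidx (lshift k i))
  - delta_mx (nidx (lshift k i)) (lshift (n + k) i).

Definition eps (R : realType) (n : nat) (i : 'I_n) : R :=
  if i.+1 == n then -1 else 1.

Definition b_basis (R : realType) (n k : nat) (i : 'I_n) :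
    'M[R]_(n + (n + k)) :=
  delta_mx (lshift (n + k) i) (nidx (kidx k i))
  - eps R i *: delta_mx (nidx (kidx k i)) (lshift (n + k) i).

(** The orthogonal complements in p, for the Killing form, of the spans of
    [a_basis] and of [b_basis]. *)
Definition a_perp (R : realType) (n k : nat) : set 'M[R]_(n + (n + k)) :=
  [set Z | exists2 xi : 'M[R]_(n, n + k),
     forall i : 'I_n, xi i (lshift k i) = 0 & Z = pmat xi].

Definition b_perp (R : realType) (n k : nat) : set 'M[R]_(n + (n + k)) :=
  [set Z | exists2 xi : 'M[R]_(n, n + k),
     forall i : 'I_n, xi i (kidx k i) = 0 & Z = pmat xi].

(** Xi is a smooth solution, with values in [perp], of the system defined by
    the abelian subalgebra with basis e. *)
Definition solves_system (R : realType) (n m : nat) (D : set 'rV[R]_n)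
    (e : 'I_n -> 'M[R]_m) (perp : set 'M[R]_m) (Xi : 'rV[R]_n -> 'M[R]_m) :
    Prop :=
  [/\ smooth_on D Xi,
      forall x, D x -> perp (Xi x) &
      forall x, D x -> forall i j : 'I_n, i != j ->
        bracket (e i) (partial j Xi x) - bracket (e j) (partial i Xi x)
        - bracket (bracket (e i) (Xi x)) (bracket (e j) (Xi x)) = 0].

Definition lorentz_frame (R : realType) (n m : nat) (D : set 'rV[R]_n)
    (Phi : 'rV[R]_n -> 'M[R]_m) : Prop :=
  smooth_on D Phi /\ forall x, D x -> lorentz_group (Phi x).

(** The columns of Phi = (e_1, ..., e_n, u_1, ..., u_(n+k)). *)
Definition frame_e (R : realType) (n k : nat)
    (Phi : 'rV[R]_n -> 'M[R]_(n + (n + k))) (i : 'I_n) (x : 'rV[R]_n) :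
    'cV[R]_(n + (n + k)) := col (lshift (n + k) i) (Phi x).

Definition frame_u (R : realType) (n k : nat)
    (Phi : 'rV[R]_n -> 'M[R]_(n + (n + k))) (i : 'I_(n + k)) (x : 'rV[R]_n) :
    'cV[R]_(n + (n + k)) := col (nidx i) (Phi x).

(** Each e_i is tangent to the i-th curvature distribution of X. *)
Definition principal_directions (R : realType) (n k : nat) (D : set 'rV[R]_n)
    (X : 'rV[R]_n -> 'cV[R]_(n + (n + k)))
    (w : 'I_n -> 'rV[R]_n -> 'cV[R]_(n + (n + k)))
    (Phi : 'rV[R]_n -> 'M[R]_(n + (n + k))) : Prop :=
  forall x, D x -> forall i : 'I_n,
    exists2 a, common_eigenspace D X (w i) x a & frame_e Phi i x = 'D_a X x.

(** g = diag(g1, g2) takes values in O(n) x O(n+k-1,1) and g^-1 dg is the sum of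
    the [e_i, Xi] dx_i. *)
Definition trivializing_gauge (R : realType) (n k : nat) (D : set 'rV[R]_n)
    (e : 'I_n -> 'M[R]_(n + (n + k))) (Xi : 'rV[R]_n -> 'M[R]_(n + (n + k)))
    (g1 : 'rV[R]_n -> 'M[R]_n) (g2 : 'rV[R]_n -> 'M[R]_(n + k)) : Prop :=
  let g x := block_mx (g1 x) 0 0 (g2 x) in
  [/\ smooth_on D g1, smooth_on D g2,
      forall x, D x -> orthogonal_group (g1 x) /\ lorentz_group (g2 x) &
      forall x, D x -> forall i : 'I_n,
        invmx (g x) *m partial i g x = bracket (e i) (Xi x)].

(** g is determined up to left multiplication by a constant, which changes the
    constant null vector c accordingly; hence c is asserted for every g. *)
Definition recovers_lift (R : realType) (n k : nat) (D : set 'rV[R]_n)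
    (e : 'I_n -> 'M[R]_(n + (n + k))) (Xi Phi : 'rV[R]_n -> 'M[R]_(n + (n + k)))
    (X : 'rV[R]_n -> 'cV[R]_(n + (n + k))) : Prop :=
  (exists g1 g2, trivializing_gauge D e Xi g1 g2) /\
  forall g1 g2, trivializing_gauge D e Xi g1 g2 ->
    exists2 c : 'cV[R]_(n + k), light_cone c &
      forall x, D x -> X x = Phi x *m col_mx 0 (invmx (g2 x) *m c).

(* Main.v *)
Require Import Defs.
From HB Require Import structures.
From mathcomp Require Import all_boot all_order all_algebra.
From mathcomp Require Import all_classical all_reals all_analysis.
From mathcomp Require Import ring lra zify.

Set Implicit Arguments.
Unset Strict Implicit.
Unset Printing Implicit Defensive.

Import Order.TTheory GRing.Theory Num.Theory.
Import numFieldNormedType.Exports.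

Local Open Scope classical_set_scope.
Local Open Scope ring_scope.

(** By Gauss' equation and flatness of the induced metric, the curvature normals
    of F are mutually orthogonal, and differentiating (F, F) = 0 gives
    (F, v_i) = -1, so no v_i vanishes.  Principal unit vectors e_i, the
    normalised v_i and a parallel frame of the flat bundle N_v^perp make up a
    Lorentz frame Phi.  The Maurer-Cartan equations of Phi show that the 1-forms
    dual to the e_i, rescaled by |v_i|, are closed: they integrate to
    co-ordinates, in which the p-part of Phi^-1 dPhi is the constant form
    sum e_i dx_i.  The same equations then force the k-part to be
    sum [e_i, Xi] dx_i, and become the system for Xi.  Since the k-part is flat
    it is g^-1 dg for some g, and g_2 times the normal component of Phi^-1 F is
    constant. *)

(** * Differentiability and smoothness through coordinates *)

(** With zero intrinsic curvature, Gauss' equation reads |e_i|^2 |e_j|^2 (v_i, v_j) = |II(e_i,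
    e_j)|^2, and the right side vanishes. The form |v_j| theta_j is the (e_j, u_j) entry of the
    Maurer-Cartan form. It is closed because the tangent-normal block has no other nonzero entry in
    that row or column, while diagonal entries vanish by skewness, so no quadratic term survives.
    The obstacle is smoothness: curvature directions are given only point by point. The tensor
    theta_i theta_i = (v_i, II) / (v_i, v_i) is smooth, and theta_i is recovered from it locally as
    a square root. All integrations take place on balls: primitives by the cone construction, dg = g
    A by a Picard iteration, co-ordinates by a local inverse. Both cases run through one injection
    [sg], sending i to the normal slot of v_i, whose sign is that of (v_i, v_i). In the first case
    the timelike slot must lie outside its image, that is k >= 1. This holds because F + sum v_i /
    (v_i, v_i) is normal, timelike and orthogonal to every v_i. *)

(* A locked copy of [partial]: comparing two iterated partial derivatives would
   otherwise unfold them down to limits of filters. *)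
Fact pd_key : unit. Proof. exact: tt. Qed.
Definition pd := locked_with pd_key (@partial).
Arguments pd {R n W} i h x.

Lemma pdE (R : realType) (n : nat) (W : normedModType R) (i : 'I_n)
  (h : 'rV[R]_n -> W) : partial i h = pd i h.
Proof. by rewrite /pd unlock. Qed.

Lemma pdD (R : realType) (n : nat) (W : normedModType R) (i : 'I_n)
  (h : 'rV[R]_n -> W) x : pd i h x = 'D_(delta_mx 0 i) h x.
Proof. by rewrite -pdE. Qed.

(** * First-order expansions with prescribed partial derivatives *)

Section Differentiability.
Context {R : realType} {n : nat}.
Implicit Types (f g : 'rV[R]_n -> R) (x h : 'rV[R]_n) (c : 'I_n -> R).

Definition lin_form c h : R := \sum_i h 0 i * c i.

Lemma lin_form_is_linear c : linear (lin_form c : 'rV[R]_n -> R).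
Proof.
move=> a u v; rewrite /lin_form scaler_sumr -big_split /=.
by apply: eq_bigr => i _; rewrite !mxE mulrDl -mulrA.
Qed.

HB.instance Definition _ c :=
  GRing.isLinear.Build R 'rV[R]_n R _ (lin_form c) (lin_form_is_linear c).

Lemma continuous_lin_form c : continuous (lin_form c).
Proof.
move=> x; apply: differentiable_continuous.
rewrite (_ : _ _ = \sum_(i < n) (fun h : 'rV[R]_n => h 0 i * c i)); last first.
  by rewrite fct_sumE.
apply: differentiable_sum => i; apply: differentiableM => //.
exact: differentiable_coord.
Qed.

Lemma coord_norm_le (p q : nat) (h : 'M[R]_(p, q)) i j : `|h i j| <= `|h|.
Proof.
by rewrite [leRHS]/Num.Def.normr/= mx_normrE (le_bigmax _ (fun ij => `|h ij.1 ij.2|) (i, j)).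
Qed.

Lemma mx_norm_le (p q : nat) (h : 'M[R]_(p, q)) (e : R) : 0 <= e ->
  (forall i j, `|h i j| <= e) -> `|h| <= e.
Proof.
move=> e0 he; rewrite [leLHS]/Num.Def.normr/= mx_normrE.
by apply: bigmax_le => // -[i j] _; exact: he.
Qed.

Lemma mx_norm_lt (p q : nat) (h : 'M[R]_(p, q)) (e : R) : 0 < e ->
  (forall i j, `|h i j| < e) -> `|h| < e.
Proof.
move=> e0 he; rewrite [ltLHS]/Num.Def.normr/= mx_normrE.
by apply/bigmax_ltP; split => // -[i j] _; exact: he.
Qed.

Lemma lin_form_le c (M : R) h : (forall i, `|c i| <= M) ->
  `|lin_form c h| <= n%:R * M * `|h|.
Proof.
move=> cM; rewrite /lin_form (le_trans (ler_norm_sum _ _ _))//.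
rewrite -mulrA -[n in n%:R]card_ord mulr_natl -sumr_const; apply: ler_sum => i _.
by rewrite normrM mulrC ler_pM// coord_norm_le.
Qed.

Lemma differentiable_lin_formP f x c :
  (forall e, 0 < e -> exists2 d, 0 < d & forall h, `|h| < d ->
     `|f (x + h) - f x - lin_form c h| <= e * `|h|) ->
  differentiable f x /\ 'd f x = lin_form c :> (_ -> _).
Proof.
move=> fc.
have fE (L : 'rV[R]_n -> R) : L = lin_form c -> forall e : R, 0 < e ->
    \forall h \near (0 : 'rV[R]_n),
      `|f (h + x) - (f x + L h)| <= e * `|h|.
  move=> -> e e0; have [d d0 de] := fc e e0.
  apply/nbhs_ballP; exists d => //= h; rewrite -ball_normE/= sub0r normrN => hd.
  by rewrite opprD addrA [h + x]addrC; exact: de.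
have dE : 'd f x = lin_form c :> (_ -> _).
  apply: diff_unique; first exact: continuous_lin_form.
  by apply/eqaddoP => e e0; exact: (fE _ erefl).
split=> //; apply/diff_locallyP; split.
  by rewrite dE; exact: continuous_lin_form.
by apply/eqaddoP => e e0; exact: (fE _ dE).
Qed.

Lemma row_sum_partial x : x = \sum_i x 0 i *: delta_mx 0 i.
Proof. exact: row_sum_delta. Qed.

Lemma deriv_partial (W : normedModType R) (f : 'rV[R]_n -> W) x h :
  differentiable f x -> 'D_h f x = \sum_i h 0 i *: pd i f x.
Proof.
move=> df; rewrite deriveE // {1}(row_sum_delta h) linear_sum /=.
by apply: eq_bigr => i _; rewrite linearZ !pdD deriveE.
Qed.

Lemma deriv_lin_form f x h :
  differentiable f x -> 'D_h f x = lin_form (fun i => pd i f x) h.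
Proof. exact: deriv_partial. Qed.

Lemma differentiable_eps f x : differentiable f x ->
  forall e, 0 < e -> exists2 d, 0 < d & forall h, `|h| < d ->
     `|f (x + h) - f x - lin_form (fun i => pd i f x) h| <= e * `|h|.
Proof.
move=> df e e0; have := diff_locally df => /eqaddoP/(_ e e0)/nbhs_ballP[d d0 de].
exists d => // h hd; have := de h; rewrite -ball_normE/= sub0r normrN => /(_ hd).
rewrite !fctE /= opprD addrA [h + x]addrC -deriveE// deriv_lin_form//.
Qed.

(** Radial integrals, uniform limits and local inverses are all differentiated through this
    criterion: their candidate partial derivatives are known in advance and only the error estimate
    is left. *)
Lemma differentiable_formP f x c :
  (forall e, 0 < e -> exists2 d, 0 < d & forall h, `|h| < d ->
     `|f (x + h) - f x - lin_form c h| <= e * `|h|) ->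
  differentiable f x /\ forall i, pd i f x = c i.
Proof.
move=> /differentiable_lin_formP [df dE]; split=> // i.
rewrite !pdD deriveE// dE /lin_form (bigD1 i)//= big1 ?addr0.
  by rewrite mxE !eqxx mul1r.
by move=> j ji; rewrite mxE (negbTE ji) andbF mul0r.
Qed.

Lemma differentiable_near_eq f g x :
  {near x, f =1 g} -> differentiable f x -> differentiable g x.
Proof.
move=> fg df.
have [] // := @differentiable_formP g x (fun i => pd i f x).
move=> e e0; have [d d0 de] := differentiable_eps df e0.
have /nbhs_ballP[d' /= d'0 d'e] := fg.
exists (Num.min d d'); first by rewrite lt_min d0.
move=> h; rewrite lt_min => /andP[hd hd'].
rewrite -(d'e (x + h)) -?(d'e x); last 2 first.
- exact: ballxx.
- by rewrite -ball_normE/= opprD addNKr normrN.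
exact: de.
Qed.

End Differentiability.

(** * Scalar functions of class C^r *)

Section SmoothScalar.
Context {R : realType} {n : nat}.
Implicit Types (D : set 'rV[R]_n) (f g : 'rV[R]_n -> R) (x : 'rV[R]_n).

Lemma open_near_eq (T : Type) D (f g : 'rV[R]_n -> T) x :
  open D -> (forall y, D y -> f y = g y) -> D x -> {near x, f =1 g}.
Proof.
by move=> oD fg Dx; apply: filterS (open_nbhs_nbhs (conj oD Dx)) => y; exact: fg.
Qed.

Lemma partial_eq_on (W : normedModType R) D (f g : 'rV[R]_n -> W) i x :
  open D -> (forall y, D y -> f y = g y) -> D x -> pd i f x = pd i g x.
Proof. by move=> oD fg Dx; rewrite !pdD; apply: near_eq_derive; exact: open_near_eq Dx. Qed.

(** Unfolds one order of regularity with the locked [pd] in place of [partial], which keeps the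
    limits out of the inductions below. *)
Lemma class_CSP (W : normedModType R) r D (h : 'rV[R]_n -> W) :
  class_C r.+1 D h <->
  (forall x, D x -> differentiable h x) /\ forall i, class_C r D (pd i h).
Proof.
by split=> -[hd hp]; split=> // i; have := hp i; rewrite pdE.
Qed.

Lemma class_C_subset (W : normedModType R) r D D' (h : 'rV[R]_n -> W) :
  D' `<=` D -> class_C r D h -> class_C r D' h.
Proof.
move=> sD; elim: r h => [|r IH] h /=; first by move=> hc x /sD; exact: hc.
by move=> [hd hp]; split=> [x /sD|i]; [exact: hd | exact: IH].
Qed.

Lemma smooth_on_subset (W : normedModType R) D D' (h : 'rV[R]_n -> W) :
  D' `<=` D -> smooth_on D h -> smooth_on D' h.
Proof. by move=> sD hs r; exact: class_C_subset (hs r). Qed.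

Lemma class_CS (W : normedModType R) r D (h : 'rV[R]_n -> W) :
  class_C r.+1 D h -> class_C r D h.
Proof.
elim: r h => [|r IH] h /class_CSP[hd hp].
  by move=> x Dx; apply: differentiable_continuous; exact: hd.
by apply/class_CSP; split=> // i; apply: IH; exact: hp.
Qed.

Lemma smooth_onP (W : normedModType R) D (h : 'rV[R]_n -> W) :
  smooth_on D h <-> (forall x, D x -> differentiable h x) /\
                    forall i, smooth_on D (pd i h).
Proof.
split=> [hs|[hd hp] [|r]].
- by split=> [|i r]; [exact: (hs 1).1|exact: ((class_CSP _ _ _).1 (hs r.+1)).2].
- by move=> x Dx; apply: differentiable_continuous; exact: hd.
- by apply/class_CSP; split=> // i; exact: hp.
Qed.

Lemma smooth_differentiable (W : normedModType R) D (h : 'rV[R]_n -> W) x :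
  smooth_on D h -> D x -> differentiable h x.
Proof. by move=> /smooth_onP[+ _]; exact. Qed.

Lemma smooth_continuous (W : normedModType R) D (h : 'rV[R]_n -> W) x :
  smooth_on D h -> D x -> {for x, continuous h}.
Proof. by move=> hs Dx; exact: (hs 0). Qed.

Lemma smooth_partial (W : normedModType R) D (h : 'rV[R]_n -> W) i :
  smooth_on D h -> smooth_on D (pd i h).
Proof. by move=> /smooth_onP[_]. Qed.

Lemma class_C_eq r D f g :
  open D -> (forall x, D x -> f x = g x) -> class_C r D f -> class_C r D g.
Proof.
move=> oD; elim: r f g => [|r IH] f g fg.
  move=> fc x Dx; suff : g @ x --> f x by rewrite fg.
  apply: cvg_trans (fc x Dx); apply: near_eq_cvg; first exact: nbhs_filter.
  exact: open_near_eq Dx.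
move=> /class_CSP[fd fp]; apply/class_CSP; split=> [x Dx|i].
  by apply: differentiable_near_eq (fd x Dx); exact: open_near_eq Dx.
apply: IH (fp i) => x Dx; exact: partial_eq_on Dx.
Qed.

Lemma smooth_on_eq D f g :
  open D -> (forall x, D x -> f x = g x) -> smooth_on D f -> smooth_on D g.
Proof. by move=> oD fg fs r; exact: class_C_eq (fs r). Qed.

Lemma class_C_cst r D (a : R) : open D -> class_C r D (fun=> a).
Proof.
move=> oD; elim: r a => [|r IH] a; first by move=> x _; exact: cst_continuous.
apply/class_CSP; split=> [x _|i]; first exact: differentiable_cst.
by apply: class_C_eq (IH 0) => // x _; rewrite !pdD derive_cst.
Qed.

(** The common induction step: the rules for products, inverses, roots and compositions give
    formulas [df] for the partials that are valid on D only, which is enough because D is open. *)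
Lemma class_C_partial_eq r D f (df : 'I_n -> 'rV[R]_n -> R) :
  open D -> (forall x, D x -> differentiable f x) ->
  (forall i x, D x -> pd i f x = df i x) ->
  (forall i, class_C r D (df i)) -> class_C r.+1 D f.
Proof.
move=> oD fd fdf dfr; apply/class_CSP; split=> // i.
by apply: class_C_eq (dfr i) => // x Dx; rewrite fdf.
Qed.

Lemma partialD f g i x : differentiable f x -> differentiable g x ->
  pd i (fun y => f y + g y) x = pd i f x + pd i g x.
Proof. by move=> df dg; rewrite !pdD deriveD//; exact: diff_derivable. Qed.

Lemma partialM f g i x : differentiable f x -> differentiable g x ->
  pd i (fun y => f y * g y) x = pd i f x * g x + f x * pd i g x.
Proof.
move=> df dg; rewrite !pdD deriveM; [|exact: diff_derivable..].
by rewrite addrC; congr (_ + _); exact: mulrC.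
Qed.

Lemma class_CD r D f g : open D ->
  class_C r D f -> class_C r D g -> class_C r D (fun x => f x + g x).
Proof.
move=> oD; elim: r f g => [|r IH] f g.
  by move=> fc gc x Dx; exact: (continuousD (fc x Dx) (gc x Dx)).
move=> /class_CSP[fd fp] /class_CSP[gd gp];
  apply: (class_C_partial_eq (df := fun i x => pd i f x + pd i g x)) => //.
- by move=> x Dx; apply: differentiableD; [exact: fd|exact: gd].
- by move=> i x Dx; rewrite partialD//; [exact: fd|exact: gd].
- by move=> i; exact: (IH _ _ (fp i) (gp i)).
Qed.

Lemma class_CM r D f g : open D ->
  class_C r D f -> class_C r D g -> class_C r D (fun x => f x * g x).
Proof.
move=> oD; elim: r f g => [|r IH] f g.
  by move=> fc gc x Dx; exact: (continuousM (fc x Dx) (gc x Dx)).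
move=> fC gC; have /class_CSP[fd fp] := fC; have /class_CSP[gd gp] := gC.
apply: (class_C_partial_eq
  (df := fun i x => pd i f x * g x + f x * pd i g x)) => //.
- by move=> x Dx; apply: differentiableM; [exact: fd|exact: gd].
- by move=> i x Dx; rewrite partialM//; [exact: fd|exact: gd].
- move=> i; apply: class_CD => //; first exact: IH (fp i) (class_CS gC).
  exact: IH (class_CS fC) (gp i).
Qed.

Lemma class_C_sum r D (I : Type) (s : seq I) (P : pred I) (F : I -> 'rV[R]_n -> R) :
  open D -> (forall i, P i -> class_C r D (F i)) ->
  class_C r D (fun x => \sum_(i <- s | P i) F i x).
Proof.
move=> oD Fs; elim: s => [|a s IH].
  by apply: class_C_eq (class_C_cst r 0 oD) => // x _; rewrite big_nil.
case Pa : (P a); last by apply: class_C_eq IH => // x _; rewrite big_cons Pa.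
apply: class_C_eq (class_CD oD (Fs a Pa) IH) => // x _.
by rewrite big_cons Pa.
Qed.

Lemma class_C_prod r D (I : Type) (s : seq I) (P : pred I) (F : I -> 'rV[R]_n -> R) :
  open D -> (forall i, P i -> class_C r D (F i)) ->
  class_C r D (fun x => \prod_(i <- s | P i) F i x).
Proof.
move=> oD Fs; elim: s => [|a s IH].
  by apply: class_C_eq (class_C_cst r 1 oD) => // x _; rewrite big_nil.
case Pa : (P a); last by apply: class_C_eq IH => // x _; rewrite big_cons Pa.
apply: class_C_eq (class_CM oD (Fs a Pa) IH) => // x _.
by rewrite big_cons Pa.
Qed.

Lemma partialV f i x : differentiable f x -> f x != 0 ->
  pd i (fun y => (f y)^-1) x = - pd i f x * ((f x)^-1 * (f x)^-1).
Proof.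
move=> df f0; rewrite !pdD deriveV//; last exact: diff_derivable.
by rewrite -exprVn expr2 mulNr -mulrN; exact: mulrC.
Qed.

Lemma class_CN r D f : open D -> class_C r D f -> class_C r D (fun x => - f x).
Proof.
move=> oD fC; apply: class_C_eq (class_CM oD (class_C_cst r (-1) oD) fC) => //.
by move=> x _; rewrite mulN1r.
Qed.

Lemma class_CV r D f : open D -> (forall x, D x -> f x != 0) ->
  class_C r D f -> class_C r D (fun x => (f x)^-1).
Proof.
move=> oD f0; elim: r => [|r IH].
  by move=> fc x Dx; exact: (continuousV (f0 x Dx) (fc x Dx)).
move=> fC; have /class_CSP[fd fp] := fC.
apply: (class_C_partial_eq
  (df := fun i x => - pd i f x * ((f x)^-1 * (f x)^-1))) => //.
- by move=> x Dx; apply: differentiableV; [exact: fd|exact: f0].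
- by move=> i x Dx; rewrite partialV//; [exact: fd|exact: f0].
- move=> i; have Vr := IH (class_CS fC).
  apply: class_CM => //; last exact: class_CM.
  exact: class_CN (fp i).
Qed.

Lemma differentiable_sqrt f x : differentiable f x -> 0 < f x ->
  differentiable (fun y => Num.sqrt (f y)) x.
Proof.
move=> df fx; have [ds _] := is_derive1_sqrt fx.
exact: (differentiable_comp df ((derivable1_diffP _ _).1 ds)).
Qed.

(** Differentiate sqrt f * sqrt f = f, which holds near x because f stays positive there. *)
Lemma partial_sqrt f i x : differentiable f x -> 0 < f x ->
  pd i (fun y => Num.sqrt (f y)) x
  = pd i f x * (2 * Num.sqrt (f x))^-1.
Proof.
move=> df fx; have s0 : Num.sqrt (f x) != 0 by rewrite gt_eqF ?sqrtr_gt0.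
have ds := differentiable_sqrt df fx.
have nf : {near x, (fun y => Num.sqrt (f y) * Num.sqrt (f y)) =1 f}.
  have : \forall y \near x, 0 < f y.
    exact: (@cvgr_gt _ _ (nbhs x) _ f (f x) (differentiable_continuous df) 0 fx).
  by apply: filterS => y fy /=; rewrite -expr2 sqr_sqrtr// ltW.
have := near_eq_derive (delta_mx 0 i) nf; rewrite -pdD partialM//.
rewrite -pdD => <-; field; exact: s0.
Qed.

Lemma class_C_sqrt r D f : open D -> (forall x, D x -> 0 < f x) ->
  class_C r D f -> class_C r D (fun x => Num.sqrt (f x)).
Proof.
move=> oD f0; elim: r => [|r IH] fC.
  move=> x Dx; apply: (continuous_comp (fC x Dx)); exact: sqrt_continuous.
have /class_CSP[fd fp] := fC.
apply: (class_C_partial_eq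
  (df := fun i x => pd i f x * (2 * Num.sqrt (f x))^-1)) => //.
- by move=> x Dx; apply: differentiable_sqrt; [exact: fd|exact: f0].
- by move=> i x Dx; apply: partial_sqrt; [exact: fd|exact: f0].
- move=> i; apply: class_CM => //; apply: class_CV => //.
    by move=> x Dx; rewrite mulf_neq0// gt_eqF// sqrtr_gt0 f0.
  by apply: class_CM => //; [exact: class_C_cst|apply: IH; exact: class_CS].
Qed.

Lemma partial_coord (i j : 'I_n) x :
  pd i (fun y : 'rV[R]_n => y 0 j) x = (j == i)%:R.
Proof.
have [|_ ->//] := @differentiable_formP R n (fun y => y 0 j) x (fun l => (j == l)%:R).
move=> e e0; exists 1 => // h _; rewrite /lin_form (bigD1 j)//= big1.
  by rewrite mxE eqxx mulr1 addr0 [_ + h 0 j]addrC addrK subrr normr0 mulr_ge0// ltW.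
by move=> l /negbTE; rewrite eq_sym => ->; rewrite mulr0.
Qed.

Lemma class_C_coord r D (j : 'I_n) : open D -> class_C r D (fun x => x 0 j).
Proof.
move=> oD; case: r => [|r].
  by move=> x _; exact: coord_continuous.
apply: (class_C_partial_eq (df := fun i x => (j == i)%:R)) => //.
- by move=> x _; exact: differentiable_coord.
- by move=> i x _; exact: partial_coord.
- by move=> i; exact: class_C_cst.
Qed.

End SmoothScalar.

(** * Matrix-valued functions *)

Section SmoothMatrix.
Context {R : realType} {n : nat}.
Implicit Types (D : set 'rV[R]_n) (x : 'rV[R]_n).

(** For the converse, A is a finite sum of its entries times elementary matrices. *)
Lemma differentiable_mxP p q (A : 'rV[R]_n -> 'M[R]_(p, q)) x :
  differentiable A x <-> forall a b, differentiable (fun y => A y a b) x.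
Proof.
split=> [dA a b|dA].
  exact: (differentiable_comp dA (differentiable_coord _ a b)).
have -> : A = \sum_(a < p) \sum_(b < q) (fun y => A y a b *: delta_mx a b).
  apply/funext => y; rewrite fct_sumE {1}(matrix_sum_delta (A y)).
  by apply: eq_bigr => a _; rewrite fct_sumE.
apply: differentiable_sum => a; apply: differentiable_sum => b.
exact: differentiableZl.
Qed.

Lemma partial_mxE p q (A : 'rV[R]_n -> 'M[R]_(p, q)) i x a b :
  differentiable A x -> pd i A x a b = pd i (fun y => A y a b) x.
Proof.
by move=> dA; rewrite !pdD derive_mx ?mxE//; exact: diff_derivable.
Qed.

Lemma continuous_mxP p q (A : 'rV[R]_n -> 'M[R]_(p, q)) x :
  {for x, continuous A} <-> forall a b, {for x, continuous (fun y => A y a b)}.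
Proof.
split=> [cA a b|cA]; first exact: (continuous_comp cA (@coord_continuous _ _ _ a b _)).
have key (e : R) : 0 < e -> \forall y \near (x : 'rV[R]_n), `|A x - A y| < e.
  move=> e0; have : \forall y \near (x : 'rV[R]_n), forall ab : 'I_p * 'I_q,
      `|A x ab.1 ab.2 - A y ab.1 ab.2| < e.
    apply: (@filter_forall _ _ (fun ab y => `|A x ab.1 ab.2 - A y ab.1 ab.2| < e)
             (nbhs x)) => -[a b].
    by have /(@cvgrPdist_lt _ _ _ (nbhs x)) := cA a b; apply.
  apply: filterS => y Ay; apply: mx_norm_lt => // a b.
  by rewrite !mxE; exact: (Ay (a, b)).
by apply/(@cvgrPdist_lt _ _ _ (nbhs x)); exact: key.
Qed.

Lemma class_C_mxP r D p q (A : 'rV[R]_n -> 'M[R]_(p, q)) : open D ->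
  class_C r D A <-> forall a b, class_C r D (fun y => A y a b).
Proof.
move=> oD; elim: r A => [|r IH] A.
  split=> [cA a b x Dx|cA x Dx]; first exact: ((continuous_mxP A x).1 (cA x Dx)).
  by apply/continuous_mxP => a b; exact: cA.
split=> [/class_CSP[dA pA] a b|cA].
  apply: (class_C_partial_eq (df := fun i x => pd i A x a b)) => //.
  - by move=> x Dx; apply: (differentiable_mxP A x).1; exact: dA.
  - by move=> i x Dx; rewrite partial_mxE//; exact: dA.
  - by move=> i; apply: ((IH _).1 (pA i)).
have dA x : D x -> differentiable A x.
  by move=> Dx; apply/differentiable_mxP => a b; exact: ((class_CSP _ _ _).1 (cA a b)).1.
apply/class_CSP; split=> // i; apply/IH => a b.
have /class_CSP[_ cAab] := cA a b; apply: class_C_eq (cAab i) => // x Dx.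
by rewrite partial_mxE//; exact: dA.
Qed.

Lemma smooth_mxP D p q (A : 'rV[R]_n -> 'M[R]_(p, q)) : open D ->
  smooth_on D A <-> forall a b, smooth_on D (fun y => A y a b).
Proof.
move=> oD; split=> [sA a b r|sA r]; first exact: ((class_C_mxP r A oD).1 (sA r)).
by apply/class_C_mxP => // a b; exact: sA.
Qed.

Lemma smooth_cst D (a : R) : open D -> smooth_on D (fun=> a).
Proof. by move=> oD r; exact: class_C_cst. Qed.

Lemma smoothD D (f g : 'rV[R]_n -> R) : open D ->
  smooth_on D f -> smooth_on D g -> smooth_on D (fun x => f x + g x).
Proof. by move=> oD fs gs r; exact: class_CD. Qed.

Lemma smoothN D (f : 'rV[R]_n -> R) : open D ->
  smooth_on D f -> smooth_on D (fun x => - f x).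
Proof. by move=> oD fs r; exact: class_CN. Qed.

Lemma smoothM D (f g : 'rV[R]_n -> R) : open D ->
  smooth_on D f -> smooth_on D g -> smooth_on D (fun x => f x * g x).
Proof. by move=> oD fs gs r; exact: class_CM. Qed.

Lemma smoothV D (f : 'rV[R]_n -> R) : open D -> (forall x, D x -> f x != 0) ->
  smooth_on D f -> smooth_on D (fun x => (f x)^-1).
Proof. by move=> oD f0 fs r; exact: class_CV. Qed.

Lemma smooth_sqrt D (f : 'rV[R]_n -> R) : open D -> (forall x, D x -> 0 < f x) ->
  smooth_on D f -> smooth_on D (fun x => Num.sqrt (f x)).
Proof. by move=> oD f0 fs r; exact: class_C_sqrt. Qed.

Lemma smooth_sum D (I : Type) (s : seq I) (P : pred I) (F : I -> 'rV[R]_n -> R) :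
  open D -> (forall i, smooth_on D (F i)) ->
  smooth_on D (fun x => \sum_(i <- s | P i) F i x).
Proof. by move=> oD Fs r; apply: class_C_sum => // i _; exact: Fs. Qed.

Lemma smooth_prod D (I : Type) (s : seq I) (P : pred I) (F : I -> 'rV[R]_n -> R) :
  open D -> (forall i, smooth_on D (F i)) ->
  smooth_on D (fun x => \prod_(i <- s | P i) F i x).
Proof. by move=> oD Fs r; apply: class_C_prod => // i _; exact: Fs. Qed.

Lemma smooth_coord D (j : 'I_n) : open D -> smooth_on D (fun x => x 0 j).
Proof. by move=> oD r; exact: class_C_coord. Qed.

Lemma smooth_mx_eq D p q (A B : 'rV[R]_n -> 'M[R]_(p, q)) :
  open D -> (forall x, D x -> A x = B x) -> smooth_on D A -> smooth_on D B.
Proof.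
move=> oD AB /(smooth_mxP _ oD) sA; apply/(smooth_mxP _ oD) => a b.
by apply: smooth_on_eq (sA a b) => // x Dx; rewrite AB.
Qed.

Lemma smooth_mx_cst D p q (A : 'M[R]_(p, q)) : open D -> smooth_on D (fun=> A).
Proof. by move=> oD; apply/smooth_mxP => // a b; exact: smooth_cst. Qed.

Lemma smooth_mxD D p q (A B : 'rV[R]_n -> 'M[R]_(p, q)) : open D ->
  smooth_on D A -> smooth_on D B -> smooth_on D (fun x => A x + B x).
Proof.
move=> oD /(smooth_mxP _ oD) sA /(smooth_mxP _ oD) sB.
apply/(smooth_mxP _ oD) => a b; apply: smooth_on_eq (smoothD oD (sA a b) (sB a b)) => //.
by move=> x _; rewrite mxE.
Qed.

Lemma smooth_mxZ D p q (f : 'rV[R]_n -> R) (A : 'rV[R]_n -> 'M[R]_(p, q)) : open D ->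
  smooth_on D f -> smooth_on D A -> smooth_on D (fun x => f x *: A x).
Proof.
move=> oD sf /(smooth_mxP _ oD) sA.
apply/(smooth_mxP _ oD) => a b; apply: smooth_on_eq (smoothM oD sf (sA a b)) => //.
by move=> x _; rewrite mxE.
Qed.

Lemma smooth_mxN D p q (A : 'rV[R]_n -> 'M[R]_(p, q)) : open D ->
  smooth_on D A -> smooth_on D (fun x => - A x).
Proof.
move=> oD sA; apply: smooth_mx_eq (smooth_mxZ oD (smooth_cst (-1) oD) sA) => //.
by move=> x _; rewrite scaleN1r.
Qed.

Lemma smooth_mxB D p q (A B : 'rV[R]_n -> 'M[R]_(p, q)) : open D ->
  smooth_on D A -> smooth_on D B -> smooth_on D (fun x => A x - B x).
Proof. by move=> oD sA sB; apply: smooth_mxD => //; exact: smooth_mxN. Qed.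

Lemma smooth_mulmx D p q r (A : 'rV[R]_n -> 'M[R]_(p, q)) (B : 'rV[R]_n -> 'M[R]_(q, r)) :
  open D -> smooth_on D A -> smooth_on D B -> smooth_on D (fun x => A x *m B x).
Proof.
move=> oD /(smooth_mxP _ oD) sA /(smooth_mxP _ oD) sB.
apply/(smooth_mxP _ oD) => a b.
apply: (@smooth_on_eq _ _ _ (fun x => \sum_j A x a j * B x j b)) => //.
  by move=> x _; rewrite mxE.
by apply: smooth_sum => // j; exact: smoothM.
Qed.

Lemma smooth_trmx D p q (A : 'rV[R]_n -> 'M[R]_(p, q)) : open D ->
  smooth_on D A -> smooth_on D (fun x => (A x)^T).
Proof.
move=> oD /(smooth_mxP _ oD) sA; apply/(smooth_mxP _ oD) => a b.
by apply: smooth_on_eq (sA b a) => // x _; rewrite mxE.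
Qed.

Lemma smooth_mx_sum D p q (I : Type) (s : seq I) (P : pred I)
    (A : I -> 'rV[R]_n -> 'M[R]_(p, q)) :
  open D -> (forall i, smooth_on D (A i)) ->
  smooth_on D (fun x => \sum_(i <- s | P i) A i x).
Proof.
move=> oD sA; apply/(smooth_mxP _ oD) => a b.
apply: (@smooth_on_eq _ _ _ (fun x => \sum_(i <- s | P i) A i x a b)) => //.
  by move=> x _; rewrite summxE.
by apply: smooth_sum => // i; exact: ((smooth_mxP _ oD).1 (sA i)).
Qed.

Lemma smooth_matrix D p q (F : 'I_p -> 'I_q -> 'rV[R]_n -> R) : open D ->
  (forall a b, smooth_on D (F a b)) ->
  smooth_on D (fun x => \matrix_(a, b) F a b x).
Proof.
move=> oD sF; apply/smooth_mxP => // a b.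
by apply: smooth_on_eq (sF a b) => // x _; rewrite mxE.
Qed.

Lemma smooth_det D p (A : 'rV[R]_n -> 'M[R]_p) : open D ->
  smooth_on D A -> smooth_on D (fun x => \det (A x)).
Proof.
move=> oD /(smooth_mxP _ oD) sA; apply: smooth_sum => // s.
by apply: smoothM => //; [exact: smooth_cst | exact: smooth_prod].
Qed.

(** By Cramer's rule the inverse is the adjugate over the determinant: polynomials in the entries,
    with a denominator that does not vanish on D. *)
Lemma smooth_invmx D p (A : 'rV[R]_n -> 'M[R]_p) : open D ->
  (forall x, D x -> A x \in unitmx) ->
  smooth_on D A -> smooth_on D (fun x => invmx (A x)).
Proof.
move=> oD uA sA.
apply: (@smooth_mx_eq D _ _ (fun x => (\det (A x))^-1 *: \adj (A x))) => //.
  by move=> x Dx; rewrite /invmx uA.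
apply: smooth_mxZ => //.
  apply: smoothV => //; last exact: smooth_det.
  by move=> x Dx; have := uA x Dx; rewrite unitmxE unitfE.
apply/smooth_mxP => // a b.
apply: (@smooth_on_eq _ _ _ (fun x => cofactor (A x) b a)) => //.
  by move=> x _; rewrite mxE.
apply: smoothM => //; first exact: smooth_cst.
apply: smooth_det => //; apply/smooth_mxP => // i j.
apply: (@smooth_on_eq _ _ _ (fun x => A x (lift b i) (lift a j))) => //.
  by move=> x _; rewrite !mxE.
exact: ((smooth_mxP _ oD).1 sA).
Qed.

Lemma smooth_mink D p (s t : 'rV[R]_n -> 'cV[R]_p) : open D ->
  smooth_on D s -> smooth_on D t -> smooth_on D (fun x => mink (s x) (t x)).
Proof.
move=> oD ss st; rewrite /mink.
have : smooth_on D (fun x => (s x)^T *m lorentz R p *m t x).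
  by do 2![apply: smooth_mulmx => //]; [exact: smooth_trmx|exact: smooth_mx_cst].
by move/(smooth_mxP _ oD); apply.
Qed.

Lemma partial_cst (W : normedModType R) (a : W) i x :
  pd i (fun=> a) x = 0.
Proof. by rewrite !pdD derive_cst. Qed.

Lemma partial_mxD p q (A B : 'rV[R]_n -> 'M[R]_(p, q)) i x :
  differentiable A x -> differentiable B x ->
  pd i (fun y => A y + B y) x = pd i A x + pd i B x.
Proof. by move=> df dg; rewrite !pdD deriveD//; exact: diff_derivable. Qed.

Lemma partial_mxN p q (A : 'rV[R]_n -> 'M[R]_(p, q)) i x :
  differentiable A x -> pd i (fun y => - A y) x = - pd i A x.
Proof. by move=> df; rewrite !pdD deriveN//; exact: diff_derivable. Qed.

Lemma partial_sum (W : normedModType R) (I : Type) (s : seq I) (P : pred I)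
    (F : I -> 'rV[R]_n -> W) i x :
  (forall j, differentiable (F j) x) ->
  pd i (fun y => \sum_(j <- s | P j) F j y) x
  = \sum_(j <- s | P j) pd i (F j) x.
Proof.
move=> dF; elim: s => [|a s IH].
  by under eq_fun do rewrite big_nil; rewrite big_nil partial_cst.
have dS : differentiable (fun y => \sum_(j <- s | P j) F j y) x.
  elim: s {IH} => [|b s IH].
    rewrite (_ : (fun _ => _) = cst 0); first exact: differentiable_cst.
    by apply/funext => y; rewrite big_nil.
  case Pb : (P b); last first.
    by under eq_fun do rewrite big_cons Pb.
  under eq_fun do rewrite big_cons Pb.
  exact: differentiableD.
rewrite big_cons; case Pa : (P a); last first.
  by under eq_fun do rewrite big_cons Pa.
under eq_fun do rewrite big_cons Pa.
by rewrite -IH !pdD deriveD//; exact: diff_derivable.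
Qed.

Lemma partial_mulmx p q r (A : 'rV[R]_n -> 'M[R]_(p, q))
    (B : 'rV[R]_n -> 'M[R]_(q, r)) i x :
  differentiable A x -> differentiable B x ->
  differentiable (fun y => A y *m B y) x /\
  pd i (fun y => A y *m B y) x = pd i A x *m B x + A x *m pd i B x.
Proof.
move=> dA dB; have [eA eB] := ((differentiable_mxP A x).1 dA, (differentiable_mxP B x).1 dB).
have ME a b : (fun y => (A y *m B y) a b) = \sum_j (fun y => A y a j * B y j b).
  by apply/funext => y; rewrite mxE fct_sumE.
have dAB : differentiable (fun y => A y *m B y) x.
  apply/differentiable_mxP => a b; rewrite ME.
  by apply: differentiable_sum => j; exact: differentiableM.
split=> //; apply/matrixP => a b; rewrite partial_mxE// !mxE.
rewrite (_ : (fun _ => _) = fun y => \sum_j A y a j * B y j b); last first.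
  by apply/funext => y; rewrite mxE.
rewrite partial_sum -?big_split/=; last by move=> j; exact: differentiableM.
by apply: eq_bigr => j _; rewrite partialM// !partial_mxE.
Qed.

Lemma partialMmx p q r (A : 'rV[R]_n -> 'M[R]_(p, q))
    (B : 'rV[R]_n -> 'M[R]_(q, r)) i x :
  differentiable A x -> differentiable B x ->
  pd i (fun y => A y *m B y) x = pd i A x *m B x + A x *m pd i B x.
Proof. by move=> dA dB; have [] := partial_mulmx i dA dB. Qed.

Lemma partial_trmx p q (A : 'rV[R]_n -> 'M[R]_(p, q)) i x :
  differentiable A x ->
  differentiable (fun y => (A y)^T) x /\
  pd i (fun y => (A y)^T) x = (pd i A x)^T.
Proof.
move=> dA; have eA := (differentiable_mxP A x).1 dA.
have dT : differentiable (fun y => (A y)^T) x.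
  apply/differentiable_mxP => a b; rewrite (_ : (fun _ => _) = fun y => A y b a)//.
  by apply/funext => y; rewrite mxE.
split=> //; apply/matrixP => a b; rewrite mxE !partial_mxE//.
by congr (pd i _ x); apply/funext => y; rewrite mxE.
Qed.

Lemma differentiable_mulmxl p q r (L : 'M[R]_(p, q)) (A : 'rV[R]_n -> 'M[R]_(q, r)) i x :
  differentiable A x -> differentiable (fun y => L *m A y) x /\
  pd i (fun y => L *m A y) x = L *m pd i A x.
Proof.
move=> dA; have [dLA ->] := partial_mulmx i (differentiable_cst L x) dA.
by split=> //; rewrite (partial_cst L) mul0mx add0r.
Qed.

Lemma differentiable_mulmxr p q r (L : 'M[R]_(q, r)) (A : 'rV[R]_n -> 'M[R]_(p, q)) i x :
  differentiable A x -> differentiable (fun y => A y *m L) x /\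
  pd i (fun y => A y *m L) x = pd i A x *m L.
Proof.
move=> dA; have [dLA ->] := partial_mulmx i dA (differentiable_cst L x).
by split=> //; rewrite (partial_cst L) mulmx0 addr0.
Qed.

Lemma partial_mink p (s t : 'rV[R]_n -> 'cV[R]_p) i x :
  differentiable s x -> differentiable t x ->
  pd i (fun y => mink (s y) (t y)) x
  = mink (pd i s x) (t x) + mink (s x) (pd i t x).
Proof.
move=> ds dt; have [dT pT] := partial_trmx i ds.
have [dL pL] := differentiable_mulmxr (lorentz R p) i dT.
have [dM pM] := partial_mulmx i dL dt.
by rewrite /mink -(partial_mxE i 0 0 dM) pM pL pT mxE.
Qed.

End SmoothMatrix.

(** * The chain rule *)

Section SmoothComposition.
Context {R : realType} {m n : nat}.

Lemma partial_comp (f : 'rV[R]_n -> R) (phi : 'rV[R]_m -> 'rV[R]_n) i x :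
  differentiable phi x -> differentiable f (phi x) ->
  pd i (f \o phi) x = \sum_j pd i phi x 0 j * pd j f (phi x).
Proof.
move=> dphi df; rewrite {1}pdD deriveE; last exact: differentiable_comp.
rewrite diff_comp//= -(deriveE _ dphi) -(deriveE _ df) -pdD deriv_lin_form//.
Qed.

(** The induction generalises over f, since the chain rule composes each [pd j f] with the same
    [phi]. *)
Lemma class_C_comp r (D : set 'rV[R]_m) (D' : set 'rV[R]_n) (f : 'rV[R]_n -> R)
    (phi : 'rV[R]_m -> 'rV[R]_n) : open D ->
  (forall x, D x -> D' (phi x)) ->
  class_C r D' f -> class_C r D phi -> class_C r D (f \o phi).
Proof.
move=> oD DD'; elim: r f => [|r IH] f.
  by move=> fc pc x Dx; exact: continuous_comp (pc x Dx) (fc _ (DD' x Dx)).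
move=> fC pC; have /class_CSP[fd fp] := fC; have /class_CSP[dphi pp] := pC.
apply: (class_C_partial_eq
  (df := fun i x => \sum_j pd i phi x 0 j * pd j f (phi x))) => //.
- by move=> x Dx; apply: differentiable_comp; [exact: dphi|exact/fd/DD'].
- by move=> i x Dx; apply: partial_comp => //; [exact: dphi|exact/fd/DD'].
- move=> i; apply: class_C_sum => // j _; apply: class_CM => //.
    exact: ((class_C_mxP r _ oD).1 (pp i)).
  exact: IH (fp j) (class_CS pC).
Qed.

Lemma smooth_comp (D : set 'rV[R]_m) (D' : set 'rV[R]_n) p q
    (f : 'rV[R]_n -> 'M[R]_(p, q)) (phi : 'rV[R]_m -> 'rV[R]_n) :
  open D -> open D' -> (forall x, D x -> D' (phi x)) ->
  smooth_on D' f -> smooth_on D phi -> smooth_on D (f \o phi).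
Proof.
move=> oD oD' DD' /(smooth_mxP _ oD') fs ps; apply/(smooth_mxP _ oD) => a b r.
exact: class_C_comp (fs a b r) (ps r).
Qed.

Lemma partial_comp_mx p q (f : 'rV[R]_n -> 'M[R]_(p, q))
    (phi : 'rV[R]_m -> 'rV[R]_n) i x :
  differentiable phi x -> differentiable f (phi x) ->
  pd i (f \o phi) x = \sum_j pd i phi x 0 j *: pd j f (phi x).
Proof.
move=> dphi df; rewrite {1}pdD deriveE; last exact: differentiable_comp.
by rewrite diff_comp//= -(deriveE _ dphi) -(deriveE _ df) -pdD deriv_partial.
Qed.

End SmoothComposition.

(** * Mean value estimates and radial integrals *)

Section MeanValue.
Context {R : realType} {n : nat}.
Implicit Types (f : 'rV[R]_n -> R) (x h p : 'rV[R]_n).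

Lemma in_ballE p (r : R) x : ball p r x <-> `|x - p| < r.
Proof. by rewrite -ball_normE/= distrC. Qed.

Lemma ball_segment p (r t : R) x y : 0 <= t <= 1 -> ball p r x -> ball p r y ->
  ball p r (x + t *: (y - x)).
Proof.
move=> /andP[t0 t1] /in_ballE xr /in_ballE yr; apply/in_ballE.
have -> : x + t *: (y - x) - p = (1 - t) *: (x - p) + t *: (y - p).
  by rewrite !scalerBr !scalerBl !scale1r !opprB; apply/rowP => i; rewrite !mxE; ring.
apply: le_lt_trans (ler_normD _ _) _; rewrite !normrZ ger0_norm ?subr_ge0// ger0_norm//.
have [->|tn0] := eqVneq t 0; first by rewrite subr0 mul0r mul1r addr0.
have t_gt0 : 0 < t by rewrite lt_def tn0.
apply: (@le_lt_trans _ _ ((1 - t) * r + t * `|y - p|)).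
  by rewrite lerD2r ler_wpM2l ?subr_ge0// ltW.
by have : t * `|y - p| < t * r; [rewrite ltr_pM2l | lra].
Qed.

Lemma is_derive_segment f x h (s : R) : differentiable f (x + s *: h) ->
  is_derive s (1 : R) (fun t => f (x + t *: h)) ('D_h f (x + s *: h)).
Proof.
move=> df.
have da : is_diff s (fun t : R => x + t *: h) (fun t => t *: h).
  by apply: is_diff_eq; rewrite add0r.
have dfa : differentiable (f \o (fun t : R => x + t *: h)) s.
  exact: differentiable_comp.
apply: DeriveDef; first exact/derivable1_diffP.
rewrite deriveE// diff_comp//= diff_val scale1r deriveE//.
Qed.

Lemma mean_value f x h :
  (forall s : R, 0 <= s <= 1 -> differentiable f (x + s *: h)) ->
  exists2 s : R, 0 <= s <= 1 &
    f (x + h) - f x = lin_form (fun i => pd i f (x + s *: h)) h.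
Proof.
move=> df.
have der (s : R) : 0 <= s <= 1 -> is_derive s (1 : R) (fun t => f (x + t *: h)) ('D_h f (x + s *: h)).
  by move=> s01; apply: is_derive_segment; exact: df.
have [||s s01] := @MVT_segment R (fun t => f (x + t *: h)) (fun s => 'D_h f (x + s *: h)) 0 1 ler01.
- by move=> s; rewrite in_itv/= => /andP[s0 s1]; apply: der; rewrite !ltW.
- apply: derivable_within_continuous => s; rewrite in_itv/= => s01.
  by have [] := der s s01.
rewrite scale1r scale0r addr0 subr0 mulr1 => ->; exists s; rewrite ?in_itv//.
by rewrite deriv_lin_form//; apply: df; move: s01; rewrite in_itv.
Qed.

Lemma ball_shift p (r : R) x h (s : R) :
  ball p r x -> ball p r (x + h) -> 0 <= s <= 1 -> ball p r (x + s *: h).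
Proof.
by move=> bx bxh s01; have := ball_segment s01 bx bxh; rewrite [x + h - x]addrC addKr.
Qed.

Lemma mean_value_le f p (r M : R) x h :
  (forall y, ball p r y -> differentiable f y) ->
  (forall y i, ball p r y -> `|pd i f y| <= M) ->
  ball p r x -> ball p r (x + h) ->
  `|f (x + h) - f x| <= n%:R * M * `|h|.
Proof.
move=> df fM bx bxh; have [|s s01 ->] := @mean_value f x h.
  by move=> s s01; apply: df; exact: ball_shift.
by apply: lin_form_le => i; apply: fM; exact: ball_shift.
Qed.

(** The mean value theorem along the segment, then for each [pd i f], produces the two factors n.
    The bound is independent of x, so remainders are uniform along rays. *)
Lemma taylor_le f p (r M : R) x h :
  (forall y, ball p r y -> differentiable f y) ->
  (forall y i, ball p r y -> differentiable (pd i f) y) ->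
  (forall y i j, ball p r y -> `|pd i (pd j f) y| <= M) ->
  ball p r x -> ball p r (x + h) ->
  `|f (x + h) - f x - lin_form (fun i => pd i f x) h|
    <= n%:R * (n%:R * M) * `|h| ^+ 2.
Proof.
move=> df ddf fM bx bxh; have [|s s01 ->] := @mean_value f x h.
  by move=> s s01; apply: df; exact: ball_shift.
have -> : lin_form (fun i => pd i f (x + s *: h)) h - lin_form (fun i => pd i f x) h
    = lin_form (fun i => pd i f (x + s *: h) - pd i f x) h.
  by rewrite /lin_form -sumrB; apply: eq_bigr => i _; rewrite mulrBr.
have M0 : forall i : 'I_n, 0 <= M by move=> i; exact: le_trans (fM x i i bx).
have -> : n%:R * (n%:R * M) * `|h| ^+ 2 = n%:R * (n%:R * M * `|h|) * `|h| by ring.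
apply: lin_form_le => i.
apply: le_trans (mean_value_le (r := r) (p := p) (M := M) _ _ _ _) _ => //.
- by move=> y by_; exact: ddf.
- by move=> y j by_; exact: fM.
- exact: ball_shift.
rewrite normrZ ler_wpM2l ?mulr_ge0 ?(M0 i)// ger0_norm; last by case/andP: s01.
by rewrite ler_piMl//; case/andP: s01.
Qed.

Lemma partial_delta f i x (s : R) : differentiable f x ->
  lin_form (fun j => pd j f x) (s *: delta_mx 0 i) = s * pd i f x.
Proof. by move=> df; rewrite linearZ/= -deriv_lin_form// -pdD. Qed.

Lemma mean_value_diff f x h k :
  (forall s t : R, 0 <= s <= 1 -> 0 <= t <= 1 ->
     differentiable f (x + s *: h + t *: k)) ->
  exists2 s : R, 0 <= s <= 1 &
    f (x + k + h) - f (x + k) - (f (x + h) - f x)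
    = 'D_h f (x + s *: h + k) - 'D_h f (x + s *: h).
Proof.
move=> df.
have d1 (s : R) : 0 <= s <= 1 ->
    is_derive s (1 : R) (fun t => f (x + k + t *: h)) ('D_h f (x + k + s *: h)).
  move=> s01; apply: is_derive_segment.
  by have := df s 1 s01; rewrite scale1r addrAC; apply; rewrite ler01 lexx.
have d0 (s : R) : 0 <= s <= 1 ->
    is_derive s (1 : R) (fun t => f (x + t *: h)) ('D_h f (x + s *: h)).
  move=> s01; apply: is_derive_segment.
  by have := df s 0 s01; rewrite scale0r addr0; apply; rewrite ler01 lexx.
have der (s : R) : 0 <= s <= 1 -> is_derive s (1 : R)
    (fun t => f (x + k + t *: h) - f (x + t *: h))
    ('D_h f (x + k + s *: h) - 'D_h f (x + s *: h)).
  by move=> s01; have ? := d1 s s01; have ? := d0 s s01; exact: is_deriveB.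
have [||s s01] := @MVT_segment R (fun t => f (x + k + t *: h) - f (x + t *: h))
    (fun s => 'D_h f (x + k + s *: h) - 'D_h f (x + s *: h)) 0 1 ler01.
- by move=> s; rewrite in_itv/= => /andP[s0 s1]; apply: der; rewrite !ltW.
- apply: derivable_within_continuous => s; rewrite in_itv/= => s01.
  by have [] := der s s01.
rewrite !scale1r !scale0r !addr0 subr0 mulr1 => E; exists s; rewrite ?in_itv//.
by move: E; rewrite [x + k + s *: h]addrAC => <-; rewrite !opprD !opprK; ring.
Qed.

(** Two mean values: along e_i for the difference of f on two parallel segments, then along e_j for
    [pd i f]. The bound on s keeps the parallelogram inside the ball. *)
Lemma second_difference (D : set 'rV[R]_n) f x (r s : R) (i j : 'I_n) :
  ball x r `<=` D -> smooth_on D f -> 0 < s -> s + s < r ->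
  exists2 y, ball x r y &
    f (x + s *: delta_mx 0 j + s *: delta_mx 0 i) - f (x + s *: delta_mx 0 j)
    - (f (x + s *: delta_mx 0 i) - f x) = s * (s * pd j (pd i f) y).
Proof.
move=> rD sf s0 sr.
have inb (u v : R) : 0 <= u <= 1 -> 0 <= v <= 1 ->
    ball x r (x + u *: (s *: delta_mx 0 i) + v *: (s *: delta_mx 0 j)).
  move=> u01 v01; apply/in_ballE.
  rewrite -[x + _ + _]addrA [x + _]addrC addrK.
  apply: le_lt_trans (ler_normD _ _) _.
  have nd (c : R) l : 0 <= c <= 1 -> `|c *: (s *: delta_mx 0 l) : 'rV[R]_n| <= s.
    move=> /andP[c0 c1]; apply: mx_norm_le; first exact: ltW.
    move=> p q; rewrite !mxE ger0_norm ?mulr_ge0// ?(ltW s0)//.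
    apply: (@le_trans _ _ (1 * (s * 1))); last by rewrite mul1r mulr1.
    apply: ler_pM => //; first by rewrite mulr_ge0// ltW.
    by rewrite ler_pM2l//; case: (_ && _).
  exact: le_lt_trans (lerD (nd u i u01) (nd v j v01)) sr.
have df y : ball x r y -> differentiable f y.
  by move=> /rD; exact: smooth_differentiable.
have sif := smooth_partial i sf.
have dif y : ball x r y -> differentiable (pd i f) y.
  by move=> /rD; exact: smooth_differentiable.
have [|u u01 ->] := @mean_value_diff f x (s *: delta_mx 0 i) (s *: delta_mx 0 j).
  by move=> u v u01 v01; apply: df; exact: inb.
have b0 : ball x r (x + u *: (s *: delta_mx 0 i)).
  by have := inb u 0 u01; rewrite scale0r addr0; apply; rewrite lexx ler01.
have b1 : ball x r (x + u *: (s *: delta_mx 0 i) + s *: delta_mx 0 j).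
  by have := inb u 1 u01; rewrite scale1r; apply; rewrite lexx ler01.
rewrite !deriv_lin_form; [|exact: df..].
rewrite !partial_delta; [|exact: df..].
rewrite -mulrBr.
have [|v v01 ->] := @mean_value (pd i f) (x + u *: (s *: delta_mx 0 i)) (s *: delta_mx 0 j).
  by move=> v v01; apply: dif; exact: inb.
rewrite partial_delta; last by apply: dif; exact: inb.
by eexists; first exact: (inb u v).
Qed.

(** The second difference is symmetric in its two increments, so the two mixed derivatives agree at
    some pair of points near x; continuity carries both values to x. *)
Lemma schwarz (D : set 'rV[R]_n) f (i j : 'I_n) x : open D -> D x ->
  smooth_on D f -> pd i (pd j f) x = pd j (pd i f) x.
Proof.
move=> oD Dx sf.
have [r /= r0 rD] := (nbhs_ballP x D).1 (open_nbhs_nbhs (conj oD Dx)).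
apply/eqP; rewrite -subr_eq0 -normr_le0; apply/ler_addgt0Pr => e e0; rewrite add0r.
have near_value (a b : 'I_n) : exists2 d, 0 < d & forall y, ball x d y ->
    `|pd a (pd b f) x - pd a (pd b f) y| < e / 2.
  have sab : smooth_on D (pd a (pd b f)) by do 2!apply: smooth_partial.
  have := smooth_continuous sab Dx; move/(@cvgrPdist_lt _ _ _ (nbhs x)).
  by move=> /(_ (e / 2))/(_ ltac:(by rewrite divr_gt0))/nbhs_ballP[d /= d0 dP]; exists d.
have [d1 d10 dP1] := near_value i j; have [d2 d20 dP2] := near_value j i.
pose d := Num.min r (Num.min d1 d2).
have d0 : 0 < d by rewrite !lt_min r0 d10.
have dr : d <= r by rewrite ge_min lexx.
have dd1 : d <= d1 by rewrite !ge_min lexx orbT.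
have dd2 : d <= d2 by rewrite !ge_min lexx !orbT.
have dD : ball x d `<=` D by move=> y /(le_ball dr); exact: rD.
(* Two increments of length d / 3 together stay below d. *)
have s0 : 0 < d / 3 by rewrite divr_gt0.
have sd : d / 3 + d / 3 < d by lra.
have [y1 by1 E1] := second_difference i j dD sf s0 sd.
have [y2 by2 E2] := second_difference j i dD sf s0 sd.
have E : pd j (pd i f) y1 = pd i (pd j f) y2.
  apply: (mulfI (lt0r_neq0 s0)); apply: (mulfI (lt0r_neq0 s0)).
  apply: etrans (esym E1) (etrans _ E2).
  by rewrite opprD addrACA -opprD [x + _ + _]addrAC.
have h1 := dP1 y2 (le_ball dd1 by2); have h2 := dP2 y1 (le_ball dd2 by1).
rewrite -E in h1; rewrite distrC in h2.
apply: le_trans (ler_distD (pd j (pd i f) y1) _ _) _.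
by rewrite [leRHS]splitr; exact: ltW (ltrD h1 h2).
Qed.

Lemma schwarz_mx (D : set 'rV[R]_n) (k l : nat) (A : 'rV[R]_n -> 'M[R]_(k, l)) (i j : 'I_n) x :
  open D -> D x -> smooth_on D A ->
  pd i (pd j A) x = pd j (pd i A) x.
Proof.
move=> oD Dx sA; apply/matrixP => a b.
have sp c : smooth_on D (pd c A) by exact: smooth_partial.
have dA y : D y -> differentiable A y by exact: smooth_differentiable.
rewrite (partial_mxE i a b (smooth_differentiable (sp j) Dx)).
rewrite (partial_mxE j a b (smooth_differentiable (sp i) Dx)).
have E c e : pd c (fun y => pd e A y a b) x
           = pd c (pd e (fun y => A y a b)) x.
  by apply: (partial_eq_on (D := D)) => // y Dy; rewrite partial_mxE//; exact: dA.
by rewrite !E (schwarz i j oD Dx)//; exact: ((smooth_mxP A oD).1 sA).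
Qed.

End MeanValue.

(** * Integrals along rays *)

Section RadialIntegral.
Context {R : realType}.
Implicit Types (phi psi : R -> R).

(** Continuity is two-sided even at 0 and 1. The integrands extend beyond the segment, because the
    rays lie in open balls. *)
Definition continuous01 phi := forall t : R, 0 <= t <= 1 -> {for t, continuous phi}.

Definition integral01 phi : R := \int[lebesgue_measure]_(t in `[0, 1]) phi t.

Lemma integrable01 phi : continuous01 phi ->
  (@lebesgue_measure R).-integrable `[0, 1] (EFin \o phi).
Proof.
move=> cphi; apply: continuous_compact_integrable; first exact: segment_compact.
by apply: continuous_in_subspaceT => t; rewrite inE/= in_itv/=; exact: cphi.
Qed.

Lemma integral01D phi psi : continuous01 phi -> continuous01 psi ->
  integral01 (fun t => phi t + psi t) = integral01 phi + integral01 psi.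
Proof. by move=> ? ?; rewrite /integral01 RintegralD//; exact: integrable01. Qed.

Lemma integral01Z phi (a : R) : continuous01 phi ->
  integral01 (fun t => a * phi t) = a * integral01 phi.
Proof. by move=> ?; rewrite /integral01 RintegralZl//; exact: integrable01. Qed.

Lemma eq_integral01 phi psi : (forall t : R, 0 <= t <= 1 -> phi t = psi t) ->
  integral01 phi = integral01 psi.
Proof.
by move=> e; apply: eq_Rintegral => t; rewrite inE/= in_itv/=; exact: e.
Qed.

Lemma continuous01_cst (a : R) : continuous01 (fun=> a).
Proof. by move=> t _; exact: cst_continuous. Qed.

Lemma continuous01D phi psi : continuous01 phi -> continuous01 psi ->
  continuous01 (fun t => phi t + psi t).
Proof. by move=> cp cq t t01; exact: (continuousD (cp t t01) (cq t t01)). Qed.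

Lemma continuous01M phi psi : continuous01 phi -> continuous01 psi ->
  continuous01 (fun t => phi t * psi t).
Proof. by move=> cp cq t t01; exact: (continuousM (cp t t01) (cq t t01)). Qed.

Lemma integral01_cst (a : R) : integral01 (fun=> a) = a.
Proof.
rewrite /integral01 Rintegral_cst//= lebesgue_measure_itv/= lte01.
by rewrite oppr0 adde0 mulr1.
Qed.

Lemma integral01_le phi (M : R) : continuous01 phi ->
  (forall t : R, 0 <= t <= 1 -> `|phi t| <= M) -> `|integral01 phi| <= M.
Proof.
move=> cphi phiM.
have ab (a b : R -> R) : continuous01 a -> continuous01 b ->
    (forall t : R, 0 <= t <= 1 -> a t <= b t) -> integral01 a <= integral01 b.
  move=> ca cb le_ab; apply: le_Rintegral => //; try exact: integrable01.
rewrite ler_norml -(integral01_cst (- M)) -{2}(integral01_cst M).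
apply/andP; split; apply: ab => //; try exact: continuous01_cst.
- by move=> t /phiM; rewrite ler_norml => /andP[].
- by move=> t /phiM; rewrite ler_norml => /andP[].
Qed.

Lemma integral01_FTC (F f : R -> R) : continuous01 f ->
  (forall t : R, 0 <= t <= 1 -> is_derive t (1 : R) F (f t)) ->
  integral01 f = F 1 - F 0.
Proof.
move=> cf dF.
have cF : continuous01 F.
  by move=> t /dF[/derivable1_diffP dFt _]; exact: differentiable_continuous.
rewrite /integral01 /Rintegral (@continuous_FTC2 R f F 0 1)//.
- by apply: continuous_in_subspaceT => t; rewrite inE/= in_itv/=; exact: cf.
- split.
  + by move=> t; rewrite in_itv/= => /andP[t0 t1]; have [] := dF t; rewrite ?ltW.
  + by apply: cvg_at_right_filter; apply: cF; rewrite lexx ler01.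
  + by apply: cvg_at_left_filter; apply: cF; rewrite lexx ler01.
- move=> t; rewrite in_itv/= => /andP[t0 t1].
  by rewrite derive1E; have [|_ ->//] := dF t; rewrite !ltW.
Qed.

Context {n : nat}.
Implicit Types (p x : 'rV[R]_n) (f : 'rV[R]_n -> R).

(** Differentiation in x brings out a factor t; the weight t^m closes the family under partial
    derivatives. *)
Definition radial p (m : nat) f x : R :=
  integral01 (fun t => t ^+ m * f (p + t *: (x - p))).

Lemma ball_radial p (r t : R) x : 0 <= t <= 1 -> ball p r x ->
  ball p r (p + t *: (x - p)).
Proof.
move=> t01 bx; apply: ball_segment => //; apply: ballxx.
by move/in_ballE: bx; exact: le_lt_trans.
Qed.

Lemma continuous01_radial p m f (r : R) x :
  (forall y, ball p r y -> {for y, continuous f}) -> ball p r x ->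
  continuous01 (fun t => t ^+ m * f (p + t *: (x - p))).
Proof.
move=> cf bx t t01.
have ct : {for t, continuous (fun s : R => s ^+ m)} by exact: exprn_continuous.
have cft : {for t, continuous (fun s : R => f (p + s *: (x - p)))}.
  have ca : {for t, continuous (fun s : R => p + s *: (x - p))}.
    by apply: continuousD; [exact: cst_continuous|exact: scalel_continuous].
  by apply: (continuous_comp ca); apply: cf; exact: ball_radial.
exact: (continuousM ct cft).
Qed.

Lemma radial_le p m f (r M : R) x :
  (forall y, ball p r y -> {for y, continuous f}) -> ball p r x ->
  (forall y, ball p r y -> `|f y| <= M) -> `|radial p m f x| <= M.
Proof.
move=> cf bx fM; apply: integral01_le; first exact: continuous01_radial cf bx.
move=> t t01; have := fM _ (ball_radial t01 bx).
case/andP: t01 => t0 t1 fM'; rewrite normrM -[leRHS]mul1r ler_pM//.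
by rewrite ger0_norm ?exprn_ge0// exprn_ile1.
Qed.

Lemma radialB p m f g (r : R) x :
  (forall y, ball p r y -> {for y, continuous f}) ->
  (forall y, ball p r y -> {for y, continuous g}) -> ball p r x ->
  radial p m (fun y => f y - g y) x = radial p m f x - radial p m g x.
Proof.
move=> cf cg bx; have If := continuous01_radial (m := m) cf bx.
have Ig := continuous01_radial (m := m) cg bx.
rewrite /radial -mulN1r -integral01Z// -integral01D//.
  by apply: eq_integral01 => t _; rewrite mulN1r mulrBr.
by apply: continuous01M => //; exact: continuous01_cst.
Qed.

Lemma integral01_sum (I : Type) (s : seq I) (F : I -> R -> R) :
  (forall i, continuous01 (F i)) ->
  continuous01 (fun t => \sum_(i <- s) F i t) /\
  integral01 (fun t => \sum_(i <- s) F i t) = \sum_(i <- s) integral01 (F i).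
Proof.
move=> cF; elim: s => [|a s [cs IH]].
  under eq_fun do rewrite big_nil.
  by rewrite big_nil integral01_cst; split=> //; exact: continuous01_cst.
under eq_fun do rewrite big_cons.
by rewrite big_cons integral01D// IH; split=> //; exact: continuous01D.
Qed.

(** The closed ball of radius r' is compact and lies in the open ball of radius r. *)
Lemma compact_bound p (r r' : R) f : r' < r ->
  (forall y, ball p r y -> {for y, continuous f}) ->
  exists2 M : R, 0 <= M & forall y, ball p r' y -> `|f y| <= M.
Proof.
move=> r'r cf.
have cK : compact (closed_ball_ (fun y : 'rV[R]_n => `|y|) p r').
  apply: bounded_closed_compact; last exact: closed_closed_ball_.
  exists (`|p| + r'); split; first exact: num_real.
  move=> M hM y /= hy; apply: ltW; apply: le_lt_trans hM.
  by rewrite -[y](subrKC p) (le_trans (ler_normD _ _))// lerD2l distrC.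
have cfK : {within closed_ball_ (fun y : 'rV[R]_n => `|y|) p r', continuous f}.
  apply: continuous_in_subspaceT => y; rewrite inE/= => hy.
  by apply: cf; rewrite -ball_normE/=; exact: le_lt_trans r'r.
have := continuous_compact cfK cK => /compact_bounded[M0 [_ HM]].
exists (`|M0| + 1); first by rewrite addr_ge0.
move=> y; rewrite -ball_normE/= => hy.
apply: HM; first by rewrite (le_lt_trans (ler_norm _))// ltrDl.
by exists y => //; exact: ltW.
Qed.

End RadialIntegral.

(** * The cone operator and the Poincare lemma *)

Section Poincare.
Context {R : realType} {n : nat}.
Implicit Types (p x : 'rV[R]_n) (f : 'rV[R]_n -> R).

Lemma ball_compact_bounds p (r r' : R) (I : finType) (f : I -> 'rV[R]_n -> R) :
  r' < r -> (forall i y, ball p r y -> {for y, continuous (f i)}) ->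
  exists2 M : R, 0 <= M & forall i y, ball p r' y -> `|f i y| <= M.
Proof.
move=> r'r cf.
have /choice[M HM] : forall i, exists M : R, 0 <= M /\ forall y, ball p r' y -> `|f i y| <= M.
  by move=> i; have [M M0 HM] := compact_bound r'r (cf i); exists M.
exists (\sum_i M i); first by apply: sumr_ge0 => i _; have [] := HM i.
move=> i y by_; have [_ /(_ y by_)Mi] := HM i; apply: le_trans Mi _.
by rewrite (bigD1 i)//= lerDl sumr_ge0// => j _; have [] := HM j.
Qed.

(** Differentiation under the integral: the Taylor remainder of f is bounded by C |h|^2 uniformly
    along the ray, and integrating keeps the bound. *)
Lemma radial_derive p (r : R) m f x : smooth_on (ball p r) f -> ball p r x ->
  differentiable (radial p m f) x /\
  forall i, pd i (radial p m f) x = radial p m.+1 (pd i f) x.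
Proof.
move=> sf bx.
have df y : ball p r y -> differentiable f y by exact: smooth_differentiable.
have sif i : smooth_on (ball p r) (pd i f) by exact: smooth_partial.
have dif i y : ball p r y -> differentiable (pd i f) y.
  exact: smooth_differentiable (sif i).
have cf y : ball p r y -> {for y, continuous f}.
  by move=> /df; exact: differentiable_continuous.
have cif i y : ball p r y -> {for y, continuous (pd i f)}.
  by move=> /(dif i); exact: differentiable_continuous.
(* Halfway between x and the boundary: second derivatives are bounded on this smaller ball, and x
   still has room to move. *)
pose r' := (`|x - p| + r) / 2.
have xr : `|x - p| < r by apply/in_ballE.
have xr' : `|x - p| < r' by rewrite /r'; lra.
have r'r : r' < r by rewrite /r'; lra.
have br' y : ball p r' y -> ball p r y by apply: le_ball; exact: ltW.
have [|M M0 HM] := @ball_compact_bounds p r r' ('I_n * 'I_n)%type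
    (fun ij => pd ij.1 (pd ij.2 f)) r'r.
  move=> [i j] y by_ /=; apply: differentiable_continuous.
  by apply: smooth_differentiable (smooth_partial i (sif j)) by_.
apply: differentiable_formP => e e0.
set C := n%:R * (n%:R * M).
have C0 : 0 <= C by rewrite !mulr_ge0.
(* The first bound keeps x + h in the smaller ball, the second gives C |h| <= e; adding 1 avoids
   dividing by zero. *)
exists (Num.min (r' - `|x - p|) (e / (C + 1))).
  by rewrite lt_min subr_gt0 xr' divr_gt0// ltr_wpDl.
move=> h; rewrite lt_min => /andP[hr he].
have bx' : ball p r' x by apply/in_ballE.
have bxh : ball p r' (x + h).
  apply/in_ballE; rewrite addrAC; apply: le_lt_trans (ler_normD _ _) _.
  by rewrite -ltrBrDl.
pose z (t : R) := p + t *: (x - p).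
have zh t : p + t *: (x + h - p) = z t + t *: h.
  by rewrite [x + h - p]addrAC scalerDr addrA.
have c1 : continuous01 (fun t => t ^+ m * f (p + t *: (x + h - p))).
  by apply: (continuous01_radial cf); exact: br'.
have c2 : continuous01 (fun t => t ^+ m * f (z t)).
  by apply: (continuous01_radial cf); exact: br'.
have c3 i : continuous01 (fun t => t ^+ m.+1 * pd i f (z t)).
  by apply: (continuous01_radial (cif i)); exact: br'.
have c3' i : continuous01 (fun t => h 0 i * (t ^+ m.+1 * pd i f (z t))).
  by apply: continuous01M (c3 i); exact: continuous01_cst.
have [c4 i4] := integral01_sum (index_enum 'I_n) c3'.
have -> : radial p m f (x + h) - radial p m f x
    - lin_form (fun i => radial p m.+1 (pd i f) x) h
  = integral01 (fun t => t ^+ m * f (p + t *: (x + h - p))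
     + (-1 * (t ^+ m * f (z t)) + -1 * (\sum_i h 0 i * (t ^+ m.+1 * pd i f (z t))))).
  have cN (g : R -> R) : continuous01 g -> continuous01 (fun t => -1 * g t).
    by move=> ?; apply: continuous01M => //; exact: continuous01_cst.
  rewrite integral01D//; last by apply: continuous01D; exact: cN.
  rewrite integral01D; [|exact: cN..].
  rewrite !integral01Z// i4 !mulN1r addrA; congr (_ - _).
  by rewrite /lin_form; apply: eq_bigr => i _; rewrite /radial -integral01Z.
have bound t : 0 <= t <= 1 ->
  `|t ^+ m * f (p + t *: (x + h - p))
     + (-1 * (t ^+ m * f (z t)) + -1 * (\sum_i h 0 i * (t ^+ m.+1 * pd i f (z t))))|
  <= C * `|h| ^+ 2.
  move=> t01; have /andP[t0 t1] := t01.
  have -> : t ^+ m * f (p + t *: (x + h - p))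
     + (-1 * (t ^+ m * f (z t)) + -1 * (\sum_i h 0 i * (t ^+ m.+1 * pd i f (z t))))
    = t ^+ m * (f (z t + t *: h) - f (z t) - lin_form (fun i => pd i f (z t)) (t *: h)).
    rewrite zh !mulN1r mulrBr mulrBr [LHS]addrA.
    congr (_ - _).
    rewrite /lin_form mulr_sumr; apply: eq_bigr => i _.
    by rewrite mxE exprSr; ring.
  rewrite normrM -[leRHS]mul1r; apply: ler_pM => //.
    by rewrite ger0_norm ?exprn_ge0// exprn_ile1.
  have bz : ball p r' (z t) by exact: ball_radial.
  have bzh : ball p r' (z t + t *: h) by rewrite -zh; exact: ball_radial.
  apply: le_trans (taylor_le (p := p) (r := r') (M := M) _ _ _ bz bzh) _.
  - by move=> y /br'; exact: df.
  - by move=> y i /br'; exact: dif.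
  - by move=> y i j by_; exact: (HM (i, j)).
  rewrite -/C ler_wpM2l// normrZ ger0_norm// exprMn ler_piMl ?sqr_ge0//.
  exact: exprn_ile1.
apply: le_trans (integral01_le _ bound) _.
  apply: continuous01D => //; apply: continuous01D.
    by apply: continuous01M => //; exact: continuous01_cst.
  by apply: continuous01M => //; exact: continuous01_cst.
rewrite expr2 mulrA ler_wpM2r// ltW//.
apply: (@le_lt_trans _ _ ((C + 1) * `|h|)); first by rewrite ler_wpM2r// lerDl.
by rewrite mulrC -ltr_pdivlMr// ltr_wpDl.
Qed.

Lemma radial_smooth p (r : R) m f :
  smooth_on (ball p r) f -> smooth_on (ball p r) (radial p m f).
Proof.
move=> sf k; elim: k m f sf => [|k IH] m f sf.
  move=> x bx; apply: differentiable_continuous.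
  by have [] := radial_derive m sf bx.
apply: (class_C_partial_eq (df := fun i => radial p m.+1 (pd i f))).
- exact: ball_open.
- by move=> x bx; have [] := radial_derive m sf bx.
- by move=> i x bx; have [] := radial_derive m sf bx.
- by move=> i; apply: IH; exact: smooth_partial.
Qed.

(** The fundamental theorem of calculus for t -> t f(p + t (x - p)), whose value at 1 is f x and at
    0 is 0. *)
Lemma radial_FTC p (r : R) f x : smooth_on (ball p r) f -> ball p r x ->
  f x = radial p 0 f x + \sum_i (x 0 i - p 0 i) * radial p 1 (pd i f) x.
Proof.
move=> sf bx.
have df y : ball p r y -> differentiable f y by exact: smooth_differentiable.
have cf y : ball p r y -> {for y, continuous f}.
  by move=> /df; exact: differentiable_continuous.
have cif i y : ball p r y -> {for y, continuous (pd i f)}.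
  exact: smooth_continuous (smooth_partial i sf).
pose z (t : R) := p + t *: (x - p).
have c0 : continuous01 (fun t => t ^+ 0 * f (z t)) by exact: continuous01_radial cf bx.
have c1 i : continuous01 (fun t => t ^+ 1 * pd i f (z t)).
  exact: continuous01_radial (cif i) bx.
have c2 i : continuous01 (fun t => (x 0 i - p 0 i) * (t ^+ 1 * pd i f (z t))).
  by apply: continuous01M (c1 i); exact: continuous01_cst.
have [c3 i3] := integral01_sum (index_enum 'I_n) c2.
have -> : \sum_i (x 0 i - p 0 i) * radial p 1 (pd i f) x
   = integral01 (fun t => \sum_i (x 0 i - p 0 i) * (t ^+ 1 * pd i f (z t))).
  by rewrite i3; apply: eq_bigr => i _; rewrite /radial -integral01Z.
have dF (t : R) : 0 <= t <= 1 -> is_derive t (1 : R) (fun s => s * f (z s))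
    (t ^+ 0 * f (z t) + \sum_i (x 0 i - p 0 i) * (t ^+ 1 * pd i f (z t))).
  move=> t01.
  have dz : is_derive t (1 : R) (fun s => f (z s)) ('D_(x - p) f (z t)).
    by apply: is_derive_segment; apply: df; exact: ball_radial.
  have dt := is_derive_id t (1 : R).
  apply: is_derive_eq (is_deriveM dt dz) _.
  rewrite deriv_lin_form; last by apply: df; exact: ball_radial.
  rewrite expr0 mul1r addrC; congr (_ + _); first exact: mulr1.
  rewrite /lin_form scaler_sumr; apply: eq_bigr => i _.
  by rewrite !mxE expr1; exact: mulrCA.
rewrite /radial -integral01D// (integral01_FTC (continuous01D c0 c3) dF).
by rewrite mul0r subr0 mul1r /z scale1r subrKC.
Qed.

(** The cone operator K on the 1-form sum w_i dx_i. It is also applied to forms that are not closed,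
    in the Picard iteration. *)
Definition homotopy p (w : 'I_n -> 'rV[R]_n -> R) x : R :=
  \sum_i (x 0 i - p 0 i) * radial p 0 (w i) x.

Lemma homotopy_smooth p (r : R) (w : 'I_n -> 'rV[R]_n -> R) :
  (forall i, smooth_on (ball p r) (w i)) -> smooth_on (ball p r) (homotopy p w).
Proof.
move=> sw; have oB : open (ball p r) by exact: ball_open.
apply: smooth_sum => // i; apply: smoothM => //; last exact: radial_smooth.
by apply: smoothD => //; [exact: smooth_coord | exact: smooth_cst].
Qed.

(** The homotopy formula d K w - w = - K d w. It measures how far K w is from a primitive, and gives
    the Poincare lemma when d w = 0. *)
Lemma homotopy_derive p (r : R) (w : 'I_n -> 'rV[R]_n -> R) j x :
  (forall i, smooth_on (ball p r) (w i)) -> ball p r x ->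
  pd j (homotopy p w) x - w j x
  = \sum_i (x 0 i - p 0 i) * radial p 1 (fun y => pd j (w i) y - pd i (w j) y) x.
Proof.
move=> sw bx.
have dR i : differentiable (radial p 0 (w i)) x by have [] := radial_derive 0 (sw i) bx.
have dc i : differentiable (fun y : 'rV[R]_n => y 0 i - p 0 i) x.
  by apply: differentiableB => //; exact: differentiable_coord.
have cw i l y : ball p r y -> {for y, continuous (pd i (w l))}.
  exact: smooth_continuous (smooth_partial i (sw l)).
rewrite /homotopy partial_sum; last by move=> i; exact: differentiableM.
rewrite (radial_FTC (sw j) bx) opprD addrA.
have -> : \sum_i pd j (fun y => (y 0 i - p 0 i) * radial p 0 (w i) y) x
  = radial p 0 (w j) x + \sum_i (x 0 i - p 0 i) * radial p 1 (pd j (w i)) x.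
  transitivity (\sum_i ((i == j)%:R * radial p 0 (w i) x
                        + (x 0 i - p 0 i) * radial p 1 (pd j (w i)) x)).
    apply: eq_bigr => i _; rewrite partialM//; congr (_ * _ + _ * _).
      rewrite partialD ?partial_cst ?addr0 ?partial_coord//.
      exact: differentiable_coord.
    by have [_ ->] := radial_derive 0 (sw i) bx.
  rewrite big_split/= (bigD1 j)//= eqxx mul1r big1 ?addr0// => i /negbTE ->.
  by rewrite mul0r.
rewrite [radial _ _ _ _ + _]addrC addrK -sumrB; apply: eq_bigr => i _.
by rewrite -mulrBr (radialB _ (cw _ _) (cw _ _) bx).
Qed.

Lemma poincare p (r : R) (w : 'I_n -> 'rV[R]_n -> R) j x :
  (forall i, smooth_on (ball p r) (w i)) -> ball p r x ->
  (forall i l y, ball p r y -> pd i (w l) y = pd l (w i) y) ->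
  pd j (homotopy p w) x = w j x.
Proof.
move=> sw bx cl; apply/eqP; rewrite -subr_eq0 (homotopy_derive j sw bx).
rewrite big1// => i _; rewrite [radial _ _ _ _](_ : _ = 0) ?mulr0//.
rewrite -(integral01_cst (0 : R)); apply: eq_integral01 => t t01.
by rewrite cl ?subrr ?mulr0//; exact: ball_radial.
Qed.

End Poincare.

(** * Flat linear systems *)

Section Limits.
Context {R : realType} {n : nat}.

(** The intervals of radius 2 * 4^-k around u k are nested, and the supremum of their left ends lies
    in all of them. *)
Lemma geometric_limit (u : nat -> R) :
  (forall k, `|u k.+1 - u k| <= 4^-1 ^+ k) ->
  exists l, forall k, `|u k - l| <= 2 * 4^-1 ^+ k.
Proof.
move=> du.
(* Nesting needs a constant c with c (1 - 1/4) >= 1; 2 is a convenient choice. *)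
pose a k := u k - 2 * 4^-1 ^+ k; pose b k := u k + 2 * 4^-1 ^+ k.
have g0 k : 0 <= 4^-1 ^+ k :> R by rewrite exprn_ge0// invr_ge0.
have am i j : (i <= j)%N -> a i <= a j.
  move=> ij; rewrite -(subnK ij); elim: (j - i)%N => // d IH; apply: le_trans IH _.
  have := du (d + i)%N; rewrite addSn /a exprS ler_norml => /andP[lo _].
  have := g0 (d + i)%N; lra.
have bm i j : (i <= j)%N -> b j <= b i.
  move=> ij; rewrite -(subnK ij); elim: (j - i)%N => // d IH; apply: le_trans _ IH.
  have := du (d + i)%N; rewrite addSn /b exprS ler_norml => /andP[_ hi].
  have := g0 (d + i)%N; lra.
have ab i j : a i <= b j.
  apply: le_trans (am i (maxn i j) (leq_maxl _ _)) (le_trans _ (bm j (maxn i j) (leq_maxr _ _))).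
  by rewrite /a /b lerD2l; have := g0 (maxn i j); lra.
have ha k : ubound (range a) (b k) by move=> _ [i _ <-].
exists (sup (range a)) => k; rewrite distrC ler_norml; apply/andP; split.
  have : a k <= sup (range a).
    by apply: ub_le_sup; [exists (b 0); exact: ha|exists k].
  by rewrite /a; lra.
have : sup (range a) <= b k by apply: ge_sup; [exists (a 0), 0|exact: ha].
by rewrite /b; lra.
Qed.

Lemma geometric_small (c t e : R) : 0 <= t < 1 -> 0 < e ->
  exists k, c * t ^+ k < e.
Proof.
move=> /andP[t0 t1] e0.
have : (fun k => c * t ^+ k) @ \oo --> c * 0.
  by apply: cvgMr; apply: cvg_expr; rewrite ger0_norm.
rewrite mulr0 => /cvgrPdist_lt/(_ e e0)[k _ /(_ k (leqnn k))] /=.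
rewrite sub0r normrN => h; exists k; exact: le_lt_trans (ler_norm _) h.
Qed.

(** The mean value theorem for one f k compares increments of g with the continuous limit q of the
    partials. Uniformity allows k to be chosen after h. *)
Lemma uniform_limit_derive (B : set 'rV[R]_n) (f : nat -> 'rV[R]_n -> R)
    (g : 'rV[R]_n -> R) (q : 'I_n -> 'rV[R]_n -> R) (eps : nat -> R) x :
  open B -> B x -> (forall e, 0 < e -> exists k, eps k < e) ->
  (forall k y, B y -> differentiable (f k) y) ->
  (forall k y, B y -> `|f k y - g y| <= eps k) ->
  (forall k i y, B y -> `|pd i (f k) y - q i y| <= eps k) ->
  (forall i, {for x, continuous (q i)}) ->
  differentiable g x /\ forall i, pd i g x = q i x.
Proof.
move=> oB Bx eps0 df fg fq cq.
apply: differentiable_formP => e e0.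
pose e' := e / (n%:R + 1).
have n1 : 0 < n%:R + 1 :> R by rewrite ltr_wpDl.
have e'0 : 0 < e' by rewrite divr_gt0.
have [d d0 dB] : exists2 d : R, 0 < d & forall y, ball x d y ->
    B y /\ forall i, `|q i x - q i y| < e'.
  have : \forall y \near (x : 'rV[R]_n), B y /\ forall i, `|q i x - q i y| < e'.
    apply: filterI; first exact: open_nbhs_nbhs.
    apply: (@filter_forall _ _ (fun i y => `|q i x - q i y| < e') (nbhs x)) => i.
    by have /(@cvgrPdist_lt _ _ _ (nbhs x)) := cq i; apply.
  by move=> /nbhs_ballP[d /= d0 dP]; exists d.
exists d => // h hd.
have bx : ball x d x by exact: ballxx.
have bxh : ball x d (x + h) by apply/in_ballE; rewrite [x + h]addrC addrK.
apply/ler_addgt0Pr => eta eta0.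
(* Replacing f k by g costs 2 [eps k] for the two values and n |h| [eps k] for the partials;
   together these stay below the auxiliary [eta]. *)
have [k hk] := eps0 (eta / (n%:R * `|h| + 2)) ltac:(by rewrite divr_gt0// ltr_wpDl// mulr_ge0).
have [|s s01 E] := @mean_value R n (f k) x h.
  by move=> s s01; apply: df; have [] := dB _ (ball_shift bx bxh s01).
have [By Hq] := dB _ (ball_shift bx bxh s01).
set y := x + s *: h in E By Hq.
have -> : g (x + h) - g x - lin_form (fun i => q i x) h
  = - (f k (x + h) - g (x + h)) + (f k x - g x)
    + lin_form (fun i => pd i (f k) y - q i x) h.
  have -> : lin_form (fun i => pd i (f k) y - q i x) h
      = lin_form (fun i => pd i (f k) y) h - lin_form (fun i => q i x) h.
    by rewrite /lin_form -sumrB; apply: eq_bigr => i _; rewrite mulrBr.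
  by rewrite -E; ring.
have h1 : `|- (f k (x + h) - g (x + h))| <= eps k.
  by rewrite normrN fg//; have [] := dB _ bxh.
have h2 : `|f k x - g x| <= eps k by exact: fg.
have h3 : `|lin_form (fun i => pd i (f k) y - q i x) h| <= n%:R * (eps k + e') * `|h|.
  apply: lin_form_le => i; apply: le_trans (ler_distD (q i y) _ _) _.
  by apply: lerD; [exact: fq|rewrite distrC ltW].
apply: le_trans (ler_normD _ _) _.
apply: le_trans (lerD (ler_normD _ _) h3) _.
apply: le_trans (lerD (lerD h1 h2) (lexx _)) _.
have -> : eps k + eps k + n%:R * (eps k + e') * `|h|
  = n%:R * e' * `|h| + eps k * (n%:R * `|h| + 2) by ring.
apply: lerD; last first.
  by apply: ltW; rewrite -ltr_pdivlMr// ltr_wpDl// mulr_ge0.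
rewrite ler_wpM2r// /e' mulrCA ger_pMr// ler_pdivrMr// mul1r lerDl//.
Qed.

Lemma uniform_limit_continuous (B : set 'rV[R]_n) (f : nat -> 'rV[R]_n -> R)
    (g : 'rV[R]_n -> R) (eps : nat -> R) x :
  open B -> B x -> (forall e, 0 < e -> exists k, eps k < e) ->
  (forall k y, B y -> `|f k y - g y| <= eps k) ->
  (forall k, {for x, continuous (f k)}) -> {for x, continuous g}.
Proof.
move=> oB Bx eps0 fg cf; apply/(@cvgrPdist_lt _ _ _ (nbhs x)) => e e0.
have [k hk] := eps0 (e / 4) ltac:(by rewrite divr_gt0).
have e2 : 0 < e / 2 by rewrite divr_gt0.
have fk : \forall y \near (x : 'rV[R]_n), `|f k x - f k y| < e / 2.
  by have /(@cvgrPdist_lt _ _ _ (nbhs x)) := cf k; apply.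
apply: filterS2 (open_nbhs_nbhs (conj oB Bx)) fk => y By fxy.
have h1 := fg k x Bx; have h2 := fg k y By; rewrite distrC in h1.
apply: le_lt_trans (ler_distD (f k x) _ _) _.
apply: le_lt_trans (lerD (lexx _) (ler_distD (f k y) _ _)) _.
by lra.
Qed.

End Limits.

(** * Picard iteration for dg = g A *)

Section Frobenius.
Context {R : realType} {n m : nat}.
Implicit Types (p x : 'rV[R]_n).

Lemma mulmx_entry_le (a b c : nat) (P : 'M[R]_(a, b)) (Q : 'M[R]_(b, c)) (u v : R) :
  (forall i j, `|P i j| <= u) -> (forall i j, `|Q i j| <= v) ->
  forall i j, `|(P *m Q) i j| <= b%:R * (u * v).
Proof.
move=> Pu Qv i j; rewrite mxE (le_trans (ler_norm_sum _ _ _))//.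
rewrite -[b in b%:R]card_ord mulr_natl -sumr_const; apply: ler_sum => l _.
by rewrite normrM ler_pM.
Qed.

Lemma mxBE (a b : nat) (P Q : 'M[R]_(a, b)) i j : (P - Q) i j = P i j - Q i j.
Proof. by rewrite !mxE. Qed.

Lemma sum_radial_le p (r M : R) k (f : 'I_n -> 'rV[R]_n -> R) x :
  (forall i y, ball p r y -> {for y, continuous (f i)}) -> ball p r x ->
  (forall i y, ball p r y -> `|f i y| <= M) ->
  `|\sum_i (x 0 i - p 0 i) * radial p k (f i) x| <= n%:R * (r * M).
Proof.
move=> cf bx fM; rewrite (le_trans (ler_norm_sum _ _ _))//.
rewrite -[n in n%:R]card_ord mulr_natl -sumr_const; apply: ler_sum => i _.
rewrite normrM ler_pM//; last exact: radial_le (cf i) bx (fM i).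
move/in_ballE: bx => /ltW; apply: le_trans.
by have := coord_norm_le (x - p) 0 i; rewrite !mxE.
Qed.

Variables (p : 'rV[R]_n) (A : 'I_n -> 'rV[R]_n -> 'M[R]_m).

(* The integral along rays solves the system only in radial directions; flatness
   of A makes the errors [picard_error] in the other directions tend to 0. *)
Fixpoint picard (k : nat) : 'rV[R]_n -> 'M[R]_m :=
  if k is k'.+1 then
    fun x => 1%:M + \matrix_(a, b) homotopy p (fun i y => (picard k' y *m A i y) a b) x
  else fun=> 1%:M.

Lemma picardSE k x a b : picard k.+1 x a b
  = (1%:M : 'M[R]_m) a b + homotopy p (fun i y => (picard k y *m A i y) a b) x.
Proof. by rewrite /= !mxE. Qed.

Variable r : R.
Hypothesis r0 : 0 < r.
Let B := ball p r.
Hypothesis sA : forall i, smooth_on B (A i).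
Hypothesis flatA : forall i j x, B x ->
  pd j (A i) x - pd i (A j) x = A i x *m A j x - A j x *m A i x.
Variable C : R.
Hypothesis C0 : 0 <= C.
Hypothesis AC : forall i x, B x -> forall a b, `|A i x a b| <= C.
(** The term m C bounds products with A, so each iteration contracts by 1/8; the term C covers the
    first step, where the iterate is the identity. *)
Hypothesis small : n%:R * (r * (m%:R * C + C)) <= 8^-1.

Let oB : open B. Proof. exact: ball_open. Qed.

Lemma picard_smooth k : smooth_on B (picard k).
Proof.
elim: k => [|k IH] /=; first exact: smooth_mx_cst.
apply: smooth_mxD => //; first exact: smooth_mx_cst.
apply: smooth_matrix => // a b; apply: homotopy_smooth => i.
by have /(smooth_mxP _ oB) := smooth_mulmx oB IH (sA i); apply.
Qed.

Let sGA k i a b : smooth_on B (fun y => (picard k y *m A i y) a b).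
Proof. by have /(smooth_mxP _ oB) := smooth_mulmx oB (picard_smooth k) (sA i); apply. Qed.

Let mC0 : 0 <= m%:R * C. Proof. by rewrite mulr_ge0. Qed.

Let step_small (u : R) : 0 <= u -> n%:R * (r * (m%:R * (u * C))) <= 8^-1 * u.
Proof.
move=> u0; apply: le_trans (ler_wpM2r u0 small).
have -> : n%:R * (r * (m%:R * (u * C))) = n%:R * r * (m%:R * C) * u by ring.
rewrite ler_wpM2r//.
have -> : n%:R * (r * (m%:R * C + C)) = n%:R * r * (m%:R * C) + n%:R * r * C by ring.
by rewrite lerDl !mulr_ge0// ltW.
Qed.

Lemma picard_step k x : B x -> forall a b,
  `|(picard k.+1 x - picard k x) a b| <= 4^-1 ^+ k.
Proof.
elim: k x => [|k IH] x Bx a b.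
  rewrite expr0 /= addrC addKr mxE.
  apply: (@le_trans _ _ (n%:R * (r * C))).
    apply: sum_radial_le => //.
      by move=> i y By; exact: smooth_continuous (sGA 0 i a b) By.
    by move=> i y By; rewrite /= mul1mx; exact: AC.
  apply: (@le_trans _ _ 8^-1); last by lra.
  apply: le_trans small; rewrite ler_wpM2l// ler_pM2l// lerDr//.
have -> : (picard k.+2 x - picard k.+1 x) a b
  = \sum_i (x 0 i - p 0 i) *
      radial p 0 (fun y => ((picard k.+1 y - picard k y) *m A i y) a b) x.
  rewrite mxBE 2!picardSE opprD addrACA subrr add0r.
  rewrite /homotopy -sumrB; apply: eq_bigr => i _; rewrite -mulrBr; congr (_ * _).
  rewrite -(@radialB _ _ _ _ _ _ r)//.
  - by congr (radial p 0 _ x); apply/funext => y; rewrite mulmxBl !mxE.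
  - by move=> y; exact: smooth_continuous (sGA k.+1 i a b).
  - by move=> y; exact: smooth_continuous (sGA k i a b).
have g0 : 0 <= 4^-1 ^+ k :> R by rewrite exprn_ge0// invr_ge0.
apply: (@le_trans _ _ (n%:R * (r * (m%:R * (4^-1 ^+ k * C))))).
  apply: sum_radial_le => //.
    move=> i y By; have sD := smooth_mxB oB (picard_smooth k.+1) (picard_smooth k).
    have /(smooth_mxP _ oB)/(_ a b) := smooth_mulmx oB sD (sA i).
    by move/smooth_continuous; apply.
  by move=> i y By; apply: mulmx_entry_le => *; [exact: IH|exact: AC].
by apply: le_trans (step_small g0) _; rewrite exprS; lra.
Qed.

Definition picard_error k j x := pd j (picard k) x - picard k x *m A j x.

(** The homotopy formula for the form G_k A produces its exterior derivative. Flatness cancels the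
    terms in G_k itself, leaving only the previous errors times A, and the change from G_k to
    G_{k+1}. *)
Lemma picard_error_step k j x : B x -> forall a b,
  picard_error k.+1 j x a b =
  \sum_i (x 0 i - p 0 i) * radial p 1 (fun y =>
     (picard_error k j y *m A i y - picard_error k i y *m A j y) a b) x
  - ((picard k.+1 x - picard k x) *m A j x) a b.
Proof.
move=> Bx a b; rewrite /picard_error mulmxBl.
rewrite 2!mxBE.
have dG l y : B y -> differentiable (picard l) y.
  exact: smooth_differentiable (picard_smooth l).
have dA i y : B y -> differentiable (A i) y by exact: smooth_differentiable.
rewrite (partial_mxE j a b (dG k.+1 x Bx)).
have -> : pd j (fun y => picard k.+1 y a b) x
  = pd j (homotopy p (fun i y => (picard k y *m A i y) a b)) x.
  have dh : differentiable (homotopy p (fun i y => (picard k y *m A i y) a b)) x.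
    by apply: smooth_differentiable Bx; apply: homotopy_smooth.
  under eq_fun do rewrite picardSE.
  by rewrite partialD ?partial_cst ?add0r//; exact: differentiable_cst.
have := homotopy_derive j (w := fun i y => (picard k y *m A i y) a b) (sGA k ^~ a ^~ b) Bx.
move/eqP; rewrite subr_eq => /eqP ->.
rewrite opprB [RHS]addrA; congr (_ - _); congr (_ + _).
apply: eq_bigr => i _; congr (_ * _); apply: eq_integral01 => t t01.
congr (_ * _); have By := ball_radial t01 Bx; set y := p + _ in By *.
rewrite -(partial_mxE _ _ _ (partial_mulmx j (dG k y By) (dA i y By)).1).
rewrite -(partial_mxE _ _ _ (partial_mulmx i (dG k y By) (dA j y By)).1).
rewrite !partialMmx//; [|exact: dG|exact: dA|exact: dG|exact: dA].
rewrite -mxBE; congr (fun_of_matrix _ a b).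
rewrite opprD addrACA -mulmxBr flatA// mulmxBr !mulmxBl !mulmxA.
by rewrite opprB [LHS]addrACA [RHS]addrACA; congr (_ + _); exact: addrC.
Qed.

(** Write u for the bound at step k. The error terms contribute at most 2 * u/8 and the change of
    iterate m C 4^-k, at most u/4 thanks to the 4 m C in the constant; hence the factor 1/2. The
    summand C covers k = 0. *)
Lemma picard_error_le k j x : B x -> forall a b,
  `|picard_error k j x a b| <= (4 * (m%:R * C) + C) * 2^-1 ^+ k.
Proof.
set c := _ + C; have c0 : 0 <= c by rewrite addr_ge0// mulr_ge0.
elim: k j x => [|k IH] j x Bx a b.
  rewrite expr0 mulr1 /picard_error /= partial_cst sub0r mul1mx mxE normrN.
  by apply: le_trans (AC j Bx a b) _; rewrite lerDr mulr_ge0.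
have g2 : 0 <= 2^-1 ^+ k :> R by rewrite exprn_ge0// invr_ge0.
have g4 : 0 <= 4^-1 ^+ k :> R by rewrite exprn_ge0// invr_ge0.
have g42 : 4^-1 ^+ k <= 2^-1 ^+ k :> R.
  by apply: lerXn2r; rewrite ?nnegrE ?invr_ge0//; lra.
set u := c * 2^-1 ^+ k in IH *; have u0 : 0 <= u by rewrite mulr_ge0.
rewrite picard_error_step//; apply: le_trans (ler_normB _ _) _.
have sE i : smooth_on B (picard_error k i).
  apply: smooth_mxB => //; first by apply: smooth_partial; exact: picard_smooth.
  by apply: smooth_mulmx => //; exact: picard_smooth.
have h1 : `|\sum_i (x 0 i - p 0 i) * radial p 1 (fun y =>
     (picard_error k j y *m A i y - picard_error k i y *m A j y) a b) x|
     <= n%:R * (r * (m%:R * (u * C) + m%:R * (u * C))).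
  apply: sum_radial_le => // i y By.
    have sD := smooth_mxB oB (smooth_mulmx oB (sE j) (sA i)) (smooth_mulmx oB (sE i) (sA j)).
    by have /(smooth_mxP _ oB)/(_ a b)/smooth_continuous := sD; apply.
  rewrite mxBE; apply: le_trans (ler_normB _ _) _.
  by apply: lerD; apply: mulmx_entry_le => *; [exact: IH|exact: AC|exact: IH|exact: AC].
have h2 : `|((picard k.+1 x - picard k x) *m A j x) a b| <= m%:R * (4^-1 ^+ k * C).
  by apply: mulmx_entry_le => *; [exact: picard_step|exact: AC].
apply: le_trans (lerD h1 h2) _.
have -> : n%:R * (r * (m%:R * (u * C) + m%:R * (u * C)))
  = 2 * (n%:R * (r * (m%:R * (u * C)))) by ring.
have := step_small u0; set s := n%:R * _ => su.
have h3 : m%:R * (4^-1 ^+ k * C) <= 4^-1 * u.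
  rewrite mulrCA; apply: le_trans (ler_wpM2r mC0 g42) _.
  rewrite /u /c; have := mulr_ge0 C0 g2; set t := 2^-1 ^+ k; nra.
rewrite exprS; have -> : c * (2^-1 * 2^-1 ^+ k) = 2^-1 * u by rewrite /u; ring.
by lra.
Qed.

Lemma picard_limit : exists g : 'rV[R]_n -> 'M[R]_m,
  [/\ smooth_on B g, g p = 1%:M &
      forall x, B x -> forall i, pd i g x = g x *m A i x].
Proof.
(* Entrywise limits, with the default 0 outside the ball. *)
have /choice[g0 hg0] : forall xab : 'rV[R]_n * ('I_m * 'I_m), exists l : R,
    B xab.1 -> forall k, `|picard k xab.1 xab.2.1 xab.2.2 - l| <= 2 * 4^-1 ^+ k.
  move=> [x [a b]] /=; have [Bx|nBx] := pselect (B x); last by exists 0.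
  have [l hl] : exists l, forall k, `|picard k x a b - l| <= 2 * 4^-1 ^+ k.
    by apply: geometric_limit => k; have := picard_step k Bx a b; rewrite mxBE.
  by exists l.
pose g x : 'M[R]_m := \matrix_(a, b) g0 (x, (a, b)).
have hg k x a b : B x -> `|picard k x a b - g x a b| <= 2 * 4^-1 ^+ k.
  by move=> Bx; rewrite mxE; exact: (hg0 (x, (a, b))).
pose c := 4 * (m%:R * C) + C; have c0 : 0 <= c by rewrite addr_ge0// mulr_ge0.
(* One sequence dominates the Picard error (c), the distance to the limit (2) and that distance
   multiplied by A (2 m C). *)
pose eps k : R := (c + 2 + m%:R * (2 * C)) * 2^-1 ^+ k.
have g42 k : 4^-1 ^+ k <= 2^-1 ^+ k :> R.
  by apply: lerXn2r; rewrite ?nnegrE ?invr_ge0//; lra.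
have g4 k : 0 <= 4^-1 ^+ k :> R by rewrite exprn_ge0// invr_ge0.
have eps0 e : 0 < e -> exists k, eps k < e.
  by apply: geometric_small; apply/andP; split; lra.
have mC2 : 0 <= m%:R * (2 * C) by rewrite !mulr_ge0.
have le1 k : 2 * 4^-1 ^+ k <= eps k.
  apply: (@le_trans _ _ (2 * 2^-1 ^+ k)); first by rewrite ler_wpM2l.
  by rewrite /eps ler_wpM2r//; lra.
have dG k x a b : B x -> differentiable (fun y => picard k y a b) x.
  by have /(smooth_mxP _ oB)/(_ a b) := picard_smooth k; exact: smooth_differentiable.
have cg a b x : B x -> {for x, continuous (fun y => g y a b)}.
  move=> Bx; apply: (uniform_limit_continuous (f := fun k y => picard k y a b) oB Bx eps0).
    by move=> k y By; exact: le_trans (hg k y a b By) (le1 k).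
  by move=> k; apply: differentiable_continuous; exact: dG.
have key a b x : B x -> differentiable (fun y => g y a b) x /\
    forall i, pd i (fun y => g y a b) x = (g x *m A i x) a b.
  move=> Bx.
  apply: (uniform_limit_derive (f := fun k y => picard k y a b)
    (q := fun i y => (g y *m A i y) a b) oB Bx eps0).
  - by move=> k y By; exact: dG.
  - by move=> k y By; exact: le_trans (hg k y a b By) (le1 k).
  - move=> k i y By.
    have dGk : differentiable (picard k) y.
      by apply: smooth_differentiable By; exact: picard_smooth.
    rewrite -(partial_mxE i a b dGk).
    have -> : pd i (picard k) y a b - (g y *m A i y) a b
      = picard_error k i y a b + ((picard k y - g y) *m A i y) a b.
      rewrite /picard_error mulmxBl.
      have E (P Q S : 'M[R]_m) : P a b - S a b = (P - Q) a b + (Q - S) a b.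
        by rewrite !mxE addrA subrK.
      exact: E.
    apply: le_trans (ler_normD _ _) _.
    have h1 := picard_error_le k i By a b.
    have h2 : `|((picard k y - g y) *m A i y) a b| <= m%:R * (2 * 4^-1 ^+ k * C).
      by apply: mulmx_entry_le => c1 c2; [rewrite mxBE; exact: hg|exact: AC].
    apply: le_trans (lerD h1 h2) _; rewrite -/c /eps.
    have h3 : m%:R * (2 * 4^-1 ^+ k * C) <= m%:R * (2 * C) * 2^-1 ^+ k.
      rewrite [2 * _ * C]mulrAC [leLHS]mulrA; exact: ler_wpM2l.
    by have := le_trans (g4 k) (g42 k); set t := 2^-1 ^+ k in h3 *; lra.
  - move=> i.
    have -> : (fun y => (g y *m A i y) a b) = \sum_l (fun y => g y a l * A i y l b).
      by apply/funext => y; rewrite mxE fct_sumE.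
    elim/big_rec: _ => [|l h _ ch]; first exact: cst_continuous.
    apply: (continuousD _ ch); apply: (continuousM (cg a l x Bx)).
    by have /(smooth_mxP _ oB)/(_ l b) := sA i => /smooth_continuous; apply.
have dg x : B x -> differentiable g x.
  by move=> Bx; apply/differentiable_mxP => a b; have [] := key a b x Bx.
have pg x : B x -> forall i, pd i g x = g x *m A i x.
  move=> Bx i; apply/matrixP => a b; rewrite (partial_mxE i a b (dg x Bx)).
  by have [_ ->] := key a b x Bx.
exists g; split=> //.
- suff H k : forall a b, class_C k B (fun y => g y a b).
    by apply/(smooth_mxP _ oB) => a b k; exact: H.
  (* Bootstrapping: if g is of class C^k, so are its partials g A, hence g is of class C^(k+1). *)
  elim: k => [|k IH] a b; first by move=> x Bx; exact: cg.
  apply: (class_C_partial_eq (df := fun i x => \sum_l g x a l * A i x l b)) => //.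
  + by move=> x Bx; have [] := key a b x Bx.
  + by move=> i x Bx; have [_ ->] := key a b x Bx; rewrite mxE.
  + move=> i; apply: class_C_sum => // l _; apply: class_CM => //.
    by have /(smooth_mxP _ oB)/(_ l b) := sA i; apply.
- have Bp : B p by exact: ballxx.
  have Gp k : picard k p = 1%:M.
    case: k => //= k; rewrite [X in _ + X](_ : _ = 0) ?addr0//.
    apply/matrixP => a b; rewrite !mxE /homotopy big1// => i _.
    by rewrite subrr mul0r.
  apply/matrixP => a b; apply/eqP; rewrite -subr_eq0 -normr_le0 distrC.
  apply/ler_addgt0Pr => e e0; rewrite add0r.
  have [k hk] := eps0 e e0; have := hg k p a b Bp; rewrite Gp => h.
  exact: le_trans h (le_trans (le1 k) (ltW hk)).
Qed.

End Frobenius.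

(** The flatness condition is the equality of the mixed partials of a solution of dg = g A. The ball
    shrinks only to make the iteration contract. *)
Lemma frobenius (R : realType) (n m : nat) (p : 'rV[R]_n) (r0 : R)
    (A : 'I_n -> 'rV[R]_n -> 'M[R]_m) :
  0 < r0 -> (forall i, smooth_on (ball p r0) (A i)) ->
  (forall i j x, ball p r0 x ->
     pd j (A i) x - pd i (A j) x = A i x *m A j x - A j x *m A i x) ->
  exists2 r : R, 0 < r <= r0 & exists g : 'rV[R]_n -> 'M[R]_m,
    [/\ smooth_on (ball p r) g, g p = 1%:M &
        forall x, ball p r x -> forall i, pd i g x = g x *m A i x].
Proof.
move=> r00 sA flatA.
have [||C C0 HC] := @ball_compact_bounds R n p r0 (r0 / 2)
    ('I_n * ('I_m * 'I_m))%type (fun iab y => A iab.1 y iab.2.1 iab.2.2).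
- by lra.
- move=> [i [a b]] y By /=.
  have /(smooth_mxP _ (ball_open _ _))/(_ a b) := sA i.
  by move/smooth_continuous; apply.
pose K := n%:R * (m%:R * C + C); have K0 : 0 <= K.
  by rewrite mulr_ge0// addr_ge0// mulr_ge0.
(* Entries of A are bounded by C on the half ball, and r K <= 1/8 is the contraction condition. *)
pose r := Num.min (r0 / 2) (8^-1 / (K + 1)).
have K1 : 0 < K + 1 by rewrite ltr_wpDl.
have r_gt0 : 0 < r by rewrite lt_min !divr_gt0.
have r2 : r <= r0 / 2 by rewrite ge_min lexx.
have rr0 : r <= r0 by lra.
have sub : ball p r `<=` ball p r0 by exact: le_ball.
have sub2 : ball p r `<=` ball p (r0 / 2) by exact: le_ball.
exists r; first by rewrite r_gt0.
apply: (@picard_limit R n m p A r _ _ _ C) => //.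
- by move=> i; apply: smooth_on_subset (sA i).
- by move=> i j x /sub; exact: flatA.
- by move=> i x /sub2 bx a b; exact: (HC (i, (a, b))).
- rewrite mulrCA -/K; apply: le_trans (_ : r * (K + 1) <= _).
    by rewrite ler_wpM2l// ?lerDl// ltW.
  by rewrite -ler_pdivlMr// ge_min lexx orbT.
Qed.

(** * Inverse functions *)

Section InverseFunction.
Context {R : realType} {n : nat}.
Implicit Types (x y h : 'rV[R]_n).

Lemma unitmx_of_kernel (A : 'M[R]_n) :
  (forall a : 'rV[R]_n, a *m A = 0 -> a = 0) -> A \in unitmx.
Proof.
move=> kA; rewrite -row_free_unit -kermx_eq0; apply/eqP/row_matrixP => i.
by rewrite row0; apply: kA; rewrite -row_mul mulmx_ker row0.
Qed.

Lemma rV_mulmx_le (h : 'rV[R]_n) (A : 'M[R]_n) : `|h *m A| <= n%:R * (`|h| * `|A|).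
Proof.
apply: mx_norm_le; first by rewrite !mulr_ge0.
by apply: mulmx_entry_le => i j; exact: coord_norm_le.
Qed.

(** Vectors are rows and multiply from the left, so this is the transpose of the usual Jacobian. *)
Definition jac (psi : 'rV[R]_n -> 'rV[R]_n) x : 'M[R]_n := \matrix_(i, j) pd i psi x 0 j.

Lemma deriv_jac psi x h : differentiable psi x -> 'D_h psi x = h *m jac psi x.
Proof.
move=> dpsi; rewrite deriv_partial//; apply/rowP => j.
by rewrite summxE mxE; apply: eq_bigr => i _; rewrite !mxE.
Qed.

Lemma differentiable_jac_eps psi x : differentiable psi x ->
  forall e, 0 < e -> exists2 d, 0 < d & forall h, `|h| < d ->
     `|psi (x + h) - psi x - h *m jac psi x| <= e * `|h|.
Proof.
move=> df e e0; have := diff_locally df => /eqaddoP/(_ e e0)/nbhs_ballP[d d0 de].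
exists d => // h hd; have := de h; rewrite -ball_normE/= sub0r normrN => /(_ hd).
by rewrite !fctE /= opprD addrA [h + x]addrC -deriveE// deriv_jac.
Qed.

(** |T x - x| attains a minimum on the compact ball; at a minimiser c, passing to T c would halve
    it, so it is 0. *)
Lemma fixed_point (T : 'rV[R]_n -> 'rV[R]_n) x0 (r : R) : 0 <= r ->
  (forall x, `|x - x0| <= r -> {for x, continuous T}) ->
  (forall x, `|x - x0| <= r -> `|T x - x0| <= r) ->
  (forall x y, `|x - x0| <= r -> `|y - x0| <= r -> `|T x - T y| <= 2^-1 * `|x - y|) ->
  exists2 x, `|x - x0| <= r & T x = x.
Proof.
move=> r0 contT hT cT; pose K := closed_ball_ (fun y : 'rV[R]_n => `|y|) x0 r.
have KE x : K x <-> `|x - x0| <= r by rewrite /K /closed_ball_ /= distrC.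
have K0 : K !=set0 by exists x0; apply/KE; rewrite subrr normr0.
have cK : compact K.
  apply: bounded_closed_compact; last exact: closed_closed_ball_.
  exists (`|x0| + r); split; first exact: num_real.
  move=> M hM y /KE hy; apply: ltW; apply: le_lt_trans hM.
  by rewrite -[y](subrKC x0) (le_trans (ler_normD _ _))// lerD2l.
have cf : {within K, continuous (fun x => `|T x - x|)}.
  apply: continuous_in_subspaceT => x; rewrite inE => /KE hx.
  have cTx : {for x, continuous (fun x => T x - x)}.
    by apply: continuousB; [exact: contT|].
  exact: (continuous_comp cTx (@norm_continuous _ _ _)).
have [c Kc minc] := EVT_min_rV K0 cK cf.
have hc : `|c - x0| <= r by apply/KE; move: Kc; rewrite inE.
exists c => //; apply/eqP; rewrite -subr_eq0 -normr_le0.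
have hTc := hT c hc.
have h1 : `|T c - c| <= `|T (T c) - T c| by apply: minc; rewrite inE; apply/KE.
have h2 := cT _ _ hTc hc.
have h3 : 0 <= `|T c - c| by [].
lra.
Qed.

Variables (O : set 'rV[R]_n) (psi : 'rV[R]_n -> 'rV[R]_n) (x0 : 'rV[R]_n).
Hypotheses (oO : open O) (Ox0 : O x0) (spsi : smooth_on O psi).
Hypothesis J0 : jac psi x0 \in unitmx.

Let L := invmx (jac psi x0).
(** The Newton map with frozen derivative: psi x = y means that x is fixed by x -> mu x + y L. *)
Let mu x := x - psi x *m L.

Let smu : smooth_on O mu.
Proof.
apply: smooth_mxB => //; last by apply: smooth_mulmx => //; exact: smooth_mx_cst.
by apply/smooth_mxP => // a b; rewrite ord1; exact: smooth_coord.
Qed.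

Let pd_mu i x : O x -> pd i mu x = delta_mx 0 i - pd i psi x *m L.
Proof.
move=> Ox; have dpsi : differentiable psi x by exact: smooth_differentiable Ox.
have [dL pL] := differentiable_mulmxr L i dpsi.
rewrite partial_mxD//; last exact: differentiableN.
by rewrite partial_mxN// pL pdD derive_id.
Qed.

Let row_jac i x : pd i psi x = delta_mx 0 i *m jac psi x.
Proof. by rewrite -rowE; apply/rowP => j; rewrite !mxE. Qed.

(** The derivative of mu vanishes at x0, hence is small nearby. The bound is chosen so that the
    factor n of the mean value estimate leaves a Lipschitz constant at most 1/2. *)
Let lipschitz_ball : exists r : R, [/\ 0 < r, ball x0 r `<=` O &
  forall x, ball x0 r x -> forall i j, `|pd i mu x 0 j| <= (2 * (n%:R + 1))^-1].
Proof.
have e0 : 0 < (2 * (n%:R + 1))^-1 :> R by rewrite invr_gt0 mulr_gt0// ltr_wpDl.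
have : \forall x \near (x0 : 'rV[R]_n), O x /\ forall ij : 'I_n * 'I_n,
    `|pd ij.1 mu x0 0 ij.2 - pd ij.1 mu x 0 ij.2| < (2 * (n%:R + 1))^-1.
  apply: filterI; first exact: open_nbhs_nbhs.
  apply: (@filter_forall _ _ (fun ij x => `|pd ij.1 mu x0 0 ij.2 - pd ij.1 mu x 0 ij.2|
    < (2 * (n%:R + 1))^-1) (nbhs x0)) => -[i j] /=.
  have /(smooth_mxP _ oO)/(_ 0 j) := smooth_partial i smu.
  by move/smooth_continuous => /(_ x0 Ox0)/(@cvgrPdist_lt _ _ _ (nbhs x0)); apply.
move=> /nbhs_ballP[r /= r0 rP]; exists r; split=> // [x /rP[]//|x bx i j].
have [_ /(_ (i, j))/=] := rP x bx.
rewrite pd_mu// row_jac -mulmxA mulmxV// mulmx1 subrr mxE sub0r normrN.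
exact: ltW.
Qed.

Let mu_lipschitz (r : R) : ball x0 r `<=` O ->
  (forall x, ball x0 r x -> forall i j, `|pd i mu x 0 j| <= (2 * (n%:R + 1))^-1) ->
  forall x y, ball x0 r x -> ball x0 r y -> `|mu y - mu x| <= 2^-1 * `|y - x|.
Proof.
move=> rO bmu x y bx by_; have n1 : 0 < n%:R + 1 :> R by rewrite ltr_wpDl.
apply: mx_norm_le; first by rewrite mulr_ge0// invr_ge0.
move=> a j; rewrite ord1 mxBE -[in mu y](subrKC x y).
have := @mean_value_le R n (fun z => mu z 0 j) x0 r (2 * (n%:R + 1))^-1 x (y - x).
move=> /(_ _ _ bx) H; apply: le_trans (H _ _ _) _.
- move=> z bz; have /(smooth_mxP _ oO)/(_ 0 j) := smu.
  by move/smooth_differentiable; apply; exact: rO.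
- move=> z i bz; rewrite -partial_mxE; last by apply: smooth_differentiable (rO _ bz).
  exact: bmu.
- by rewrite subrKC.
rewrite ler_wpM2r// invfM mulrCA ger_pMr ?invr_gt0// ler_pdivrMr// mul1r.
by rewrite lerDl.
Qed.

(** The estimate x - x' = mu x - mu x' + (psi x - psi x') L, with mu 1/2-Lipschitz, yields existence
    of preimages, injectivity and a Lipschitz inverse. *)
Lemma inverse_function : exists (d : R) (U : set 'rV[R]_n) (phi : 'rV[R]_n -> 'rV[R]_n),
  [/\ 0 < d, open U, U x0 & U `<=` O] /\
  [/\ smooth_on (ball (psi x0) d) phi,
      forall y, ball (psi x0) d y -> U (phi y) /\ psi (phi y) = y,
      forall x, U x -> ball (psi x0) d (psi x) /\ phi (psi x) = x &
      forall x, U x -> jac psi x \in unitmx].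
Proof.
have [r [r0 rO bmu]] := lipschitz_ball.
have lip := mu_lipschitz rO bmu.
have uL : L \in unitmx by rewrite unitmx_inv.
have clb x : `|x - x0| <= r / 2 -> ball x0 r x.
  by move=> h; apply/in_ballE; apply: le_lt_trans h _; lra.
pose K := n%:R * `|L|; have K0 : 0 <= K by rewrite mulr_ge0.
have LK y y' : `|(y - y') *m L| <= K * `|y - y'|.
  by apply: le_trans (rV_mulmx_le _ _) _; rewrite /K mulrA mulrAC.
(* Then |(y - psi x0) L| <= r/8, and x -> mu x + y L sends the ball of radius r/2 into one of radius
   r/4 + r/8. *)
pose d := r / (8 * (K + 1)).
have K1 : 0 < K + 1 by rewrite ltr_wpDl.
have d0 : 0 < d by rewrite divr_gt0// mulr_gt0.
have Kd y : ball (psi x0) d y -> `|(y - psi x0) *m L| <= r / 8.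
  move=> /in_ballE yd; apply: le_trans (LK _ _) _.
  apply: (@le_trans _ _ ((K + 1) * d)).
    by apply: ler_pM => //; [rewrite lerDl|exact: ltW].
  suff -> : (K + 1) * d = r / 8 by [].
  by rewrite /d; field; rewrite gt_eqF.
have muE x : x = mu x + psi x *m L by rewrite subrK.
have xE x x' : x - x' = mu x - mu x' + (psi x - psi x') *m L.
  by rewrite {1}(muE x) {1}(muE x') opprD addrACA -mulmxBl.
have bx0 : ball x0 r x0 by exact: ballxx.
(* The preimage is a fixed point of mu + y L; x0 is the default outside the ball. *)
have /choice[phi0 hphi0] : forall y, exists x, ball (psi x0) d y ->
    `|x - x0| < r / 2 /\ psi x = y.
  move=> y; have [yd|nyd] := pselect (ball (psi x0) d y); last by exists x0.
  pose T x := mu x + y *m L.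
  have Tx x : T x - x0 = mu x - mu x0 + (y - psi x0) *m L.
    by rewrite /T {1}(muE x0) opprD addrACA -mulmxBl.
  have [|x hx|x hx|x x' hx hx'|x hx Tfix] := @fixed_point T x0 (r / 2).
  - by rewrite divr_ge0// ltW.
  - apply: continuousD; last exact: cst_continuous.
    exact: smooth_continuous smu (rO _ (clb _ hx)).
  - rewrite Tx; apply: le_trans (ler_normD _ _) _.
    by have := lip x0 x bx0 (clb _ hx); have := Kd y yd; lra.
  - by rewrite /T opprD addrACA subrr addr0; apply: lip; exact: clb.
  exists x => _; split.
    have : `|x - x0| <= `|mu x - mu x0| + `|(y - psi x0) *m L|.
      by rewrite -{1}Tfix Tx ler_normD.
    by have := lip x0 x bx0 (clb _ hx); have := Kd y yd; lra.
  by have := Tfix; rewrite {2}(muE x) => /addrI/(can_inj (mulmxK uL)) ->.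
pose D := ball (psi x0) d.
have oD : open D by exact: ball_open.
have br2 x : ball x0 (r / 2) x -> ball x0 r x by move=> /in_ballE /ltW; exact: clb.
have phir y : D y -> ball x0 (r / 2) (phi0 y).
  by move=> /hphi0[h _]; apply/in_ballE.
have psiphi y : D y -> psi (phi0 y) = y by move=> /hphi0[].
have inj x x' : ball x0 r x -> ball x0 r x' -> psi x = psi x' -> x = x'.
  move=> bx bx' e; apply/eqP; rewrite -subr_eq0 -normr_le0.
  have := lip x' x bx' bx; rewrite (xE x x') e subrr mul0mx addr0.
  have : 0 <= `|mu x - mu x'| by [].
  lra.
(* If a is in the kernel, a = a - a J L is the derivative of mu along a, so |a| <= |a|/2. *)
have uJ x : ball x0 r x -> jac psi x \in unitmx.
  move=> bx; apply: unitmx_of_kernel => a aJ; apply/eqP; rewrite -normr_le0.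
  have aE : a = \sum_i a 0 i *: pd i mu x.
    transitivity (a - a *m jac psi x *m L); first by rewrite aJ mul0mx subr0.
    rewrite {1 2}(row_sum_partial a) !mulmx_suml -sumrB; apply: eq_bigr => i _.
    by rewrite pd_mu ?row_jac ?scalerBr ?scalemxAl//; exact: rO.
  have n1 : 0 < n%:R + 1 :> R by rewrite ltr_wpDl.
  have : `|a| <= 2^-1 * `|a|.
    apply: mx_norm_le; first by rewrite mulr_ge0// invr_ge0.
    move=> i j; rewrite ord1 [in leLHS]aE summxE.
    rewrite (_ : \sum_l _ = lin_form (fun l => pd l mu x 0 j) a); last first.
      by apply: eq_bigr => l _; rewrite mxE.
    apply: le_trans (lin_form_le a (bmu x bx ^~ j)) _.
    rewrite ler_wpM2r// invfM mulrCA ger_pMr ?invr_gt0// ler_pdivrMr// mul1r.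
    by rewrite lerDl.
  lra.
have phiL y y' : D y -> D y' -> `|phi0 y - phi0 y'| <= 2 * K * `|y - y'|.
  move=> Dy Dy'; have b1 := br2 _ (phir y Dy); have b2 := br2 _ (phir y' Dy').
  have h1 := lip _ _ b2 b1; have h2 := LK y y'.
  have : `|phi0 y - phi0 y'| <= `|mu (phi0 y) - mu (phi0 y')| + `|(y - y') *m L|.
    by rewrite [in leLHS](xE (phi0 y)) !psiphi// ler_normD.
  lra.
have dphi j y : D y -> differentiable (fun z => phi0 z 0 j) y /\
    forall i, pd i (fun z => phi0 z 0 j) y = (invmx (jac psi (phi0 y))) i j.
  move=> Dy; have b1 := br2 _ (phir y Dy).
  apply: differentiable_formP => e e0.
  set J' := invmx _; set K' := n%:R * `|J'|.
  have K'0 : 0 <= K' by rewrite mulr_ge0.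
  (* The expansion of psi at phi0 y is transported by J', which costs K', and |k| <= 2 K |h|, which
     costs 2 K. *)
  pose eta := e / ((K' + 1) * (2 * K + 1)).
  have K'1 : 0 < K' + 1 by rewrite ltr_wpDl.
  have K21 : 0 < 2 * K + 1 by rewrite ltr_wpDl// mulr_ge0.
  have eta0 : 0 < eta by rewrite divr_gt0// mulr_gt0.
  have [d1 d10 Hd1] := differentiable_jac_eps (smooth_differentiable spsi (rO _ b1)) eta0.
  have [d2 /= d20 Hd2] := (nbhs_ballP y D).1 (open_nbhs_nbhs (conj oD Dy)).
  exists (Num.min d2 (d1 / (2 * K + 1))); first by rewrite lt_min d20 divr_gt0.
  move=> h; rewrite lt_min => /andP[hd2 hd1].
  have Dyh : D (y + h) by apply: Hd2; apply/in_ballE; rewrite [y + h]addrC addrK.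
  have yhy : y + h - y = h by rewrite addrAC subrr add0r.
  pose k := phi0 (y + h) - phi0 y.
  have kh : `|k| <= 2 * K * `|h|.
    by have := phiL _ _ Dyh Dy; rewrite yhy.
  have kd1 : `|k| < d1.
    apply: le_lt_trans kh _; apply: (@le_lt_trans _ _ ((2 * K + 1) * `|h|)).
      by rewrite ler_wpM2r// lerDl.
    by rewrite mulrC -ltr_pdivlMr.
  have := Hd1 k kd1; rewrite /k subrKC !psiphi// -/k yhy => Hk.
  have -> : phi0 (y + h) 0 j - phi0 y 0 j - lin_form (fun i => J' i j) h
      = ((k *m jac psi (phi0 y) - h) *m J') 0 j.
    rewrite mulmxBl mulmxK ?uJ// mxBE; congr (_ - _); first by rewrite mxBE.
    by rewrite mxE.
  apply: le_trans (coord_norm_le _ _ _) _; apply: le_trans (rV_mulmx_le _ _) _.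
  have -> : n%:R * (`|k *m jac psi (phi0 y) - h| * `|J'|) = K' * `|k *m jac psi (phi0 y) - h|.
    by rewrite /K'; ring.
  rewrite distrC; apply: (@le_trans _ _ (K' * (eta * (2 * K * `|h|)))).
    rewrite ler_wpM2l//; apply: le_trans Hk _; rewrite ler_wpM2l//; exact: ltW.
  have -> : e * `|h| = (K' + 1) * (eta * ((2 * K + 1) * `|h|)).
    by rewrite /eta; field; rewrite !gt_eqF.
  apply: ler_pM => //.
  - by apply: mulr_ge0; [exact: ltW|exact: le_trans kh].
  - by rewrite lerDl.
  - by apply: ler_wpM2l; [exact: ltW|rewrite ler_wpM2r// lerDl].
have sJ : smooth_on (ball x0 r) (fun x => invmx (jac psi x)).
  apply: smooth_invmx => //; first exact: ball_open.
  apply: smooth_on_subset rO _; apply: smooth_matrix => // i j.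
  by have /(smooth_mxP _ oO) := smooth_partial i spsi; apply.
(* Bootstrapping again: the partials of phi0 are entries of the inverse Jacobian composed with
   phi0. *)
have sphi : smooth_on D phi0.
  elim=> [|s IH].
    apply/(class_C_mxP _ _ oD) => i j y Dy; rewrite ord1.
    by apply: differentiable_continuous; have [] := dphi j y Dy.
  apply/(class_C_mxP _ _ oD) => i j; rewrite ord1.
  apply: (class_C_partial_eq (df := fun l y => (invmx (jac psi (phi0 y))) l j)) => //.
  - by move=> y Dy; have [] := dphi j y Dy.
  - by move=> l y Dy; have [_ ->] := dphi j y Dy.
  - move=> l; have oB : open (ball x0 r) by exact: ball_open.
    have := (class_C_mxP s _ oB).1 (sJ s) l j => sJlj.
    by apply: (class_C_comp oD _ sJlj IH) => y Dy; exact: br2 (phir y Dy).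
exists d, [set x | ball x0 (r / 2) x /\ D (psi x)], phi0; split; split=> //.
- rewrite openE => x [bx Dx]; apply: filterI.
    by apply: open_nbhs_nbhs; split=> //; exact: ball_open.
  have := smooth_continuous spsi (rO _ (br2 x bx)); apply.
  by apply: open_nbhs_nbhs.
- by split; apply: ballxx => //; rewrite divr_gt0.
- by move=> x [/br2/rO].
- by move=> y Dy; rewrite /= psiphi//; split=> //; split=> //; exact: phir.
- move=> x [bx Dx]; split=> //; apply: inj; [|exact: br2|exact: psiphi].
  exact: br2 (phir _ Dx).
- by move=> x [/br2/uJ].
Qed.

End InverseFunction.

(** * Lorentzian linear algebra *)

Section Lorentz.
Context {R : realType}.

Definition lsgn (m : nat) (i : 'I_m) : R := if i.+1 == m then -1 else 1.

Lemma lsgn_sqr m (i : 'I_m) : lsgn i * lsgn i = 1.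
Proof. by rewrite /lsgn; case: ifP => _; rewrite ?mulrNN mulr1. Qed.

Lemma lsgn_neq0 m (i : 'I_m) : lsgn i != 0.
Proof. by rewrite /lsgn; case: ifP => _; rewrite ?oppr_eq0 oner_eq0. Qed.

Lemma lorentzE m (i j : 'I_m) : lorentz R m i j = lsgn i *+ (i == j).
Proof. by rewrite !mxE. Qed.

Lemma minkE m (x y : 'cV[R]_m) : mink x y = \sum_i lsgn i * x i 0 * y i 0.
Proof.
rewrite /mink -mulmxA mxE; apply: eq_bigr => i _.
by rewrite mul_diag_mx !mxE mulrA [x i 0 * _]mulrC.
Qed.

Lemma minkC m (x y : 'cV[R]_m) : mink x y = mink y x.
Proof. by rewrite !minkE; apply: eq_bigr => i _; rewrite mulrAC. Qed.

Lemma minkDl m (x y z : 'cV[R]_m) : mink (x + y) z = mink x z + mink y z.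
Proof. by rewrite /mink linearD/= !mulmxDl mxE. Qed.

Lemma minkZl m a (x z : 'cV[R]_m) : mink (a *: x) z = a * mink x z.
Proof. by rewrite /mink linearZ/= -!scalemxAl mxE. Qed.

Lemma minkDr m (x y z : 'cV[R]_m) : mink z (x + y) = mink z x + mink z y.
Proof. by rewrite !(minkC z) minkDl. Qed.

Lemma minkZr m a (x z : 'cV[R]_m) : mink z (a *: x) = a * mink z x.
Proof. by rewrite !(minkC z) minkZl. Qed.

Lemma minkNl m (x z : 'cV[R]_m) : mink (- x) z = - mink x z.
Proof. by rewrite -scaleN1r minkZl mulN1r. Qed.

Lemma minkNr m (x z : 'cV[R]_m) : mink z (- x) = - mink z x.
Proof. by rewrite !(minkC z) minkNl. Qed.

Lemma minkBl m (x y z : 'cV[R]_m) : mink (x - y) z = mink x z - mink y z.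
Proof. by rewrite minkDl minkNl. Qed.

Lemma minkBr m (x y z : 'cV[R]_m) : mink z (x - y) = mink z x - mink z y.
Proof. by rewrite minkDr minkNr. Qed.

Lemma mink0l m (z : 'cV[R]_m) : mink 0 z = 0.
Proof. by rewrite /mink trmx0 !mul0mx mxE. Qed.

Lemma mink0r m (z : 'cV[R]_m) : mink z 0 = 0.
Proof. by rewrite minkC mink0l. Qed.

Lemma mink_suml m (I : Type) (s : seq I) (P : pred I) (x : I -> 'cV[R]_m) z :
  mink (\sum_(i <- s | P i) x i) z = \sum_(i <- s | P i) mink (x i) z.
Proof.
elim/big_ind2: _ => [|x1 y1 x2 y2 <- <-|//]; first exact: mink0l.
exact: minkDl.
Qed.

Lemma mink_sumr m (I : Type) (s : seq I) (P : pred I) (x : I -> 'cV[R]_m) z :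
  mink z (\sum_(i <- s | P i) x i) = \sum_(i <- s | P i) mink z (x i).
Proof. by rewrite minkC mink_suml; apply: eq_bigr => i _; rewrite minkC. Qed.

Lemma mink_delta m (x : 'cV[R]_m) i : mink x (delta_mx i 0) = lsgn i * x i 0.
Proof.
rewrite minkE (bigD1 i)//= big1 ?addr0 => [|j ji]; rewrite !mxE.
  by rewrite !eqxx mulr1.
by rewrite (negbTE ji) mulr0.
Qed.

Lemma mink_nondegenerate m (x : 'cV[R]_m) : (forall y, mink x y = 0) -> x = 0.
Proof.
move=> x0; apply/colP => i; rewrite mxE; have := x0 (delta_mx i 0).
by rewrite mink_delta => /eqP; rewrite mulf_eq0 (negbTE (lsgn_neq0 i)) => /eqP.
Qed.

Lemma mink_cols m p q (P : 'M[R]_(m, p)) (Q : 'M[R]_(m, q)) i j :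
  (P^T *m lorentz R m *m Q) i j = mink (col i P) (col j Q).
Proof.
rewrite /mink tr_col -row_mul colE mulmxA -row_mul -colE !mxE.
by apply: eq_bigr => l _; rewrite !mxE.
Qed.

Lemma mink_mulmxl m p (P : 'M[R]_(m, p)) (x : 'cV[R]_p) (y : 'cV[R]_m) :
  mink (P *m x) y = \sum_i x i 0 * mink (col i P) y.
Proof.
have -> : P *m x = \sum_i x i 0 *: col i P.
  apply/colP => j; rewrite mxE summxE; apply: eq_bigr => i _.
  by rewrite !mxE mulrC.
by rewrite mink_suml; apply: eq_bigr => i _; rewrite minkZl.
Qed.

Lemma lorentz_groupP m (P : 'M[R]_m) :
  lorentz_group P <-> forall x y, mink (P *m x) (P *m y) = mink x y.
Proof.
split=> [hP x y|hP].
  have {}hP : P^T *m lorentz R m *m P = lorentz R m := hP.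
  by rewrite /mink trmx_mul -[in RHS]hP !mulmxA.
apply/matrixP => i j; rewrite mink_cols !colE hP minkC mink_delta.
by rewrite mxE eqxx andbT lorentzE mulr_natr.
Qed.

Lemma lorentz_sqr m : lorentz R m *m lorentz R m = 1%:M.
Proof.
apply/matrixP => i j.
by rewrite mul_diag_mx mxE lorentzE mxE [RHS]mxE -/(lsgn i) mulrnAr lsgn_sqr.
Qed.

(** The inverse of a Lorentz matrix, in a form linear in P and hence easy to differentiate. *)
Definition linv m (P : 'M[R]_m) := lorentz R m *m P^T *m lorentz R m.

Lemma linvK m (P : 'M[R]_m) : lorentz_group P -> linv P *m P = 1%:M.
Proof.
by move=> hP; rewrite /linv -!mulmxA [P^T *m _]mulmxA hP lorentz_sqr.
Qed.

Lemma linvKr m (P : 'M[R]_m) : lorentz_group P -> P *m linv P = 1%:M.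
Proof. by move=> hP; apply: mulmx1C; exact: linvK. Qed.

Lemma lorentz_unit m (P : 'M[R]_m) : lorentz_group P -> P \in unitmx.
Proof. by move=> /linvK/mulmx1_unit[]. Qed.

Lemma lorentz_invmx m (P : 'M[R]_m) : lorentz_group P -> invmx P = linv P.
Proof.
move=> hP; rewrite -[RHS]mulmx1 -(mulmxV (lorentz_unit hP)) mulmxA linvK//.
by rewrite mul1mx.
Qed.

Lemma lorentz_group1 m : lorentz_group (1%:M : 'M[R]_m).
Proof. by apply/lorentz_groupP => x y; rewrite !mul1mx. Qed.

Lemma lorentz_groupM m (P Q : 'M[R]_m) :
  lorentz_group P -> lorentz_group Q -> lorentz_group (P *m Q).
Proof.
move=> /lorentz_groupP hP /lorentz_groupP hQ; apply/lorentz_groupP => x y.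
by rewrite -!mulmxA hP hQ.
Qed.

Definition reflection m (v : 'cV[R]_m) : 'M[R]_m :=
  1%:M - (2 / mink v v) *: (v *m v^T *m lorentz R m).

Lemma reflectionE m (v x : 'cV[R]_m) :
  reflection v *m x = x - (2 / mink v v * mink v x) *: v.
Proof.
rewrite /reflection mulmxBl mul1mx -scalemxAl -scalerA; congr (_ - _ *: _).
rewrite -!mulmxA; apply/colP => i; rewrite mxE big_ord1 [RHS]mxE mulrC.
by rewrite /mink -!mulmxA.
Qed.

Lemma reflection_lorentz m (v : 'cV[R]_m) : mink v v != 0 -> lorentz_group (reflection v).
Proof.
move=> v0; apply/lorentz_groupP => x y; rewrite !reflectionE.
rewrite minkBl !minkBr !minkZl !minkZr (minkC x v); field; exact: v0.
Qed.

(** Reflecting in a - b exchanges a and b unless a - b is null. In that case (a + b, a + b) = 4 (a,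
    a) is nonzero: send a to -a, then reflect in a + b. Both maps fix vectors orthogonal to a and
    b. *)
Lemma lorentz_transitive m (a b : 'cV[R]_m) : mink a a = mink b b -> mink a a != 0 ->
  exists2 Q, lorentz_group Q & Q *m a = b /\
    forall z, mink z a = 0 -> mink z b = 0 -> Q *m z = z.
Proof.
move=> ab a0; have [n0|n0] := eqVneq (mink (a - b) (a - b)) 0; last first.
  exists (reflection (a - b)); first exact: reflection_lorentz.
  split=> [|z za zb]; rewrite reflectionE.
    have E : mink (a - b) (a - b) = 2 * mink (a - b) a.
      by rewrite !minkBl !minkBr (minkC b a) -ab; ring.
    rewrite mulrAC -E mulfV// scale1r; exact: subKr.
  by rewrite (minkC _ z) (minkBr a b z) za zb subrr mulr0 scale0r subr0.
have n1 : mink (a + b) (a + b) = 4 * mink a a.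
  move: n0; rewrite minkBl !minkBr minkDl !minkDr (minkC b a) -ab; lra.
have n1' : mink (a + b) (a + b) != 0 by rewrite n1 mulf_neq0.
exists (reflection (a + b) *m reflection a).
  by apply: lorentz_groupM; exact: reflection_lorentz.
split=> [|z za zb]; rewrite -mulmxA !reflectionE.
  rewrite divfK// minkBr minkZr.
  have E : mink (a + b) a - 2 * mink (a + b) a = - (mink (a + b) (a + b) / 2).
    have : mink (a + b) (a + b) = 2 * mink (a + b) a.
      by rewrite !minkDl !minkDr (minkC b a) -ab; ring.
    lra.
  rewrite E mulrN [2 / _]mulrC mulrACA mulVf// mulfV// mulr1 scaleN1r opprK.
  by apply/colP => i; rewrite !mxE; ring.
rewrite (minkC a z) za mulr0 scale0r subr0 (minkC _ z) (minkDr a b z) za zb addr0 mulr0 scale0r.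
by rewrite subr0.
Qed.

(** A form of Witt's theorem. Columns are adjusted one at a time, each by a Lorentz map fixing the
    basis vectors already placed. *)
Lemma lorentz_extend m (W : 'M[R]_m) (S : {set 'I_m}) :
  (forall s t, s \in S -> t \in S -> mink (col s W) (col t W) = lsgn s *+ (s == t)) ->
  exists2 P, lorentz_group P & forall s, s \in S -> col s P = col s W.
Proof.
move: {2}#|S| (erefl #|S|) => k; elim: k S => [|k IH] S.
  move/eqP; rewrite cards_eq0 => /eqP -> _; exists 1%:M; first exact: lorentz_group1.
  by move=> s; rewrite inE.
move=> cS hW; have [t tS] : exists t, t \in S by apply/set0Pn; rewrite -card_gt0 cS.
have [||P hP PW] := IH (S :\ t).
- by have := cardsD1 t S; rewrite tS cS => -[].
- by move=> s s'; rewrite !inE => /andP[_ ?] /andP[_ ?]; exact: hW.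
pose w := linv P *m col t W.
have lP := (lorentz_groupP _).1 hP.
have Pw : P *m w = col t W by rewrite mulmxA linvKr// mul1mx.
have et : mink (delta_mx t 0 : 'cV[R]_m) (delta_mx t 0) = lsgn t.
  by rewrite mink_delta mxE !eqxx mulr1.
have ww : mink (delta_mx t 0 : 'cV[R]_m) (delta_mx t 0) = mink w w.
  by rewrite et -lP Pw hW// eqxx.
have [|Q hQ [Qt Qz]] := lorentz_transitive ww; first by rewrite et lsgn_neq0.
exists (P *m Q); first exact: lorentz_groupM.
move=> s sS; rewrite [LHS]colE -mulmxA; have [->|st] := eqVneq s t; first by rewrite Qt.
have sS' : s \in S :\ t by rewrite !inE st.
rewrite Qz ?mink_delta.
- by rewrite -colE PW.
- by rewrite mxE eq_sym (negbTE st) mulr0.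
- by rewrite -lP Pw -colE PW// hW// (negbTE st).
Qed.

(** A Lorentz matrix takes the last basis vector to the normalised t; in that frame y has last
    co-ordinate 0, so (y, y) is a sum of squares. *)
Lemma timelike_orthogonal m (t y : 'cV[R]_m) :
  mink t t < 0 -> mink y t = 0 -> y != 0 -> 0 < mink y y.
Proof.
case: m t y => [|m] t y tt yt y0.
  by move: y0; rewrite (_ : y = 0) ?eqxx//; apply/colP => -[].
pose c := Num.sqrt (- mink t t).
have c0 : 0 < c by rewrite sqrtr_gt0 oppr_gt0.
have cc : c * c = - mink t t by rewrite -expr2 sqr_sqrtr// oppr_ge0 ltW.
(* All columns are equal, but only the last one is prescribed to the extension. *)
pose W : 'M[R]_m.+1 := \matrix_(i, j) (c^-1 * t i 0).
have cW j : col j W = c^-1 *: t by apply/colP => i; rewrite !mxE.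
have [|P hP PW] := @lorentz_extend _ W [set ord_max].
  move=> s s'; rewrite !inE => /eqP -> /eqP ->.
  rewrite cW minkZl minkZr eqxx /lsgn eqxx mulr1n -[mink t t]opprK -cc.
  by field; rewrite gt_eqF.
pose z := linv P *m y.
have lP := (lorentz_groupP _).1 hP.
have Pz : P *m z = y by rewrite mulmxA linvKr// mul1mx.
have zm : z ord_max 0 = 0.
  have := mink_delta z ord_max; rewrite -lP Pz -colE PW ?inE// cW minkZr yt mulr0.
  by move/esym/eqP; rewrite mulf_eq0 (negbTE (lsgn_neq0 _)) => /eqP.
have z0 : z != 0 by apply: contraNneq y0 => z0; rewrite -Pz z0 mulmx0.
have zz i : lsgn i * z i 0 * z i 0 = z i 0 ^+ 2.
  rewrite /lsgn; case: eqP => [im|_]; last by rewrite mul1r.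
  have -> : i = ord_max by apply: val_inj; case: im.
  by rewrite zm mulr0 expr0n.
rewrite -Pz lP minkE; under eq_bigr do rewrite zz.
rewrite lt_def sumr_ge0 ?andbT => [|i _]; last exact: sqr_ge0.
apply: contra z0 => /eqP/psumr_eq0P h; apply/eqP/colP => i; rewrite [RHS]mxE.
by apply/eqP; rewrite -sqrf_eq0; apply/eqP/h => // j _; exact: sqr_ge0.
Qed.

End Lorentz.

(** * Second fundamental form and the Gauss equation *)

Section Immersion.
Context {R : realType} {n k : nat}.
Local Notation N := (n + (n + k))%N.
Variables (O : set 'rV[R]_n) (X : 'rV[R]_n -> 'cV[R]_N).
Hypotheses (oO : open O) (sX : smooth_on O X).
Hypothesis posX : forall x, O x -> forall a : 'rV[R]_n, a != 0 ->
  0 < mink ('D_a X x) ('D_a X x).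
Implicit Types (x : 'rV[R]_n) (a : 'cV[R]_n) (y z : 'cV[R]_N).

Local Notation I := (lorentz R N).

Definition dX x : 'M[R]_(N, n) := \matrix_(s, j) pd j X x s 0.

Definition gram x : 'M[R]_n := (dX x)^T *m I *m dX x.

Definition tangent x y : Prop := exists a, y = dX x *m a.

Definition normal x y : Prop := forall a, mink y (dX x *m a) = 0.

Definition proj_tan x : 'M[R]_N := dX x *m invmx (gram x) *m (dX x)^T *m I.

(** The full second derivative of X. Its normal part is the second fundamental form II, its
    tangential part encodes the Levi-Civita connection. *)
Definition hess x a b : 'cV[R]_N := \sum_l a l 0 *: (pd l dX x *m b).

Lemma col_dX x j : col j (dX x) = pd j X x.
Proof. by apply/colP => s; rewrite !mxE. Qed.

Lemma dXE x (a : 'rV[R]_n) : O x -> 'D_a X x = dX x *m a^T.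
Proof.
move=> Ox; rewrite deriv_partial; last exact: smooth_differentiable Ox.
apply/colP => s; rewrite summxE [RHS]mxE; apply: eq_bigr => i _.
by rewrite !mxE mulrC.
Qed.

Lemma smooth_dX : smooth_on O dX.
Proof.
apply: smooth_matrix => // s j.
by have /(smooth_mxP _ oO) := smooth_partial j sX; apply.
Qed.

Lemma pd_dX l x s j : O x -> pd l dX x s j = pd l (pd j X) x s 0.
Proof.
move=> Ox; have dE := smooth_differentiable smooth_dX Ox.
have dp := smooth_differentiable (smooth_partial j sX) Ox.
rewrite (partial_mxE l s j dE) (partial_mxE l s 0 dp).
by congr (pd l _ x); apply/funext => y; rewrite mxE.
Qed.

Lemma pd_dX_col l x j : O x -> col j (pd l dX x) = pd l (pd j X) x.
Proof. by move=> Ox; apply/colP => s; rewrite mxE pd_dX// ord1. Qed.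

Lemma hessC x a b : O x -> hess x a b = hess x b a.
Proof.
move=> Ox; apply/colP => s; rewrite /hess !summxE.
under eq_bigr do rewrite mxE mxE big_distrr/=.
under [RHS]eq_bigr do rewrite mxE mxE big_distrr/=.
rewrite exchange_big/=; apply: eq_bigr => j _; apply: eq_bigr => i _.
rewrite !pd_dX// (schwarz_mx _ _ oO Ox sX).
by ring.
Qed.

Lemma hessDl x a b c : hess x (a + b) c = hess x a c + hess x b c.
Proof. by rewrite /hess -big_split; apply: eq_bigr => l _; rewrite mxE scalerDl. Qed.

Lemma hessZl x t a c : hess x (t *: a) c = t *: hess x a c.
Proof. by rewrite /hess scaler_sumr; apply: eq_bigr => l _; rewrite mxE scalerA. Qed.

Lemma hess_suml x (J : finType) (t : J -> R) (v : J -> 'cV[R]_n) c :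
  hess x (\sum_j t j *: v j) c = \sum_j t j *: hess x (v j) c.
Proof.
elim/big_ind2: _ => [|a1 b1 a2 b2 h1 h2|j _]; last exact: hessZl.
  by rewrite -[0 in LHS](scale0r (0 : 'cV_n)) hessZl scale0r.
by rewrite hessDl h1 h2.
Qed.

Lemma hess_delta x l m : O x -> hess x (delta_mx l 0) (delta_mx m 0) = pd l (pd m X) x.
Proof.
move=> Ox; rewrite /hess (bigD1 l)//= big1 ?addr0 => [|i /negbTE il].
  by rewrite mxE !eqxx scale1r -colE pd_dX_col.
by rewrite mxE il scale0r.
Qed.

Lemma gramE x a b : mink (dX x *m a) (dX x *m b) = (a^T *m gram x *m b) 0 0.
Proof. by rewrite /mink /gram trmx_mul !mulmxA. Qed.

Lemma gram_sym x : (gram x)^T = gram x.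
Proof. by rewrite /gram !trmx_mul trmxK /lorentz tr_diag_mx mulmxA. Qed.

Lemma gram_unit x : O x -> gram x \in unitmx.
Proof.
move=> Ox; apply: unitmx_of_kernel => a aG; apply/eqP; apply: contraTT isT => a0.
have := posX Ox a0; rewrite dXE// gramE trmxK aG mul0mx mxE ltxx//.
Qed.

Lemma smooth_gram : smooth_on O gram.
Proof.
have sE := smooth_dX; apply: smooth_mulmx => //; apply: smooth_mulmx => //.
  exact: smooth_trmx.
exact: smooth_mx_cst.
Qed.

Lemma smooth_proj_tan : smooth_on O proj_tan.
Proof.
have sE := smooth_dX; apply: smooth_mulmx => //; last exact: smooth_mx_cst.
apply: smooth_mulmx => //; last exact: smooth_trmx.
by apply: smooth_mulmx => //; apply: smooth_invmx => //; [exact: gram_unit|exact: smooth_gram].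
Qed.

Lemma tangent_proj x y : tangent x (proj_tan x *m y).
Proof. by exists (invmx (gram x) *m (dX x)^T *m I *m y); rewrite /proj_tan !mulmxA. Qed.

Lemma proj_tan_dX x : O x -> proj_tan x *m dX x = dX x.
Proof.
by move=> Ox; rewrite /proj_tan -!mulmxA [(dX x)^T *m _]mulmxA mulVmx ?mulmx1 ?gram_unit.
Qed.

Lemma mink_proj_tan x y z : O x -> mink (proj_tan x *m y) z = mink y (proj_tan x *m z).
Proof.
move=> Ox; rewrite /mink; congr (fun_of_matrix _ 0 0).
rewrite /proj_tan !trmx_mul trmxK trmx_inv gram_sym /lorentz tr_diag_mx !mulmxA.
by [].
Qed.

Lemma normal_tangent x y z : normal x y -> tangent x z -> mink y z = 0.
Proof. by move=> ny [a ->]. Qed.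

Lemma normal_nor x y : O x -> normal x (y - proj_tan x *m y).
Proof.
move=> Ox a; rewrite minkBl mink_proj_tan// mulmxA proj_tan_dX//.
exact: subrr.
Qed.

Lemma normal_proj0 x y : O x -> normal x y -> proj_tan x *m y = 0.
Proof.
move=> Ox ny; apply: mink_nondegenerate => z; rewrite mink_proj_tan//.
exact: normal_tangent ny (tangent_proj _ _).
Qed.

Lemma normal_partialP x y : normal x y <-> forall j, mink y (pd j X x) = 0.
Proof.
split=> [ny j|ny a]; first by rewrite -col_dX colE.
by rewrite minkC mink_mulmxl big1// => j _; rewrite col_dX minkC ny mulr0.
Qed.

Lemma normal_spaceP x y : O x -> Defs.normal_space X x y <-> normal x y.
Proof.
move=> Ox; split=> [ny a|ny a]; last by rewrite dXE.
by rewrite -[a]trmxK -dXE.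
Qed.

(** The normal space is nondegenerate, as the complement of a nondegenerate tangent space: any test
    vector can be replaced by its normal part. *)
Lemma normal_eq x y z : O x -> normal x y -> normal x z ->
  (forall v, normal x v -> mink v y = mink v z) -> y = z.
Proof.
move=> Ox ny nz h; apply/eqP; rewrite -subr_eq0; apply/eqP.
apply: mink_nondegenerate => v; rewrite minkC minkBr.
have E u : normal x u -> mink v u = mink (v - proj_tan x *m v) u.
  by move=> nu; rewrite minkBl mink_proj_tan// (normal_proj0 Ox nu) mink0r subr0.
by rewrite (E y ny) (E z nz) h ?subrr//; exact: normal_nor.
Qed.

Hypothesis flatX : flat_metric O (induced_metric X).

Lemma induced_metricE x : induced_metric X x = gram x.
Proof. by apply/matrixP => i j; rewrite mxE mink_cols !col_dX !pdE. Qed.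

(** The Christoffel symbols as tangential components of d_l dX, without derivatives of the
    metric. *)
Definition levi_civita l x : 'M[R]_n := invmx (gram x) *m ((dX x)^T *m I *m pd l dX x).

Lemma smooth_levi_civita l : smooth_on O (levi_civita l).
Proof.
have sE := smooth_dX; apply: smooth_mulmx => //.
  by apply: smooth_invmx => //; [exact: gram_unit|exact: smooth_gram].
apply: smooth_mulmx => //; last exact: smooth_partial.
by apply: smooth_mulmx => //; [exact: smooth_trmx|exact: smooth_mx_cst].
Qed.

(** By symmetry of second derivatives, the three metric derivatives combine to 2 (d_l d_j X, d_i
    X). *)
Lemma christoffelE l x : O x -> christoffel (induced_metric X) l x = levi_civita l x.
Proof.
move=> Ox; rewrite /christoffel /levi_civita induced_metricE; congr (_ *m _).
apply/matrixP => i j; rewrite mxE mink_cols col_dX pd_dX_col// !pdE.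
have dp m : differentiable (pd m X) x.
  exact: smooth_differentiable (smooth_partial m sX) Ox.
have E (a b c : 'I_n) : pd a (fun x' => induced_metric X x' b c) x
    = mink (pd a (pd b X) x) (pd c X x) + mink (pd b X x) (pd a (pd c X) x).
  by rewrite -partial_mink//; congr (pd a _ x); apply/funext => x'; rewrite mxE !pdE.
rewrite !E (schwarz_mx l i oO Ox sX) (schwarz_mx j i oO Ox sX) (schwarz_mx j l oO Ox sX).
rewrite (minkC (pd j X x)) (minkC (pd l X x)).
rewrite (minkC (pd l (pd j X) x)); set A := mink _ _; set B := mink _ _; set C := mink _ _.
by move: A B C => A B C; lra.
Qed.

(** Differentiate gram Gamma_q = dX^T I d_q dX along x_p, with d gram = Gamma^T gram + gram Gamma.
    On exchanging p and q, the third derivatives of X agree by symmetry and the terms d_p Gamma_q +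
    Gamma_p Gamma_q by flatness. *)
Lemma gauss_mx p q x : O x ->
  (pd p dX x)^T *m I *m pd q dX x - (levi_civita p x)^T *m gram x *m levi_civita q x
  = (pd q dX x)^T *m I *m pd p dX x - (levi_civita q x)^T *m gram x *m levi_civita p x.
Proof.
move=> Ox.
have dE : differentiable dX x by exact: smooth_differentiable smooth_dX Ox.
have dpE l : differentiable (pd l dX) x.
  exact: smooth_differentiable (smooth_partial l smooth_dX) Ox.
have dG : differentiable gram x by exact: smooth_differentiable smooth_gram Ox.
have dL l : differentiable (levi_civita l) x.
  exact: smooth_differentiable (smooth_levi_civita l) Ox.
have GL l x' : O x' -> gram x' *m levi_civita l x' = (dX x')^T *m I *m pd l dX x'.
  by move=> Ox'; rewrite /levi_civita mulKVmx// gram_unit.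
have key l m : (pd l gram x) *m levi_civita m x + gram x *m pd l (levi_civita m) x
   = (pd l dX x)^T *m I *m pd m dX x + (dX x)^T *m I *m pd l (pd m dX) x.
  rewrite -partialMmx// (partial_eq_on l oO (GL m) Ox).
  have [dT pT] := partial_trmx l dE.
  have [dTI pTI] := differentiable_mulmxr I l dT.
  by rewrite partialMmx// pTI pT.
have pG l : pd l gram x = (levi_civita l x)^T *m gram x + gram x *m levi_civita l x.
  have [dT pT] := partial_trmx l dE.
  have [dTI pTI] := differentiable_mulmxr I l dT.
  rewrite /gram partialMmx// pTI pT -/(gram x) GL//; congr (_ + _).
  by rewrite -[in RHS]gram_sym -trmx_mul GL// !trmx_mul trmxK /lorentz tr_diag_mx mulmxA.
have flat := flatX Ox p q.
have L0 : pd p (levi_civita q) x + levi_civita p x *m levi_civita q x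
  = pd q (levi_civita p) x + levi_civita q x *m levi_civita p x.
  move: flat; rewrite !pdE !christoffelE// /bracket.
  rewrite (partial_eq_on p oO (christoffelE q) Ox) (partial_eq_on q oO (christoffelE p) Ox).
  by move/eqP; rewrite addrACA -opprD subr_eq0 => /eqP.
have step l m : (pd l dX x)^T *m I *m pd m dX x
      - (levi_civita l x)^T *m gram x *m levi_civita m x
    = gram x *m (pd l (levi_civita m) x + levi_civita l x *m levi_civita m x)
      - (dX x)^T *m I *m pd l (pd m dX) x.
  have := key l m; rewrite pG mulmxDl mulmxDr mulmxA => /eqP.
  rewrite -addrA eq_sym -subr_eq => /eqP.
  have abel (P S U V : 'M[R]_n) : P - (P + S - (U + V)) = V + U - S.
    by apply/matrixP => i j; rewrite !mxE; ring.
  by move=> <-; exact: abel.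
by rewrite !step L0 (schwarz_mx p q oO Ox smooth_dX).
Qed.

Definition normal_part x y := y - proj_tan x *m y.

Lemma mink_normal_part x y z : O x -> normal x y -> mink y (normal_part x z) = mink y z.
Proof. by move=> Ox ny; rewrite minkBr -mink_proj_tan// (normal_proj0 Ox ny) mink0l subr0. Qed.

Lemma mink_hess x a b z : mink (hess x a b) z = \sum_l a l 0 * mink (pd l dX x *m b) z.
Proof. by rewrite mink_suml; apply: eq_bigr => l _; rewrite minkZl. Qed.

(** The Gamma^T gram Gamma term of the matrix identity is the contribution of the tangential parts,
    so the normal parts of the second derivatives remain: Gauss' equation for zero curvature. *)
Lemma gauss_hess x a b c d : O x ->
  mink (hess x a b) (normal_part x (hess x c d))
  = mink (hess x c b) (normal_part x (hess x a d)).
Proof.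
move=> Ox.
have form p q : mink (pd p dX x *m b) (normal_part x (pd q dX x *m d))
    = (b^T *m ((pd p dX x)^T *m I *m pd q dX x
       - (levi_civita p x)^T *m gram x *m levi_civita q x) *m d) 0 0.
  have -> : (levi_civita p x)^T *m gram x *m levi_civita q x
      = (pd p dX x)^T *m I *m proj_tan x *m pd q dX x.
    rewrite /levi_civita /proj_tan -[_ *m gram x *m _]mulmxA mulKVmx ?gram_unit//.
    rewrite !trmx_mul trmxK.
    by rewrite trmx_inv gram_sym /lorentz tr_diag_mx !mulmxA.
  rewrite mulmxBr mulmxBl [in RHS]mxE [X in _ + X]mxE /normal_part minkBr /mink.
  by rewrite !trmx_mul !mulmxA.
have sym p q : mink (pd p dX x *m b) (normal_part x (pd q dX x *m d))
    = mink (pd q dX x *m b) (normal_part x (pd p dX x *m d)).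
  by rewrite !form gauss_mx.
have expand a' c' : mink (hess x a' b) (normal_part x (hess x c' d))
  = \sum_p \sum_q a' p 0 * c' q 0 *
      mink (pd p dX x *m b) (normal_part x (pd q dX x *m d)).
  rewrite mink_hess; apply: eq_bigr => p _.
  have -> : normal_part x (hess x c' d)
      = \sum_q c' q 0 *: normal_part x (pd q dX x *m d).
    rewrite /normal_part /hess mulmx_sumr -sumrB; apply: eq_bigr => q _.
    by rewrite -scalemxAr scalerBr.
  rewrite mink_sumr mulr_sumr; apply: eq_bigr => q _.
  by rewrite minkZr mulrA.
rewrite !expand exchange_big/=; apply: eq_bigr => p _; apply: eq_bigr => q _.
by rewrite sym [a _ _ * _]mulrC.
Qed.

(** The condition II(a, .) = (a, .) z tested against normal vectors. It is the eigenvector condition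
    A_v a = (v, z) a at one point, freed from extending v to a section. *)
Definition principal x z a : Prop := forall v, normal x v -> forall b,
  mink v (hess x a b) = mink v z * mink (dX x *m a) (dX x *m b).

(** Computing II(a, a') from either argument gives (a, a') z = (a, a') z'. *)
Lemma principal_orthogonal x z z' a a' : O x -> normal x z -> normal x z' ->
  principal x z a -> principal x z' a' -> z <> z' ->
  mink (dX x *m a) (dX x *m a') = 0.
Proof.
move=> Ox nz nz' pz pz' zz'; apply/eqP; apply: contra_notT zz' => h.
apply: (normal_eq Ox) => // v nv; apply: (mulIf h).
by rewrite -(pz v nv) (minkC (dX x *m a)) -(pz' v nv) hessC.
Qed.

Lemma gram_pos x a : O x -> a != 0 -> 0 < mink (dX x *m a) (dX x *m a).
Proof.
move=> Ox a0; have := @posX x Ox a^T; rewrite dXE// trmxK; apply.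
by rewrite -(inj_eq trmx_inj) trmxK trmx0.
Qed.

Variable w : 'I_n -> 'rV[R]_n -> 'cV[R]_N.
Hypothesis sw : forall i, smooth_on O (w i).
Hypothesis w_normal : forall x, O x -> forall i, normal x (w i x).
Hypothesis w_neq : forall x, O x -> forall i j, i != j -> w i x <> w j x.
Hypothesis w_eigen : forall x, O x -> forall i, exists2 a, a != 0 & principal x (w i x) a.

(** Gauss' equation on (a, a, c, c): the left side is (a, a) (c, c) (w_i, w_j), the right side is
    |II(a, c)|^2 = 0 because a and c are orthogonal. *)
Lemma curvature_normals_orthogonal x i j : O x -> i != j -> mink (w i x) (w j x) = 0.
Proof.
move=> Ox ij; have [a a0 pa] := w_eigen Ox i; have [c c0 pc] := w_eigen Ox j.
have ac : mink (dX x *m c) (dX x *m a) = 0.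
  rewrite minkC; apply: principal_orthogonal (w_normal Ox i) (w_normal Ox j) pa pc _ => //.
  exact: w_neq.
have nn y : normal x (normal_part x y) by exact: normal_nor.
have := gauss_hess a a c c Ox.
rewrite minkC pa// minkC (mink_normal_part _ Ox (w_normal Ox i)).
rewrite pc//; last exact: w_normal.
rewrite [RHS]minkC pc// ac mulr0 => /eqP; rewrite !mulf_eq0.
by rewrite (gt_eqF (gram_pos Ox a0)) (gt_eqF (gram_pos Ox c0)) !orbF => /eqP.
Qed.

Lemma principal_basis x : O x -> exists A : 'M[R]_n,
  A^T *m gram x *m A = 1%:M /\ forall i, principal x (w i x) (col i A).
Proof.
move=> Ox; have /choice[a ha] : forall i, exists a, a != 0 /\ principal x (w i x) a.
  by move=> i; have [a a0 pa] := w_eigen Ox i; exists a.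
pose c i := Num.sqrt (mink (dX x *m a i) (dX x *m a i)).
have c0 i : 0 < c i by rewrite sqrtr_gt0; apply: gram_pos; have [] := ha i.
have cc i : c i * c i = mink (dX x *m a i) (dX x *m a i).
  by rewrite -expr2 sqr_sqrtr// ltW// gram_pos//; have [] := ha i.
pose A : 'M[R]_n := \matrix_(l, i) ((c i)^-1 * a i l 0).
have cA i : col i A = (c i)^-1 *: a i by apply/colP => l; rewrite !mxE.
have pA i : principal x (w i x) (col i A).
  move=> v nv b; rewrite cA hessZl minkZr -scalemxAr minkZl.
  by have [_ ->] := ha i => //; rewrite mulrCA.
exists A; split=> //; apply/matrixP => i j.
rewrite (_ : (A^T *m gram x *m A) i j = mink (dX x *m col i A) (dX x *m col j A)); last first.
  rewrite gramE tr_col -row_mul.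
  by rewrite colE mulmxA -row_mul -colE !mxE.
have [<-|ij] := eqVneq i j.
  rewrite cA -scalemxAr minkZl minkZr -cc mxE eqxx.
  by rewrite mulKf ?mulVf// gt_eqF.
rewrite mxE (negbTE ij).
apply: principal_orthogonal (w_normal Ox i) (w_normal Ox j) (pA i) (pA j) _ => //.
exact: w_neq.
Qed.

(** II is diagonal in the principal basis; the rows of [A^T *m gram x] are the dual coframe
    theta. *)
Lemma mink_hess_basis x (A : 'M[R]_n) v b c : O x ->
  A^T *m gram x *m A = 1%:M -> (forall i, principal x (w i x) (col i A)) ->
  normal x v -> mink v (hess x b c)
  = \sum_i mink v (w i x) * (A^T *m gram x *m b) i 0 * (A^T *m gram x *m c) i 0.
Proof.
move=> Ox AG pA nv; set th := A^T *m gram x.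
have bE : b = \sum_i (th *m b) i 0 *: col i A.
  rewrite -{1}[b]mul1mx -(mulmx1C AG) -mulmxA; apply/colP => l.
  rewrite mxE summxE; apply: eq_bigr => i _.
  by rewrite [RHS]mxE [in RHS]mulrC; congr (_ * _); rewrite mxE.
rewrite {1}bE hess_suml mink_sumr; apply: eq_bigr => i _.
rewrite minkZr pA// gramE tr_col -row_mul.
rewrite -row_mul -/th [row i _ 0 0]mxE mulrA; congr (_ * _).
exact: mulrC.
Qed.

(* [sg i] is the normal slot of the frame that receives the normalised v_i:
   [lshift k i] in case (i) of the theorem, [kidx k i] in case (ii). *)
Variable sg : 'I_n -> 'I_(n + k).
Hypothesis sg_inj : injective sg.
Hypothesis w_sign : forall x, O x -> forall i, 0 < lsgn (sg i) * mink (w i x) (w i x).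

Lemma w_neq0 x i : O x -> mink (w i x) (w i x) != 0.
Proof. by move=> Ox; have := w_sign Ox i; apply: contraTneq => ->; rewrite mulr0 ltxx. Qed.

(** Pointwise unit principal vectors have arbitrary signs and no regularity. The tensors theta_i
    theta_i are smooth, and a nonzero row of such a tensor, divided by the root of its diagonal
    entry, is theta_i up to sign. *)
Lemma principal_coframe x0 : O x0 ->
  exists (r : R) (th : 'rV[R]_n -> 'M[R]_n),
  [/\ 0 < r, ball x0 r `<=` O, smooth_on (ball x0 r) th &
    forall x, ball x0 r x ->
      [/\ th x *m (invmx (gram x) *m (th x)^T) = 1%:M,
          th x = (invmx (gram x) *m (th x)^T)^T *m gram x &
          forall i, principal x (w i x) (col i (invmx (gram x) *m (th x)^T))]].
Proof.
move=> Ox0.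
(* Coefficients of theta_i theta_i: pairing II with w_i isolates the i-th term because the w_j are
   orthogonal. *)
pose S i l m x := mink (w i x) (pd l (pd m X) x) / mink (w i x) (w i x).
have SE x (A : 'M[R]_n) i l m : O x -> A^T *m gram x *m A = 1%:M ->
    (forall i, principal x (w i x) (col i A)) ->
    S i l m x = (A^T *m gram x) i l * (A^T *m gram x) i m.
  move=> Ox AG pA; rewrite /S -hess_delta//.
  rewrite (mink_hess_basis _ _ Ox AG pA (w_normal Ox i)) (bigD1 i)//= big1.
    have dE m' : (A^T *m gram x *m (delta_mx m' 0 : 'cV_n)) i 0 = (A^T *m gram x) i m'.
      by rewrite -colE mxE.
    by rewrite addr0 !dE mulrC -mulrA mulKf ?w_neq0.
  by move=> j ji; rewrite curvature_normals_orthogonal ?mul0r// eq_sym.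
have sS i l m : smooth_on O (S i l m).
  apply: smoothM => //.
    by apply: smooth_mink => //; do 2!apply: smooth_partial.
  apply: smoothV => //; first by move=> x Ox; exact: w_neq0.
  exact: smooth_mink.
have [A0 [AG0 pA0]] := principal_basis Ox0.
(* A coefficient of theta_i that is nonzero at x0; making it positive fixes the sign of theta_i
   nearby. *)
have /choice[mm hmm] : forall i, exists m, (A0^T *m gram x0) i m != 0.
  move=> i; have : (A0^T *m gram x0 *m A0) i i != 0 by rewrite AG0 mxE eqxx oner_eq0.
  apply: contra_neqP => /forallNP h; rewrite mxE big1// => j _.
  by have /negP := h j; rewrite negbK => /eqP ->; rewrite mul0r.
have [r r0 rP] : exists2 r : R, 0 < r & forall x, ball x0 r x ->
    O x /\ forall i, 0 < S i (mm i) (mm i) x.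
  have : \forall x \near (x0 : 'rV[R]_n), O x /\ forall i, 0 < S i (mm i) (mm i) x.
    apply: filterI; first exact: open_nbhs_nbhs.
    apply: (@filter_forall _ _ (fun i x => 0 < S i (mm i) (mm i) x) (nbhs x0)) => i.
    have Spos : 0 < S i (mm i) (mm i) x0.
      by rewrite (SE _ _ _ _ _ Ox0 AG0 pA0) -expr2 lt_def sqr_ge0 sqrf_eq0 hmm.
    exact: (@cvgr_gt _ _ (nbhs x0) _ _ _ (smooth_continuous (sS i (mm i) (mm i)) Ox0) 0 Spos).
  by move=> /nbhs_ballP[r /= r0 rP]; exists r.
have rO : ball x0 r `<=` O by move=> x /rP[].
have oB : open (ball x0 r) by exact: ball_open.
pose th x : 'M[R]_n := \matrix_(i, l) (S i l (mm i) x / Num.sqrt (S i (mm i) (mm i) x)).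
exists r, th; split=> //.
  apply: smooth_matrix => // i l; apply: smoothM => //; first exact: smooth_on_subset (sS _ _ _).
  apply: smoothV => //; first by move=> x /rP[_ h]; rewrite gt_eqF// sqrtr_gt0.
  apply: smooth_sqrt => //; first by move=> x /rP[].
  exact: smooth_on_subset (sS _ _ _).
move=> x bx; have [Ox Spos] := rP x bx; have [A [AG pA]] := principal_basis Ox.
set q := A^T *m gram x in AG.
have SEx i l m : S i l m x = q i l * q i m by exact: SE.
(* The signs relating the smooth coframe to the pointwise one at x. *)
pose ep : 'rV[R]_n := \row_i (q i (mm i) / Num.sqrt (S i (mm i) (mm i) x)).
have ep1 i : ep 0 i * ep 0 i = 1.
  rewrite mxE mulrACA -invfM -!expr2 sqr_sqrtr ?ltW// SEx -expr2 divff//.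
  by rewrite expr2 -SEx gt_eqF.
have thE : th x = diag_mx ep *m q.
  by apply/matrixP => i l; rewrite mul_diag_mx mxE [RHS]mxE [ep _ _]mxE [in LHS]SEx mulrAC mulrC mulrA mulrAC.
have ep2 : diag_mx ep *m diag_mx ep = 1%:M.
  apply/matrixP => i j; rewrite mul_diag_mx mxE [X in _ * X]mxE [RHS]mxE mulrnAr.
  by rewrite ep1.
have AE : invmx (gram x) *m (th x)^T = A *m diag_mx ep.
  have qT : q^T = gram x *m A by rewrite (trmx_mul A^T (gram x)) trmxK gram_sym.
  by rewrite thE (trmx_mul (diag_mx ep) q) qT tr_diag_mx -mulmxA mulKmx// gram_unit.
rewrite AE; split.
- by rewrite thE -mulmxA [q *m _]mulmxA AG mul1mx.
- by rewrite thE trmx_mul tr_diag_mx -mulmxA.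
- move=> i; have -> : col i (A *m diag_mx ep) = ep 0 i *: col i A.
    by apply/colP => l; rewrite mul_mx_diag !mxE mulrC.
  by move=> v nv b; rewrite hessZl minkZr -scalemxAr minkZl pA// mulrCA.
Qed.

(** * The adapted Lorentz frame *)

Definition rho i x : R := Num.sqrt (lsgn (sg i) * mink (w i x) (w i x)).

Lemma rho_gt0 i x : O x -> 0 < rho i x.
Proof. by move=> Ox; rewrite sqrtr_gt0 w_sign. Qed.

Lemma rho_sqr i x : O x -> rho i x * rho i x = lsgn (sg i) * mink (w i x) (w i x).
Proof. by move=> Ox; rewrite -expr2 sqr_sqrtr// ltW// w_sign. Qed.

Lemma smooth_rho i : smooth_on O (rho i).
Proof.
apply: smooth_sqrt => //; first by move=> x Ox; exact: w_sign.
by apply: smoothM => //; [exact: smooth_cst|exact: smooth_mink].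
Qed.

Definition complement x y : Prop := normal x y /\ forall i, mink y (w i x) = 0.

Lemma complementP x y : O x -> curvature_normals_complement X w x y <-> complement x y.
Proof. by move=> Ox; split=> -[h1 h2]; split=> //; apply/normal_spaceP. Qed.

(** The orthogonal projection onto the complement; subtracting one term per w_i is correct because
    the w_i are mutually orthogonal. *)
Definition proj_compl x : 'M[R]_N := 1%:M - proj_tan x
  - \sum_i (mink (w i x) (w i x))^-1 *: (w i x *m (w i x)^T *m I).

Lemma proj_complE x y : proj_compl x *m y = normal_part x y
  - \sum_i (mink (w i x) y / mink (w i x) (w i x)) *: w i x.
Proof.
rewrite /proj_compl !mulmxBl mul1mx mulmx_suml; congr (_ - _).
apply: eq_bigr => i _; rewrite -scalemxAl mulrC -scalerA; congr (_ *: _).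
rewrite -!mulmxA; apply/colP => s; rewrite mxE big_ord1 [RHS]mxE mulrC.
by rewrite /mink -!mulmxA.
Qed.

Lemma smooth_proj_compl : smooth_on O proj_compl.
Proof.
apply: smooth_mxB => //.
  by apply: smooth_mxB => //; [exact: smooth_mx_cst|exact: smooth_proj_tan].
apply: smooth_mx_sum => // i; apply: smooth_mxZ => //.
  by apply: smoothV => //; [move=> x Ox; exact: w_neq0|exact: smooth_mink].
apply: smooth_mulmx => //; last exact: smooth_mx_cst.
by apply: smooth_mulmx => //; exact: smooth_trmx.
Qed.

Lemma normalZ x t y : normal x y -> normal x (t *: y).
Proof. by move=> ny a; rewrite minkZl ny mulr0. Qed.

Lemma complement_proj x y : O x -> complement x (proj_compl x *m y).
Proof.
move=> Ox; rewrite proj_complE; split.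
  move=> a; rewrite minkBl (normal_nor _ Ox) sub0r mink_suml big1 ?oppr0// => i _.
  by rewrite minkZl w_normal ?mulr0.
move=> j; rewrite minkBl minkC mink_normal_part//; last exact: w_normal.
rewrite mink_suml (bigD1 j)//= big1 => [|i ij].
  by rewrite minkZl divfK ?w_neq0// addr0 subrr.
by rewrite minkZl (curvature_normals_orthogonal Ox ij) mulr0.
Qed.

Lemma proj_compl_id x y : O x -> complement x y -> proj_compl x *m y = y.
Proof.
move=> Ox [ny yw]; rewrite proj_complE /normal_part normal_proj0// subr0.
by rewrite big1 ?subr0// => i _; rewrite minkC yw mul0r scale0r.
Qed.

Lemma mink_proj_compl x y z : O x -> complement x z -> mink (y - proj_compl x *m y) z = 0.
Proof.
move=> Ox [nz zw]; rewrite minkBl proj_complE minkBl minkC [mink (normal_part _ _) _]minkC.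
rewrite mink_normal_part// mink_suml big1 ?subr0 ?subrr// => i _.
by rewrite minkZl [mink (w i x) z]minkC zw mulr0.
Qed.

Hypothesis flat_compl : flat_connection O (curvature_normals_complement X w).

(** The induced connection is the projected derivative, so flatness on projections of constant
    vectors is an identity between iterated derivatives. *)
Lemma flat_proj_compl (eta : 'cV[R]_N) i j x : O x ->
  proj_compl x *m pd i (fun x1 => proj_compl x1 *m pd j (fun x2 => proj_compl x2 *m eta) x1) x
  = proj_compl x *m pd j (fun x1 => proj_compl x1 *m pd i (fun x2 => proj_compl x2 *m eta) x1) x.
Proof.
move=> Ox; have sP := smooth_proj_compl.
have sec (f : 'rV[R]_n -> 'cV[R]_N) : smooth_on O f ->
    section_of O (curvature_normals_complement X w) (fun x => proj_compl x *m f x).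
  move=> sf; split; first exact: smooth_mulmx.
  by move=> x' Ox'; apply/complementP => //; exact: complement_proj.
have ind l (f : 'rV[R]_n -> 'cV[R]_N) : smooth_on O f ->
    induced_derivative O (curvature_normals_complement X w) l f
      (fun x => proj_compl x *m pd l f x).
  move=> sf; split; first by apply: sec; exact: smooth_partial.
  by move=> x' Ox' v /(complementP _ Ox') cv; rewrite pdE mink_proj_compl.
have s0 : smooth_on O (fun x2 => proj_compl x2 *m eta).
  by apply: smooth_mulmx => //; exact: smooth_mx_cst.
have s1 l : smooth_on O (fun x1 => proj_compl x1 *m pd l (fun x2 => proj_compl x2 *m eta) x1).
  by apply: smooth_mulmx => //; exact: smooth_partial.
apply: flat_compl (sec _ (smooth_mx_cst eta oO)) (ind i _ s0) (ind j _ s0)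
  (ind i _ (s1 j)) (ind j _ (s1 i)) x Ox.
Qed.

Lemma flat_proj_compl_mx p (Eta : 'M[R]_(N, p)) i j x : O x ->
  let S x2 := proj_compl x2 *m Eta in
  proj_compl x *m pd i (fun x1 => proj_compl x1 *m pd j S x1) x
  = proj_compl x *m pd j (fun x1 => proj_compl x1 *m pd i S x1) x.
Proof.
move=> Ox S; apply/row_matrixP => s; apply/rowP => t.
have sP := smooth_proj_compl.
have sS : smooth_on O S by apply: smooth_mulmx => //; exact: smooth_mx_cst.
have sPS l : smooth_on O (fun x1 => proj_compl x1 *m pd l S x1).
  by apply: smooth_mulmx => //; exact: smooth_partial.
pose d : 'cV[R]_p := delta_mx t 0.
have E l m : proj_compl x *m pd l (fun x1 => proj_compl x1 *m pd m S x1) x *m d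
  = proj_compl x *m pd l (fun x1 => proj_compl x1 *m
       pd m (fun x2 => proj_compl x2 *m (Eta *m d)) x1) x.
  rewrite -mulmxA; congr (_ *m _).
  have [_ <-] := differentiable_mulmxr d l (smooth_differentiable (sPS m) Ox).
  apply: (partial_eq_on l oO _ Ox) => x1 Ox1; rewrite -mulmxA; congr (_ *m _).
  have [_ <-] := differentiable_mulmxr d m (smooth_differentiable sS Ox1).
  by congr (pd m _ x1); apply/funext => x2; rewrite mulmxA.
have := flat_proj_compl (Eta *m d) i j Ox; rewrite -!E => /colP/(_ s).
by rewrite -!colE !mxE.
Qed.

Lemma pd_col p q (A : 'rV[R]_n -> 'M[R]_(p, q)) l t x :
  differentiable A x -> pd l (fun x1 => col t (A x1)) x = col t (pd l A x).
Proof.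
move=> dA; rewrite colE; have [_ <-] := differentiable_mulmxr (delta_mx t 0 : 'cV_q) l dA.
by congr (pd l _ x); apply/funext => x1; rewrite colE.
Qed.

Lemma constant_on_ball p q (A : 'rV[R]_n -> 'M[R]_(p, q)) x0 (r : R) :
  smooth_on (ball x0 r) A -> (forall l x, ball x0 r x -> pd l A x = 0) ->
  forall x, ball x0 r x -> A x = A x0.
Proof.
move=> sA A0 x bx; have oB : open (ball x0 r) by exact: ball_open.
have b0 : ball x0 r x0 by apply: ballxx; move/in_ballE: bx; exact: le_lt_trans.
apply/matrixP => a b; apply/eqP; rewrite -subr_eq0 -normr_le0.
have dAab x1 : ball x0 r x1 -> differentiable (fun x2 => A x2 a b) x1.
  by have /(smooth_mxP _ oB)/(_ a b) := sA; exact: smooth_differentiable.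
have := @mean_value_le R n (fun x1 => A x1 a b) x0 r 0 x0 (x - x0) dAab.
rewrite subrKC mulr0 mul0r; apply => // x1 i b1.
have dA1 : differentiable A x1 by exact: smooth_differentiable b1.
by rewrite -(partial_mxE i a b dA1) A0// mxE normr0.
Qed.

(** Marks the slots reserved for the complement: the normal ones outside the image of [sg]. *)
Definition cmp (t : 'I_N) : bool :=
  match fintype.split t with inl _ => false | inr b => [forall i, sg i != b] end.

Lemma split_l j : fintype.split (lshift (n + k) j : 'I_N) = inl j.
Proof. exact: (unsplitK (inl j)). Qed.

Lemma split_r b : fintype.split (nidx b : 'I_N) = inr b.
Proof. exact: (unsplitK (inr b)). Qed.

Lemma cmp_nidx b : cmp (nidx b) = [forall i, sg i != b].
Proof. by rewrite /cmp split_r. Qed.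

Variant index_spec : 'I_N -> bool -> Type :=
  | IndexTangent j : index_spec (lshift (n + k) j) false
  | IndexNormal i : index_spec (nidx (sg i)) false
  | IndexComplement b of (forall i, sg i != b) : index_spec (nidx b) true.

Lemma indexP t : index_spec t (cmp t).
Proof.
rewrite -[t]splitK; case: (fintype.split t) => [j|b] /=; first by rewrite /cmp split_l; constructor.
rewrite -/(nidx b) cmp_nidx; case: (boolP [forall i, sg i != b]) => [/forallP|] h.
  by constructor.
have /existsP/sigW[i /eqP <-] : [exists i, sg i == b].
  by move: h; rewrite negb_forall => /existsP[i]; rewrite negbK => hi; apply/existsP; exists i.
by constructor.
Qed.

Lemma lsgn_lshift j : lsgn (lshift (n + k) j : 'I_N) = 1 :> R.
Proof.
rewrite /lsgn; case: eqP => //= h; have := ltn_ord j.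
by move: h => /=; lia.
Qed.

Lemma lsgn_nidx b : lsgn (nidx b : 'I_N) = lsgn b :> R.
Proof. by rewrite /lsgn /= -addnS eqn_add2l. Qed.

(** Complement slots hold zero columns, to be filled by adding a second matrix. *)
Definition base_frame (ev uv : 'I_n -> 'cV[R]_N) : 'M[R]_N := \matrix_(s, t)
  match fintype.split t with
  | inl j => ev j s 0
  | inr b => if [pick i | sg i == b] is Some i then uv i s 0 else 0
  end.

Lemma base_frame_e ev uv j : col (lshift (n + k) j) (base_frame ev uv) = ev j.
Proof. by apply/colP => s; rewrite !mxE split_l. Qed.

Lemma base_frame_u ev uv i : col (nidx (sg i)) (base_frame ev uv) = uv i.
Proof.
apply/colP => s; rewrite !mxE split_r; case: pickP => [i' /eqP/sg_inj ->//|/(_ i)].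
by rewrite eqxx.
Qed.

Lemma base_frame_0 ev uv b : (forall i, sg i != b) -> col (nidx b) (base_frame ev uv) = 0.
Proof.
move=> hb; apply/colP => s; rewrite !mxE split_r; case: pickP => // i hi.
by have := hb i; rewrite hi.
Qed.

(** Right multiplication keeps the complement columns and erases the others. *)
Definition cmask : 'M[R]_N := diag_mx (\row_t (cmp t)%:R).

Lemma col_cmask p (A : 'M[R]_(p, N)) t : col t (A *m cmask) = if cmp t then col t A else 0.
Proof.
apply/colP => s; rewrite mxE mul_mx_diag !mxE.
by case: ifP => _; rewrite ?mulr1 ?mulr0 !mxE.
Qed.

Lemma cmask_sqr : cmask *m cmask = cmask.
Proof.
apply/matrixP => s t; rewrite mul_diag_mx !mxE.
by case: (cmp s); rewrite ?mul1r ?mul0r ?mul0rn.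
Qed.

Lemma mx_col_eq p q (A B : 'M[R]_(p, q)) : (forall t, col t A = col t B) -> A = B.
Proof. by move=> h; apply/matrixP => s t; have /colP/(_ s) := h t; rewrite !mxE. Qed.

Lemma proj_compl_eq0 x y : O x -> (forall v, complement x v -> mink y v = 0) ->
  proj_compl x *m y = 0.
Proof.
move=> Ox yV; apply: mink_nondegenerate => z.
have cy := complement_proj y Ox; have cz := complement_proj z Ox.
have h1 := mink_proj_compl z Ox cy; have h2 := mink_proj_compl y Ox cz.
rewrite minkBl in h1; rewrite minkBl yV// sub0r in h2.
rewrite minkC; move/eqP: h1; rewrite subr_eq0 => /eqP ->.
by rewrite minkC; apply/eqP; rewrite -oppr_eq0 h2.
Qed.

Lemma mulmx_col p q r (A : 'M[R]_(p, q)) (B : 'M[R]_(q, r)) t :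
  col t (A *m B) = A *m col t B.
Proof. by rewrite !colE mulmxA. Qed.

(** A -> - A^T is a Lie algebra automorphism; it carries flatness over when dH = - Ga H is
    transposed into the form dg = g A. *)
Lemma neg_trmx_bracket m (U V P Q : 'M[R]_m) : U - V = P *m Q - Q *m P ->
  - U^T - - V^T = (- P^T) *m (- Q^T) - (- Q^T) *m (- P^T).
Proof.
move=> /(congr1 trmx); rewrite !linearB/= !trmx_mul => h.
by rewrite opprK !mulNmx !mulmxN !opprK addrC -opprB h opprB.
Qed.

Lemma linv_mulE m p (P : 'M[R]_m) (Q : 'M[R]_(m, p)) s t :
  (linv P *m Q) s t = lsgn s * mink (col s P) (col t Q).
Proof. by rewrite /linv -!mulmxA mul_diag_mx mxE mulmxA mink_cols mxE. Qed.

Lemma hess_deltal l x a : hess x (delta_mx l 0) a = pd l dX x *m a.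
Proof.
rewrite /hess (bigD1 l)//= big1 ?addr0 => [|i /negbTE il].
  by rewrite mxE !eqxx scale1r.
by rewrite mxE il scale0r.
Qed.

Lemma weingarten D (s : 'rV[R]_n -> 'cV[R]_N) l x a : open D -> D `<=` O -> D x ->
  differentiable s x -> (forall x1, D x1 -> normal x1 (s x1)) ->
  mink (pd l s x) (dX x *m a) = - mink (s x) (pd l dX x *m a).
Proof.
move=> oD DO Dx ds ns; have ddX := smooth_differentiable smooth_dX (DO x Dx).
have [d1 d2] := differentiable_mulmxr a l ddX.
have := partial_mink l ds d1; rewrite d2.
rewrite (@partial_eq_on R n _ D _ (fun=> 0) l x)//; last by move=> y Dy; exact: ns.
by rewrite partial_cst => /eqP; rewrite eq_sym addr_eq0 => /eqP.
Qed.

(** The frame is a sum [W] + [Y]: the known columns e_j and u_i, and a parallel orthonormal basis of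
    the complement. Signs of the latter are settled at x0, where a Lorentz matrix extends the known
    columns, and are then preserved by parallelism. *)
Lemma adapted_frame x0 : O x0 ->
  exists (r : R) (Phi : 'rV[R]_n -> 'M[R]_N) (om : 'rV[R]_n -> 'M[R]_n),
  [/\ 0 < r, ball x0 r `<=` O, smooth_on (ball x0 r) Phi & smooth_on (ball x0 r) om] /\
  forall x, ball x0 r x -> [/\ lorentz_group (Phi x), om x \in unitmx,
    forall l j b, (linv (Phi x) *m pd l Phi x) (lshift (n + k) j) (nidx b)
                  = om x j l *+ (b == sg j),
    forall i, frame_u Phi (sg i) x = (rho i x)^-1 *: w i x &
    [/\ forall l b c, (forall i, sg i != b) -> (forall i, sg i != c) ->
          mink (pd l (frame_u Phi b) x) (frame_u Phi c x) = 0,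
        forall b, normal x (frame_u Phi b x) &
        forall j, tangent x (frame_e Phi j x)]].
Proof.
move=> Ox0; have [r0 [th [r00 r0O sth hth]]] := principal_coframe Ox0.
set B0 := ball x0 r0 in sth *; have oB0 : open B0 by exact: ball_open.
have B0x0 : B0 x0 by exact: ballxx.
pose A x := invmx (gram x) *m (th x)^T.
have AG x : B0 x -> (A x)^T *m gram x = th x by move=> /hth[].
have thA x : B0 x -> th x *m A x = 1%:M by move=> /hth[].
have pA x i : B0 x -> principal x (w i x) (col i (A x)) by move=> /hth[].
have sA : smooth_on B0 A.
  apply: smooth_mulmx => //; last exact: smooth_trmx.
  apply: smooth_invmx => //; first by move=> x /r0O; exact: gram_unit.
  exact: smooth_on_subset smooth_gram.
have sdX : smooth_on B0 dX by apply: smooth_on_subset smooth_dX.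
pose e j x : 'cV[R]_N := - lsgn (sg j) *: (dX x *m col j (A x)).
pose u i x : 'cV[R]_N := (rho i x)^-1 *: w i x.
have se j : smooth_on B0 (e j).
  apply: smooth_mxZ => //; first exact: smooth_cst.
  apply: smooth_mulmx => //.
  apply: (@smooth_mx_eq _ _ _ _ _ (fun x => A x *m delta_mx j 0)) => //.
    by move=> x _; rewrite -colE.
  by apply: smooth_mulmx => //; exact: smooth_mx_cst.
have su i : smooth_on B0 (u i).
  apply: smooth_mxZ => //; last exact: smooth_on_subset (sw i).
  apply: smoothV => //; first by move=> x /r0O Ox; rewrite gt_eqF// rho_gt0.
  exact: smooth_on_subset (smooth_rho i).
have dXA x i (c : 'cV[R]_n) : B0 x ->
    mink (dX x *m col i (A x)) (dX x *m c) = (th x *m c) i 0.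
  move=> Bx; rewrite gramE tr_col -row_mul AG// -row_mul.
  by rewrite mxE.
have ee x j l : B0 x -> mink (e j x) (e l x) = (j == l)%:R.
  move=> Bx; rewrite minkZl minkZr dXA// -mulmx_col thA// 2!mxE mulrA mulrNN.
  by case: eqVneq => [<-|_]; rewrite ?mulr0// lsgn_sqr mul1r.
have nu x i : B0 x -> normal x (u i x) by move=> Bx; apply: normalZ; apply: w_normal; exact: r0O.
have te x j : tangent x (e j x).
  by exists (- lsgn (sg j) *: col j (A x)); rewrite -scalemxAr.
have eu x j i : B0 x -> mink (e j x) (u i x) = 0.
  by move=> Bx; rewrite minkC; apply: normal_tangent (nu x i Bx) (te x j).
have uu x i l : B0 x -> mink (u i x) (u l x) = lsgn (sg i) *+ (i == l).
  move=> Bx; have Ox := r0O x Bx; rewrite minkZl minkZr; have [<-|il] := eqVneq i l.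
    rewrite mulrA -invfM rho_sqr// invfM -[_^-1]mulr1 -(lsgn_sqr (sg i)) mulKf ?lsgn_neq0//.
    by rewrite mulfVK ?w_neq0.
  by rewrite curvature_normals_orthogonal ?mulr0.
have spanE x y : B0 x -> (forall j, mink y (e j x) = 0) -> normal x y.
  move=> Bx ye a.
  have -> : dX x *m a = \sum_j (- lsgn (sg j) * (th x *m a) j 0) *: e j x.
    rewrite -[a in LHS]mul1mx -(mulmx1C (thA x Bx)) -mulmxA mulmxA.
    apply/colP => s; rewrite mxE summxE; apply: eq_bigr => j _.
    rewrite /e scalerA -mulmx_col [RHS]mxE [col j _ s 0]mxE [LHS]mulrC.
    by rewrite [- _ * _ * - _]mulrAC mulrNN lsgn_sqr mul1r.
  by rewrite mink_sumr big1// => j _; rewrite minkZr ye mulr0.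
pose W x := base_frame (e ^~ x) (u ^~ x).
have sW : smooth_on B0 W.
  apply/smooth_mxP => // s t; case: (indexP t) => [j|i|b hb].
  - apply: (@smooth_on_eq _ _ _ (fun x => e j x s 0)) => //.
      move=> x _; have /colP/(_ s) := base_frame_e (e ^~ x) (u ^~ x) j.
      by rewrite mxE => ->.
    by have /(smooth_mxP _ oB0) := se j; apply.
  - apply: (@smooth_on_eq _ _ _ (fun x => u i x s 0)) => //.
      move=> x _; have /colP/(_ s) := base_frame_u (e ^~ x) (u ^~ x) i.
      by rewrite mxE => ->.
    by have /(smooth_mxP _ oB0) := su i; apply.
  - apply: (@smooth_on_eq _ _ _ (fun=> 0)) => //; last exact: smooth_cst.
    move=> x _; have /colP/(_ s) := base_frame_0 (e ^~ x) (u ^~ x) hb.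
    by rewrite mxE [RHS]mxE => ->.
have WW x s t : B0 x -> mink (col s (W x)) (col t (W x))
    = if cmp s || cmp t then 0 else lsgn s *+ (s == t).
  move=> Bx; case: (indexP s) => [j|i|b hb] /=; case: (indexP t) => [l|m|c hc] /=;
    rewrite ?base_frame_e ?base_frame_u ?base_frame_0// ?mink0l ?mink0r//.
  - by rewrite ee// lsgn_lshift (inj_eq (@lshift_inj _ _)).
  - rewrite eu// eq_sym; case: eqP => // h;
    by have := congr1 (@fintype.split n (n + k)) h; rewrite split_l split_r.
  - rewrite minkC eu//; case: eqP => // h;
    by have := congr1 (@fintype.split n (n + k)) h; rewrite split_l split_r.
  - by rewrite uu// lsgn_nidx (inj_eq (@rshift_inj _ _)) (inj_eq sg_inj).
have WV x y t : B0 x -> complement x y -> mink (col t (W x)) y = 0.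
  move=> Bx [ny yw]; rewrite minkC; case: (indexP t) => [j|i|b hb].
  - by rewrite base_frame_e; exact: normal_tangent ny (te x j).
  - by rewrite base_frame_u minkZr yw mulr0.
  - by rewrite base_frame_0// mink0r.
have [P hP PW] : exists2 P, lorentz_group P &
    forall t, ~~ cmp t -> col t P = col t (W x0).
  have [|P hP PW] := @lorentz_extend R N (W x0) [set t | ~~ cmp t].
    by move=> s t; rewrite !inE => /negbTE hs /negbTE ht; rewrite WW// hs ht.
  by exists P => // t ht; apply: PW; rewrite inE.
have lP := (lorentz_groupP P).1 hP.
have PP s t : mink (col s P) (col t P) = lsgn s *+ (s == t).
  by rewrite !colE lP mink_delta mxE eqxx andbT eq_sym mulr_natr; case: eqP => [->|].
pose Eta := P *m cmask.
have VP t : cmp t -> complement x0 (col t P).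
  move=> ct; have eP j : mink (col t P) (e j x0) = 0.
    have := PW (lshift (n + k) j); rewrite base_frame_e => <-; last by rewrite /cmp split_l.
    by rewrite PP; case: eqP => // tj; move: ct; rewrite tj /cmp split_l.
  have uP i : mink (col t P) (u i x0) = 0.
    have [h1 h2] : ~~ cmp (nidx (sg i)) /\ (t == nidx (sg i)) = false.
      have h : ~~ cmp (nidx (sg i)).
        by rewrite cmp_nidx; apply/forallPn; exists i; rewrite eqxx.
      by split=> //; apply/eqP => ti; move: h; rewrite -ti ct.
    by have := PW _ h1; rewrite base_frame_u => <-; rewrite PP h2.
  split=> [|i]; first exact: spanE.
  have := uP i; rewrite minkZr => /eqP; rewrite mulf_eq0 invr_eq0.
  by rewrite (gt_eqF (rho_gt0 i Ox0)) => /eqP.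
(* The complement basis at x0 is projected to the complement at x. Near x0 this gives a basis of the
   whole space, in general neither orthonormal nor parallel. *)
pose T x := W x + proj_compl x *m Eta.
have sPr : smooth_on B0 proj_compl by apply: smooth_on_subset smooth_proj_compl.
have sT : smooth_on B0 T.
  by apply: smooth_mxD => //; apply: smooth_mulmx => //; exact: smooth_mx_cst.
have T0 : T x0 = P.
  apply: mx_col_eq => t; rewrite linearD/= mulmx_col col_cmask.
  case ct : (cmp t); last by rewrite -PW ?ct// mulmx0 addr0.
  rewrite (proj_compl_id Ox0 (VP t ct)); case: (indexP t) ct => // b hb _.
  by rewrite base_frame_0// add0r.
have [r1 [r10 r1r0 uT]] : exists r1 : R, [/\ 0 < r1, r1 <= r0 &
    forall x, ball x0 r1 x -> T x \in unitmx].
  have sdet := smooth_det oB0 sT.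
  have : \forall x \near (x0 : 'rV[R]_n), `|\det (T x0) - \det (T x)| < `|\det (T x0)|.
    have := smooth_continuous sdet B0x0; move/(@cvgrPdist_lt _ _ _ (nbhs x0)); apply.
    by rewrite normr_gt0 T0 -unitfE -unitmxE; exact: lorentz_unit.
  move=> /nbhs_ballP[r1 /= r10 hr1]; exists (Num.min r1 r0).
  rewrite lt_min r10 ge_min lexx orbT; split=> // x bx.
  have := hr1 x; rewrite unitmxE unitfE => /(_ _) h.
  apply: contraTneq (h _) => [->|]; first by rewrite subr0 ltxx.
  by apply: le_ball bx; rewrite ge_min lexx.
set B1 := ball x0 r1 in uT.
have oB1 : open B1 by exact: ball_open.
have B10 : B1 `<=` B0 by exact: le_ball.
have B1O x : B1 x -> O x by move=> /B10/r0O.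
have dT x : B1 x -> differentiable T x by move=> /B10; exact: smooth_differentiable.
have PrW x : B1 x -> proj_compl x *m W x = 0.
  move=> Bx; apply: mx_col_eq => t; rewrite mulmx_col col0.
  by apply: (proj_compl_eq0 (B1O x Bx)) => v; apply: WV; exact: B10.
have PrPr x : B1 x -> proj_compl x *m (proj_compl x *m Eta) = proj_compl x *m Eta.
  move=> Bx; apply: mx_col_eq => t; rewrite !mulmx_col.
  by rewrite proj_compl_id//; [exact: B1O|apply: complement_proj; exact: B1O].
have PrT x : B1 x -> proj_compl x *m T x = proj_compl x *m Eta.
  by move=> Bx; rewrite mulmxDr PrW// add0r PrPr.
have EtaE : Eta *m cmask = Eta by rewrite -mulmxA cmask_sqr.
have WE x : W x *m cmask = 0.
  apply: mx_col_eq => t; rewrite col_cmask col0; case: (indexP t) => // b hb.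
  exact: base_frame_0.
have TE x : T x *m cmask = proj_compl x *m Eta.
  by rewrite mulmxDl WE add0r -mulmxA EtaE.
pose C l x := invmx (T x) *m pd l T x.
have TC l x : B1 x -> T x *m C l x = pd l T x by move=> Bx; rewrite mulKVmx// uT.
pose Ga l x := cmask *m C l x *m cmask.
have sC l : smooth_on B1 (C l).
  apply: smooth_mulmx => //.
    by apply: smooth_invmx => //; exact: smooth_on_subset sT.
  by apply: smooth_partial; exact: smooth_on_subset sT.
have sGa l : smooth_on B1 (Ga l).
  do 2![apply: smooth_mulmx => //; try exact: smooth_mx_cst].
have dGa l x : B1 x -> differentiable (Ga l) x by exact: smooth_differentiable.
have cGa l x : cmask *m Ga l x = Ga l x by rewrite /Ga !mulmxA cmask_sqr.
have cdGa l m x : B1 x -> cmask *m pd l (Ga m) x = pd l (Ga m) x.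
  move=> Bx; have [_ <-] := differentiable_mulmxl cmask l (dGa m x Bx).
  by congr (pd l _ x); apply/funext => x1; exact: cGa.
have cov l x : B1 x -> proj_compl x *m pd l (fun x1 => proj_compl x1 *m Eta) x
    = T x *m Ga l x.
  move=> Bx; have -> : (fun x1 => proj_compl x1 *m Eta) = fun x1 => T x1 *m cmask.
    by apply/funext => x1; rewrite TE.
  have [_ ->] := differentiable_mulmxr cmask l (dT x Bx).
  by rewrite -TC// /Ga !mulmxA PrT// -TE.
(* Equality of the iterated covariant derivatives, written in the basis [T]; here flatness of the
   complement enters. *)
have flatGa i j x : B1 x ->
    pd j (Ga i) x - pd i (Ga j) x = Ga i x *m Ga j x - Ga j x *m Ga i x.
  move=> Bx.
  have E l m : proj_compl x *m pd l (fun x1 => proj_compl x1 *m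
       pd m (fun x2 => proj_compl x2 *m Eta) x1) x
     = T x *m (Ga l x *m Ga m x + pd l (Ga m) x).
    rewrite (partial_eq_on l oB1 (cov m) Bx) (partialMmx l (dT x Bx) (dGa m x Bx)).
    rewrite [LHS]mulmxDr [RHS]mulmxDr; congr (_ + _).
      rewrite -TC// [LHS]mulmxA [X in X *m Ga m x]mulmxA PrT// -TE -[in LHS](cGa m).
      by rewrite /Ga !mulmxA.
    by rewrite [LHS]mulmxA PrT// -TE -mulmxA cdGa.
  have abel (a b c d : 'M[R]_N) : a + b = c + d -> d - b = a - c.
    by move=> h; apply/eqP; rewrite subr_eq addrAC h [c + d]addrC addrK.
  have := flat_proj_compl_mx Eta i j (B1O x Bx); rewrite /= !E.
  move/(can_inj (mulKmx (uT x Bx))) => h.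
  by apply: abel; rewrite h.
(* [Ga] is the connection form of the complement in the frame [T]; solving
   dH = - Ga H turns the complement part of [T] into a parallel frame. *)
pose Am l x := - (Ga l x)^T.
have sAm l : smooth_on B1 (Am l) by apply: smooth_mxN => //; exact: smooth_trmx.
have dAm l m x : B1 x -> pd l (Am m) x = - (pd l (Ga m) x)^T.
  by move=> Bx; have [d1 d2] := partial_trmx l (dGa m x Bx); rewrite /Am partial_mxN// d2.
have mcAm i j x : B1 x ->
    pd j (Am i) x - pd i (Am j) x = Am i x *m Am j x - Am j x *m Am i x.
  by move=> Bx; rewrite !dAm//; apply: neg_trmx_bracket; exact: flatGa.
have [r2 /andP[r20 r2r1] [g [sg2 g0 dg]]] := frobenius r10 sAm mcAm.
set B2 := ball x0 r2 in sg2 dg; have oB2 : open B2 by exact: ball_open.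
have B21 : B2 `<=` B1 by exact: le_ball.
have B20 x : B2 x -> B0 x by move=> /B21/B10.
have B2O x : B2 x -> O x by move=> /B21/B1O.
have B2x0 : B2 x0 by exact: ballxx.
pose H x := (g x)^T.
have H0 : H x0 = 1%:M by rewrite /H g0 trmx1.
have sH : smooth_on B2 H by exact: smooth_trmx.
have dH l x : B2 x -> pd l H x = - (Ga l x *m H x).
  move=> Bx; have [_ ->] := partial_trmx l (smooth_differentiable sg2 Bx).
  by rewrite dg// trmx_mul /Am linearN/= trmxK mulNmx.
have Hdiff x : B2 x -> differentiable H x by move=> Bx; exact: smooth_differentiable Bx.
(* The rows of [Ga] outside the complement vanish, so those rows of H stay constant and H preserves
   the complement slots. *)
have HE x : B2 x -> H x *m cmask = cmask *m H x *m cmask.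
  move=> Bx; pose L : 'M[R]_N := 1%:M - cmask.
  have := @constant_on_ball _ _ (fun x1 => L *m H x1) x0 r2 _ _ x Bx.
  rewrite H0 mulmx1 => h.
  have {}h : L *m H x = L.
    apply: h; first by apply: smooth_mulmx => //; exact: smooth_mx_cst.
    move=> l y By; have [_ ->] := differentiable_mulmxl L l (Hdiff y By).
    by rewrite dH// mulmxN -cGa /L !mulmxA mulmxBl mul1mx cmask_sqr subrr !mul0mx oppr0.
  have : L *m H x *m cmask = 0 by rewrite h /L mulmxBl mul1mx cmask_sqr subrr.
  by rewrite /L mulmxBl mul1mx mulmxBl => /eqP; rewrite subr_eq0 => /eqP.
pose Y x := T x *m (H x *m cmask).
have sHc : smooth_on B2 (fun x => H x *m cmask).
  by apply: smooth_mulmx => //; exact: smooth_mx_cst.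
have sY : smooth_on B2 Y.
  by apply: smooth_mulmx => //; apply: smooth_on_subset sT => // x /B20.
have Ydiff x : B2 x -> differentiable Y x by move=> Bx; exact: smooth_differentiable Bx.
(* The complement part of the derivative cancels: only a combination of the e_j and u_i remains, so
   the columns of Y are parallel. *)
have dY l x : B2 x -> pd l Y x = W x *m (C l x *m (H x *m cmask)).
  move=> Bx; rewrite /Y (partialMmx l (dT x (B21 x Bx)) (smooth_differentiable sHc Bx)).
  have [_ ->] := differentiable_mulmxr cmask l (Hdiff x Bx).
  rewrite dH// -(TC l x (B21 x Bx)).
  have -> : W x = T x - T x *m cmask by rewrite TE /T addrK.
  rewrite mulmxBl -[T x *m C l x *m _]mulmxA; congr (_ + _).
  by rewrite mulNmx mulmxN -[Ga l x *m _ *m _]mulmxA HE// /Ga -!mulmxA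
    [cmask *m (cmask *m _)]mulmxA cmask_sqr.
have Ycompl x t : B2 x -> complement x (col t (Y x)).
  move=> Bx; rewrite /Y HE// !mulmxA TE -!mulmxA mulmx_col.
  by apply: complement_proj; exact: B2O.
have Y0 x t : ~~ cmp t -> col t (Y x) = 0.
  by rewrite /Y mulmxA col_cmask => /negbTE ->.
have WZ x y Z t : B2 x -> complement x y -> mink y (col t (W x *m Z)) = 0.
  move=> Bx cy; rewrite mulmx_col minkC mink_mulmxl big1// => s _.
  by rewrite WV ?mulr0//; exact: B20.
(* The derivative of Y is orthogonal to the complement, hence to Y, and the Gram matrix keeps its
   value at x0. *)
have YY x s t : B2 x -> mink (col s (Y x)) (col t (Y x))
    = if cmp s && cmp t then lsgn s *+ (s == t) else 0.
  move=> Bx; pose K x1 := (Y x1)^T *m I *m Y x1.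
  have sYt : smooth_on B2 (fun x1 => (Y x1)^T) by exact: smooth_trmx.
  have sYI : smooth_on B2 (fun x1 => (Y x1)^T *m I).
    by apply: smooth_mulmx => //; exact: smooth_mx_cst.
  rewrite -mink_cols -[LHS]/(K x s t) (@constant_on_ball _ _ K x0 r2)//.
  - rewrite /K mink_cols /Y T0 H0 mul1mx !col_cmask.
    by case: (cmp s); case: (cmp t); rewrite /= ?mink0l ?mink0r ?PP.
  - by apply: smooth_mulmx.
  - move=> l y By; rewrite /K (partialMmx l (smooth_differentiable sYI By) (Ydiff y By)).
    have [_ ->] := differentiable_mulmxr I l (smooth_differentiable sYt By).
    have [_ ->] := partial_trmx l (Ydiff y By); rewrite dY//.
    apply/matrixP => a b; rewrite mxE !mink_cols [RHS]mxE.
    rewrite WZ ?addr0//; last exact: Ycompl.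
    by rewrite minkC WZ//; exact: Ycompl.
pose Phi x := W x + Y x.
have sPhi : smooth_on B2 Phi.
  by apply: smooth_mxD => //; apply: smooth_on_subset sW => x /B20.
have Phidiff x : B2 x -> differentiable Phi x by move=> Bx; exact: smooth_differentiable Bx.
have lPhi x : B2 x -> lorentz_group (Phi x).
  move=> Bx; apply/matrixP => s t; rewrite mink_cols lorentzE /Phi !linearD/=.
  rewrite minkDl !minkDr WW ?YY; [|by []|exact: B20].
  rewrite (WV x _ s (B20 x Bx) (Ycompl x t Bx)) minkC (WV x _ t (B20 x Bx) (Ycompl x s Bx)).
  rewrite addr0 add0r; case cs : (cmp s); case ct : (cmp t); rewrite /= ?add0r ?addr0//.
    by case: eqP => // st; rewrite st ct in cs.
  by case: eqP => // st; rewrite st ct in cs.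
have phiE x j : frame_e Phi j x = e j x.
  by rewrite /frame_e /Phi linearD/= base_frame_e Y0 ?addr0// /cmp split_l.
have phiU x i : frame_u Phi (sg i) x = u i x.
  rewrite /frame_u /Phi linearD/= base_frame_u Y0 ?addr0// cmp_nidx.
  by apply/forallPn; exists i; rewrite eqxx.
have phiC x b : (forall i, sg i != b) -> frame_u Phi b x = col (nidx b) (Y x).
  by move=> hb; rewrite /frame_u /Phi linearD/= base_frame_0// add0r.
have nPhi x b : B2 x -> normal x (frame_u Phi b x).
  move=> Bx; have [/forallP hb|] := boolP [forall i, sg i != b].
    by rewrite phiC//; have [] := Ycompl x (nidx b) Bx.
  by rewrite negb_forall => /existsP[i]; rewrite negbK => /eqP <-; rewrite phiU; apply/nu/B20.
pose om x : 'M[R]_n := \matrix_(j, l) (rho j x * th x j l).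
exists r2, Phi, om; split; first split=> //.
- apply: smooth_matrix => // j l; apply: smoothM => //.
    by apply: smooth_on_subset (smooth_rho j) => x /B2O.
  have /(smooth_mxP _ oB0)/(_ j l) := sth; apply: smooth_on_subset => x.
  exact: B20.
move=> x Bx; have B0x := B20 x Bx; have Ox := B2O x Bx; split; first exact: lPhi.
- have -> : om x = diag_mx (\row_j rho j x) *m th x.
    by apply/matrixP => j l; rewrite mul_diag_mx !mxE.
  rewrite unitmx_mul; apply/andP; split; last by have /mulmx1_unit[] := thA x B0x.
  rewrite unitmxE det_diag unitfE; apply/prodf_neq0 => j _.
  by rewrite mxE gt_eqF// rho_gt0.
- move=> l j b; rewrite linv_mulE lsgn_lshift mul1r -[col _ (Phi x)]/(frame_e Phi j x) phiE.
  rewrite -pd_col; last exact: Phidiff.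
  rewrite /e minkZl minkC (@weingarten B2 (frame_u Phi b))//; last first.
  - by move=> y; exact: nPhi.
  - have [d _] := differentiable_mulmxr (delta_mx (nidx b) 0 : 'cV_N) l (Phidiff x Bx).
    have -> // : frame_u Phi b = fun x1 => Phi x1 *m delta_mx (nidx b) 0.
      by apply/funext => y; rewrite /frame_u colE.
  rewrite -hess_deltal hessC// (pA x j B0x _ (nPhi x b Bx)) dXA// -colE [col _ _ _ _]mxE.
  rewrite mulrN mulNr opprK [om x j l]mxE mulrA.
  have [<-|bj] := eqVneq (sg j) b.
    rewrite phiU /u minkZl mulr1n; congr (_ * _).
    by rewrite mulrCA -rho_sqr// mulrA mulVf ?mul1r// gt_eqF// rho_gt0.
  rewrite mulr0n; apply/eqP; rewrite !mulf_eq0.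
  apply/orP; left; apply/orP; right; apply/eqP.
  have [/forallP hb|] := boolP [forall i, sg i != b].
    by rewrite phiC//; have [_ ->] := Ycompl x (nidx b) Bx.
  rewrite negb_forall => /existsP[i]; rewrite negbK => /eqP bi; rewrite -bi phiU /u minkZl.
  rewrite curvature_normals_orthogonal ?mulr0//; apply: contraNneq bj => <-.
  by rewrite bi.
- by move=> i; exact: phiU.
split=> [l b c hb hc|b|j]; last by rewrite phiE.
- rewrite (partial_eq_on l oB2 (fun x1 _ => phiC x1 b hb) Bx) (pd_col l _ (Ydiff x Bx)) phiC//.
  by rewrite dY// minkC WZ//; exact: Ycompl.
- exact: nPhi.
Qed.

End Immersion.

(** * The Maurer-Cartan form of an adapted frame *)

Section MaurerCartan.
Context {R : realType} {n k : nat}.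
Local Notation N := (n + (n + k))%N.
Implicit Types (x : 'rV[R]_n).
Local Notation I := (lorentz R N).

Definition mc (Phi : 'rV[R]_n -> 'M[R]_N) l x : 'M[R]_N := linv (Phi x) *m pd l Phi x.

Variables (D : set 'rV[R]_n) (Phi : 'rV[R]_n -> 'M[R]_N).
Hypotheses (oD : open D) (sPhi : smooth_on D Phi).
Hypothesis lPhi : forall x, D x -> lorentz_group (Phi x).

Lemma smooth_linv : smooth_on D (fun x => linv (Phi x)).
Proof.
apply: smooth_mulmx => //; last exact: smooth_mx_cst.
by apply: smooth_mulmx => //; [exact: smooth_mx_cst|exact: smooth_trmx].
Qed.

Lemma smooth_mc l : smooth_on D (mc Phi l).
Proof.
by apply: smooth_mulmx => //; [exact: smooth_linv|exact: smooth_partial].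
Qed.

Lemma frame_mc l x : D x -> pd l Phi x = Phi x *m mc Phi l x.
Proof. by move=> Dx; rewrite /mc [RHS]mulmxA (linvKr (lPhi Dx)) mul1mx. Qed.

Lemma mc_skew l x s t : D x -> lsgn s * mc Phi l x s t = - (lsgn t * mc Phi l x t s).
Proof.
move=> Dx; have dP := smooth_differentiable sPhi Dx.
rewrite /mc !linv_mulE !mulrA !lsgn_sqr !mul1r.
have [d1 p1] := differentiable_mulmxr (delta_mx s 0 : 'cV_N) l dP.
have [d2 p2] := differentiable_mulmxr (delta_mx t 0 : 'cV_N) l dP.
have := partial_mink l d1 d2; rewrite p1 p2 -!colE.
rewrite (@partial_eq_on R n _ D _ (fun=> mink (delta_mx s 0) (delta_mx t 0)) l x)//.
  by rewrite partial_cst minkC => /eqP; rewrite eq_sym addrC addr_eq0 => /eqP ->; rewrite minkC.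
by move=> x1 Dx1; have /lorentz_groupP -> := lPhi Dx1.
Qed.

Lemma mc_diag l x s : D x -> mc Phi l x s s = 0.
Proof.
move=> Dx; have /eqP := mc_skew l s s Dx; rewrite -addr_eq0 -mulr2n mulrn_eq0/=.
by rewrite mulf_eq0 (negbTE (lsgn_neq0 s)) => /eqP.
Qed.

(** Equality of the mixed partial derivatives of Phi, after cancelling Phi. *)
Lemma maurer_cartan i j x : D x ->
  pd i (mc Phi j) x - pd j (mc Phi i) x = mc Phi j x *m mc Phi i x - mc Phi i x *m mc Phi j x.
Proof.
move=> Dx; have E a b : pd a (pd b Phi) x
    = Phi x *m (mc Phi a x *m mc Phi b x + pd a (mc Phi b) x).
  rewrite (partial_eq_on a oD (fun x1 => @frame_mc b x1) Dx).
  rewrite (partialMmx a (smooth_differentiable sPhi Dx) (smooth_differentiable (smooth_mc b) Dx)).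
  by rewrite frame_mc// mulmxDr mulmxA.
have := schwarz_mx i j oD Dx sPhi; rewrite !E.
move/(can_inj (mulKmx (lorentz_unit (lPhi Dx)))) => h.
apply/eqP; rewrite subr_eq addrAC eq_sym subr_eq -h addrC.
by rewrite addrC.
Qed.

End MaurerCartan.

(** * Integrating the dual forms to co-ordinates *)

Section AdaptedCoordinates.
Context {R : realType} {n k : nat}.
Local Notation N := (n + (n + k))%N.
Implicit Types (x : 'rV[R]_n).

(** Each row of [om] is a closed form with a primitive psi_j. The Jacobian of psi is the transpose
    of [om], invertible at x0; in the inverse co-ordinates the forms become dx_j. *)
Lemma adapted_coordinates (sg : 'I_n -> 'I_(n + k)) x0 (r : R)
    (Phi : 'rV[R]_n -> 'M[R]_N) (om : 'rV[R]_n -> 'M[R]_n) :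
  injective sg -> 0 < r -> smooth_on (ball x0 r) Phi -> smooth_on (ball x0 r) om ->
  (forall x, ball x0 r x -> [/\ lorentz_group (Phi x), om x \in unitmx &
    forall l j b, mc Phi l x (lshift (n + k) j) (nidx b) = om x j l *+ (b == sg j)]) ->
  exists (d : R) (U : set 'rV[R]_n) (psi phi : 'rV[R]_n -> 'rV[R]_n),
  [/\ 0 < d, open U, U x0 & U `<=` ball x0 r] /\
  [/\ smooth_on U psi, smooth_on (ball (psi x0) d) phi,
      forall y, ball (psi x0) d y -> U (phi y) /\ psi (phi y) = y,
      forall x, U x -> ball (psi x0) d (psi x) /\ phi (psi x) = x &
      forall y, ball (psi x0) d y -> forall l j b,
        mc (Phi \o phi) l y (lshift (n + k) j) (nidx b) = ((l == j) && (b == sg j))%:R].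
Proof.
move=> sg_inj r0 sPhi som H; set B := ball x0 r in sPhi som H *.
have oB : open B by exact: ball_open.
have lPhi x : B x -> lorentz_group (Phi x) by move=> /H[].
have omE l j x : B x -> om x j l = mc Phi l x (lshift (n + k) j) (nidx (sg j)).
  by move=> /H[_ _ ->]; rewrite eqxx.
have som' j l : smooth_on B (fun x => om x j l) by have /(smooth_mxP _ oB) := som.
have dom j p q x : B x -> pd p (fun x1 => om x1 j q) x
    = pd p (mc Phi q) x (lshift (n + k) j) (nidx (sg j)).
  move=> Bx; rewrite (partial_mxE p _ _ (smooth_differentiable (smooth_mc oB sPhi q) Bx)).
  by apply: (partial_eq_on p oB _ Bx) => x1; exact: omE.
(* A nonzero entry of the tangent-normal block meets only a diagonal entry of the other factor,
   which vanishes by skewness. *)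
have prod0 j p q x : B x ->
    (mc Phi p x *m mc Phi q x) (lshift (n + k) j) (nidx (sg j)) = 0.
  move=> Bx; have [_ _ E] := H x Bx; rewrite mxE big_split_ord/= big1 ?add0r => [|l _].
    rewrite big1// => b _; rewrite -/(nidx b) E.
    by case: eqP => [->|_]; rewrite ?mul0r// (mc_diag oB sPhi)// mulr0.
  rewrite E (inj_eq sg_inj); case: eqP => [->|_]; last by rewrite mulr0.
  by rewrite (mc_diag oB sPhi)// mul0r.
have closed j p q x : B x -> pd p (fun x1 => om x1 j q) x = pd q (fun x1 => om x1 j p) x.
  move=> Bx; apply/eqP; rewrite -subr_eq0 !dom// -mxBE (maurer_cartan oB sPhi)//.
  by rewrite mxBE !prod0// subrr.
pose psi x : 'rV[R]_n := \row_j homotopy x0 (fun l x1 => om x1 j l) x.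
have spsi : smooth_on B psi.
  by apply: smooth_matrix => // a j; exact: homotopy_smooth.
have jacE x : B x -> jac psi x = (om x)^T.
  move=> Bx; apply/matrixP => i j; rewrite mxE [RHS]mxE.
  rewrite (partial_mxE i 0 j (smooth_differentiable spsi Bx)).
  rewrite -(@poincare _ _ x0 r (fun l x1 => om x1 j l))//; last by move=> a b y; exact: closed.
  by apply: (partial_eq_on i oB _ Bx) => x1 _; rewrite mxE.
have Bx0 : B x0 by exact: ballxx.
have [|d [U [phi [[d0 oU Ux0 UB] [sphi h1 h2 h3]]]]] := inverse_function oB Bx0 spsi.
  by rewrite jacE// unitmx_tr; have [] := H x0 Bx0.
exists d, U, psi, phi; split=> //; split=> //; first exact: smooth_on_subset spsi.
set D := ball (psi x0) d in sphi h1 h2 *; have oD : open D by exact: ball_open.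
move=> y Dy l j b; have [Upy psiK] := h1 y Dy; have Bpy := UB _ Upy.
have dphi := smooth_differentiable sphi Dy.
have dPhi := smooth_differentiable sPhi Bpy.
have jj : jac phi y *m jac psi (phi y) = 1%:M.
  have dpsi := smooth_differentiable spsi Bpy.
  apply/matrixP => p q; rewrite mxE.
  have := partial_comp_mx p dphi dpsi.
  rewrite (@partial_eq_on R n _ D _ id p y)//; last by move=> y1 /h1[].
  move=> /rowP/(_ q); rewrite summxE => h.
  rewrite [RHS]mxE; under eq_bigr do rewrite [jac _ _ _ _]mxE [jac psi _ _ _]mxE.
  transitivity (pd p id y 0 q).
    by rewrite h; apply: eq_bigr => a _; rewrite mxE.
  by rewrite pdD derive_id mxE eqxx eq_sym.
rewrite /mc (partial_comp_mx l dphi dPhi) mulmx_sumr summxE.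
under eq_bigr do rewrite -scalemxAr mxE.
have [_ _ E] := H _ Bpy.
transitivity (\sum_m pd l phi y 0 m * (om (phi y) j m *+ (b == sg j))).
  by apply: eq_bigr => m _; rewrite -E.
have /matrixP/(_ l j) := jj; rewrite jacE// mxE [RHS]mxE => jjE.
case: (b == sg j); last by rewrite andbF big1 // => m _; rewrite mulr0n mulr0.
by rewrite andbT -jjE; apply: eq_bigr => m _; rewrite mulr1n [jac _ _ _ _]mxE [_^T _ _]mxE.
Qed.

End AdaptedCoordinates.

(** * The system associated with adapted co-ordinates *)

Section BasisAlgebra.
Context {R : realType} {n k : nat}.
Local Notation N := (n + (n + k))%N.

Lemma mxNE p q (A : 'M[R]_(p, q)) s t : (- A) s t = - A s t.
Proof. by rewrite mxE. Qed.

Lemma mxZE p q c (A : 'M[R]_(p, q)) s t : (c *: A) s t = c * A s t.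
Proof. by rewrite mxE. Qed.

Lemma mulmx_deltaE p q r (A : 'M[R]_(p, q)) a (b : 'I_r) s t :
  (A *m delta_mx a b) s t = A s a *+ (t == b).
Proof.
rewrite mxE (bigD1 a)//= big1 ?addr0 => [|c /negbTE ca]; rewrite mxE.
  by rewrite eqxx/= mulr_natr.
by rewrite ca mulr0.
Qed.

Lemma delta_mulmxE p q r (A : 'M[R]_(q, r)) (a : 'I_p) b s t :
  (delta_mx a b *m A) s t = A b t *+ (s == a).
Proof.
rewrite mxE (bigD1 b)//= big1 ?addr0 => [|c /negbTE cb]; rewrite mxE.
  by rewrite eqxx andbT mulr_natl.
by rewrite cb andbF mul0r.
Qed.

Lemma lorentz_mulE m q (A : 'M[R]_(m, q)) s t :
  (lorentz R m *m A) s t = lsgn s * A s t.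
Proof. by rewrite mul_diag_mx mxE [(\row__ _) _ _]mxE. Qed.

Lemma bracket_block p q (b : 'M[R]_(p, q)) (c : 'M[R]_(q, p)) (b' : 'M[R]_(p, q)) c' :
  bracket (block_mx 0 b c 0) (block_mx 0 b' c' 0)
  = block_mx (b *m c' - b' *m c) 0 0 (c *m b' - c' *m b).
Proof.
rewrite /bracket !mulmx_block !mul0mx !mulmx0 !addr0 !add0r.
by rewrite opp_block_mx add_block_mx !oppr0 !addr0.
Qed.

Lemma bracket_diag p q (a : 'M[R]_p) (d : 'M[R]_q) a' d' :
  bracket (block_mx a 0 0 d) (block_mx a' 0 0 d') = block_mx (bracket a a') 0 0 (bracket d d').
Proof.
rewrite /bracket !mulmx_block !mul0mx !mulmx0 !addr0 !add0r.
by rewrite opp_block_mx add_block_mx !oppr0 !addr0.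
Qed.

Variable sg : 'I_n -> 'I_(n + k).

(** Covers a_i (slots [lshift k i], k >= 1) and b_i (slots [kidx k i]) at once; the sign of the slot
    enters through [pmat]. *)
Definition ebasis i : 'M[R]_N := pmat (delta_mx i (sg i)).

(** [kap] and [tau] are the blocks in o(n) and o(n+k-1,1) of the bracket of the i-th basis element
    with [pmat xi]. *)
Definition kap i (xi : 'M[R]_(n, n + k)) : 'M[R]_n := \matrix_(p, q)
  (lsgn (sg i) * (xi p (sg i) *+ (q == i) - xi q (sg i) *+ (p == i))).

Definition tau i (xi : 'M[R]_(n, n + k)) : 'M[R]_(n + k) := \matrix_(a, b)
  (lsgn a * (xi i a *+ (b == sg i) - xi i b *+ (a == sg i))).

Lemma bracket_ebasis i xi : bracket (ebasis i) (pmat xi) = block_mx (kap i xi) 0 0 (tau i xi).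
Proof.
have JD : lorentz R (n + k) *m (delta_mx i (sg i))^T = lsgn (sg i) *: delta_mx (sg i) i.
  apply/matrixP => s t; rewrite trmx_delta lorentz_mulE !mxE.
  by case: eqVneq => [->|_] //=; rewrite !mulr0.
rewrite bracket_block JD; congr block_mx; apply/matrixP => a b; rewrite mxBE.
  rewrite !mulmxN !mxNE delta_mulmxE lorentz_mulE [xi^T _ _]mxE.
  by rewrite -scalemxAr mxZE mulmx_deltaE [RHS]mxE opprK addrC mulrBr -[in LHS]mulrnAr.
rewrite !mulNmx !mxNE -scalemxAl mxZE delta_mulmxE mulmx_deltaE lorentz_mulE [xi^T _ _]mxE.
rewrite [RHS]mxE opprK addrC mulrBr -mulrnAr; congr (_ - _).
case: eqVneq => [->|_]; first by rewrite !mulr1n.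
by rewrite !mulr0n !mulr0.
Qed.

Lemma bracket_ebasis_eq0 i j : injective sg -> bracket (ebasis i) (ebasis j) = 0.
Proof.
move=> sg_inj; rewrite bracket_ebasis -[RHS](@block_mx0 _ n (n + k) n (n + k)).
congr block_mx; apply/matrixP => a b; rewrite !mxE.
  rewrite !(inj_eq sg_inj); have [->|ij] := eqVneq i j; last by rewrite !andbF !mul0rn subrr mulr0.
  by case: (a == j); case: (b == j); rewrite /= ?mulr0n ?mul0rn ?mulr1n ?subrr ?mulr0.
have [->|ij] := eqVneq i j; last by rewrite !mul0rn subrr mulr0.
by case: (a == _); case: (b == _); rewrite /= ?mulr0n ?mul0rn ?mulr1n ?subrr ?mulr0.
Qed.

Lemma jacobi m (x y z : 'M[R]_m) : bracket x y = 0 ->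
  bracket x (bracket y z) = bracket y (bracket x z).
Proof.
rewrite /bracket => /eqP; rewrite subr_eq0 => /eqP xy.
have abel (a b c d : 'M[R]_m) : a - b - (c - d) = a - c - (b - d).
  by rewrite !opprB addrACA [- b - c]addrC addrACA.
by rewrite !mulmxBr !mulmxBl !mulmxA xy -[z *m y *m x]mulmxA -xy mulmxA abel.
Qed.

End BasisAlgebra.

(** * Structure equations in adapted co-ordinates *)

Section AdaptedFrame.
Context {R : realType} {n k : nat}.
Local Notation N := (n + (n + k))%N.
Implicit Types (x : 'rV[R]_n).
Variables (D : set 'rV[R]_n) (Phi : 'rV[R]_n -> 'M[R]_N) (sg : 'I_n -> 'I_(n + k)).
Hypotheses (oD : open D) (sPhi : smooth_on D Phi).
Hypothesis lPhi : forall x, D x -> lorentz_group (Phi x).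
Hypothesis sg_inj : injective sg.
Hypothesis mcE : forall x, D x -> forall l j b,
  mc Phi l x (lshift (n + k) j) (nidx b) = ((l == j) && (b == sg j))%:R.
Hypothesis parallel_compl : forall x, D x -> forall l b c,
  (forall i, sg i != b) -> (forall i, sg i != c) -> mc Phi l x (nidx b) (nidx c) = 0.

(** Row [sg j] of [tau] at index j is, up to the sign of the slot, row j of xi; this reads xi off
    from the normal connection of u_j along x_j. *)
Definition xi_of x : 'M[R]_(n, n + k) :=
  \matrix_(j, a) (- lsgn (sg j) * mc Phi j x (nidx (sg j)) (nidx a)).

Lemma smooth_xi_of : smooth_on D xi_of.
Proof.
apply: smooth_matrix => // j a; apply: smoothM => //; first exact: smooth_cst.
by have /(smooth_mxP _ oD) := smooth_mc oD sPhi j; apply.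
Qed.

Lemma mc_mulE x p q j b : D x -> (mc Phi q x *m mc Phi p x) (lshift (n + k) j) (nidx b)
  = mc Phi q x (lshift (n + k) j) (lshift (n + k) p) *+ (b == sg p)
    + mc Phi p x (nidx (sg j)) (nidx b) *+ (q == j).
Proof.
move=> Dx; rewrite mxE big_split_ord/=; congr (_ + _).
  rewrite (bigD1 p)//= big1 ?addr0 => [|l /negbTE lp]; rewrite mcE//.
    by rewrite eqxx mulr_natr.
  by rewrite eq_sym lp mulr0.
rewrite (bigD1 (sg j))//= big1 ?addr0 => [|c /negbTE cj]; rewrite -/(nidx _) mcE//.
  by rewrite eqxx andbT mulr_natl.
by rewrite cj andbF mul0r.
Qed.

(** The tangent-normal block is constant in these co-ordinates, so its Maurer-Cartan equation has no
    derivatives and is a linear relation between entries of the k-part. *)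
Lemma structure_eq x p q j b : D x ->
  mc Phi q x (lshift (n + k) j) (lshift (n + k) p) *+ (b == sg p)
    + mc Phi p x (nidx (sg j)) (nidx b) *+ (q == j)
  = mc Phi p x (lshift (n + k) j) (lshift (n + k) q) *+ (b == sg q)
    + mc Phi q x (nidx (sg j)) (nidx b) *+ (p == j).
Proof.
move=> Dx; rewrite -!mc_mulE//; apply/eqP; rewrite -subr_eq0 -mxBE.
rewrite -(maurer_cartan oD sPhi lPhi p q Dx) mxBE.
have d0 a c : pd a (mc Phi c) x (lshift (n + k) j) (nidx b) = 0.
  rewrite (partial_mxE a _ _ (smooth_differentiable (smooth_mc oD sPhi c) Dx)).
  rewrite (partial_eq_on a oD (fun x1 Dx1 => mcE Dx1 c j b) Dx).
  exact: partial_cst.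
by rewrite !d0 subrr.
Qed.

Lemma mc_nskew x l a b : D x ->
  lsgn a * mc Phi l x (nidx a) (nidx b) = - (lsgn b * mc Phi l x (nidx b) (nidx a)).
Proof.
by move=> Dx; have := mc_skew oD sPhi lPhi l (nidx a) (nidx b) Dx; rewrite !lsgn_nidx.
Qed.

Lemma mc_lskew x l p q : D x -> mc Phi l x (lshift (n + k) p) (lshift (n + k) q)
  = - mc Phi l x (lshift (n + k) q) (lshift (n + k) p).
Proof.
by move=> Dx; have := mc_skew oD sPhi lPhi l (lshift _ p) (lshift _ q) Dx; rewrite !lsgn_lshift !mul1r.
Qed.

(** The relation with j = p, where one term is a diagonal entry. *)
Lemma mc_curvature x p q b : D x -> p != q -> mc Phi q x (nidx (sg p)) (nidx b)
  = - (mc Phi p x (lshift (n + k) p) (lshift (n + k) q) *+ (b == sg q)).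
Proof.
move=> Dx pq; have := structure_eq p q p b Dx.
rewrite (mc_diag oD sPhi lPhi)// [q == p]eq_sym (negbTE pq) eqxx mul0rn mulr0n addr0 mulr1n.
by move=> /eqP; rewrite eq_sym addrC addr_eq0 => /eqP.
Qed.

Lemma mc_rotation x p q j : D x -> p != q -> j != p -> j != q ->
  mc Phi p x (lshift (n + k) j) (lshift (n + k) q) = 0.
Proof.
move=> Dx pq jp jq; have := structure_eq p q j (sg q) Dx.
rewrite eqxx (inj_eq sg_inj) [q == p]eq_sym (negbTE pq) ![_ == j]eq_sym.
by rewrite (negbTE jp) (negbTE jq) !mulr0n mulr1n !addr0.
Qed.

(** Entries in row or column [sg i] agree by the choice of xi and skewness. Those in a row or column
    [sg p] with p different from i vanish by the structure equations, and the remaining ones because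
    the complement frame is parallel. *)
Lemma mc_tau x i a b : D x -> mc Phi i x (nidx a) (nidx b) = tau sg i (xi_of x) a b.
Proof.
move=> Dx; rewrite [RHS]mxE ![xi_of x _ _]mxE.
have [ai|ai] := eqVneq a (sg i).
  rewrite ai; have [->|bi] := eqVneq b (sg i).
    by rewrite subrr mulr0 (mc_diag oD sPhi lPhi).
  by rewrite mulr0n mulr1n sub0r mulNr opprK mulrA lsgn_sqr mul1r.
have [->|bi] := eqVneq b (sg i).
  by rewrite mulr1n mulr0n subr0 mulNr mc_nskew// opprK mulrA lsgn_sqr mul1r.
rewrite !mulr0n subrr mulr0.
have [/existsP[p /eqP pa]|/existsPn ha] := boolP [exists p, sg p == a].
  have pi : p != i by apply: contra_neq ai => <-.
  by rewrite -pa mc_curvature// (negbTE bi) mulr0n oppr0.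
have [/existsP[p /eqP pb]|/existsPn hb] := boolP [exists p, sg p == b].
  have pi : p != i by apply: contra_neq bi => <-.
  have : lsgn a * mc Phi i x (nidx a) (nidx b) = 0.
    by rewrite mc_nskew// -pb mc_curvature// (negbTE ai) mulr0n oppr0 mulr0 oppr0.
  by move=> /eqP; rewrite mulf_eq0 (negbTE (lsgn_neq0 a)) => /eqP.
exact: parallel_compl.
Qed.

Lemma mc_kap x i p q : D x ->
  mc Phi i x (lshift (n + k) p) (lshift (n + k) q) = kap sg i (xi_of x) p q.
Proof.
move=> Dx; wlog qi : p q / p != i => [hw|].
  have [pi|] := eqVneq p i; last exact: hw.
  have [qi|qi] := eqVneq q i.
    by rewrite pi qi (mc_diag oD sPhi lPhi)// [RHS]mxE subrr mulr0.
  by rewrite mc_lskew// hw// ![kap _ _ _ _ _]mxE -mulrN opprB.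
rewrite [RHS]mxE (negbTE qi) mulr0n subr0; have [->|iq] := eqVneq q i; last first.
  rewrite mulr0n mulr0; have [->|pq] := eqVneq p q; first exact: (mc_diag oD sPhi lPhi).
  by rewrite mc_rotation// eq_sym.
rewrite mulr1n [xi_of _ _ _]mxE mulNr -mc_nskew// mulrA lsgn_sqr mul1r.
by rewrite mc_curvature 1?eq_sym// eqxx mulr1n -mc_lskew.
Qed.

Theorem mc_bracket x i : D x ->
  mc Phi i x = ebasis sg i + bracket (ebasis sg i) (pmat (xi_of x)).
Proof.
move=> Dx; rewrite bracket_ebasis add_block_mx add0r !addr0 add0r -[LHS]submxK.
congr block_mx; apply/matrixP => a b; rewrite [LHS]mxE [LHS]mxE.
- exact: mc_kap.
- by rewrite mcE// mxE; case: (eqVneq a i) => [->|]; rewrite // eq_sym.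
- rewrite mxNE lorentz_mulE [_^T _ _]mxE [delta_mx _ _ _ _]mxE.
  apply: (mulfI (lsgn_neq0 a : lsgn a != 0 :> R)).
  rewrite -[in LHS]lsgn_nidx (mc_skew oD sPhi lPhi)// lsgn_lshift mul1r mcE//.
  by rewrite mulrN mulrA lsgn_sqr mul1r; case: (eqVneq i b) => [->|]; rewrite // mulr0n oppr0.
- exact: mc_tau.
Qed.

Lemma differentiable_block p q p' q' (A : 'rV[R]_n -> 'M[R]_(p, q)) (B : 'rV[R]_n -> 'M[R]_(p, q'))
    (C : 'rV[R]_n -> 'M[R]_(p', q)) (E : 'rV[R]_n -> 'M[R]_(p', q')) i x :
  differentiable A x -> differentiable B x -> differentiable C x -> differentiable E x ->
  differentiable (fun x1 => block_mx (A x1) (B x1) (C x1) (E x1)) x /\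
  pd i (fun x1 => block_mx (A x1) (B x1) (C x1) (E x1)) x
  = block_mx (pd i A x) (pd i B x) (pd i C x) (pd i E x).
Proof.
move=> dA dB dC dE.
have H s t : differentiable (fun x1 => block_mx (A x1) (B x1) (C x1) (E x1) s t) x /\
    pd i (fun x1 => block_mx (A x1) (B x1) (C x1) (E x1) s t) x
    = block_mx (pd i A x) (pd i B x) (pd i C x) (pd i E x) s t.
  rewrite -[s]splitK -[t]splitK.
  case: (fintype.split s) => a; case: (fintype.split t) => b /=.
  - have -> : (fun x1 => block_mx (A x1) (B x1) (C x1) (E x1) (lshift p' a) (lshift q' b))
        = fun x1 => A x1 a b by apply/funext => x1; exact: block_mxEul.
    rewrite block_mxEul (partial_mxE i a b dA); split=> //.
    exact: (differentiable_mxP A x).1 dA a b.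
  - have -> : (fun x1 => block_mx (A x1) (B x1) (C x1) (E x1) (lshift p' a) (rshift q b))
        = fun x1 => B x1 a b by apply/funext => x1; exact: block_mxEur.
    rewrite block_mxEur (partial_mxE i a b dB); split=> //.
    exact: (differentiable_mxP B x).1 dB a b.
  - have -> : (fun x1 => block_mx (A x1) (B x1) (C x1) (E x1) (rshift p a) (lshift q' b))
        = fun x1 => C x1 a b by apply/funext => x1; exact: block_mxEdl.
    rewrite block_mxEdl (partial_mxE i a b dC); split=> //.
    exact: (differentiable_mxP C x).1 dC a b.
  - have -> : (fun x1 => block_mx (A x1) (B x1) (C x1) (E x1) (rshift p a) (rshift q b))
        = fun x1 => E x1 a b by apply/funext => x1; exact: block_mxEdr.
    rewrite block_mxEdr (partial_mxE i a b dE); split=> //.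
    exact: (differentiable_mxP E x).1 dE a b.
have dF : differentiable (fun x1 => block_mx (A x1) (B x1) (C x1) (E x1)) x.
  by apply/differentiable_mxP => s t; have [] := H s t.
split=> //; apply/matrixP => s t; rewrite (partial_mxE i s t dF).
by have [] := H s t.
Qed.

Definition Xi_of x : 'M[R]_N := pmat (xi_of x).

Lemma smooth_Xi_of : smooth_on D Xi_of.
Proof.
have sx := smooth_xi_of.
have sJ : smooth_on D (fun x => - (lorentz R (n + k) *m (xi_of x)^T)).
  apply: smooth_mxN => //; apply: smooth_mulmx => //; first exact: smooth_mx_cst.
  exact: smooth_trmx.
apply/smooth_mxP => // s t; rewrite -[s]splitK -[t]splitK.
case: (fintype.split s) => a; case: (fintype.split t) => b /=.
- apply: (@smooth_on_eq _ _ _ (fun=> 0)) => //; last exact: smooth_cst.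
  by move=> x _; rewrite [RHS]block_mxEul mxE.
- apply: (@smooth_on_eq _ _ _ (fun x => xi_of x a b)) => //.
    by move=> x _; rewrite [RHS]block_mxEur.
  by have /(smooth_mxP _ oD) := sx; apply.
- apply: (@smooth_on_eq _ _ _ (fun x => (- (lorentz R (n + k) *m (xi_of x)^T)) a b)) => //.
    by move=> x _; rewrite [RHS]block_mxEdl.
  by have /(smooth_mxP _ oD) := sJ; apply.
- apply: (@smooth_on_eq _ _ _ (fun=> 0)) => //; last exact: smooth_cst.
  by move=> x _; rewrite [RHS]block_mxEdr mxE.
Qed.

Lemma partial_bracket i (e : 'M[R]_N) (A : 'rV[R]_n -> 'M[R]_N) x : differentiable A x ->
  differentiable (fun x1 => bracket e (A x1)) x /\
  pd i (fun x1 => bracket e (A x1)) x = bracket e (pd i A x).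
Proof.
move=> dA; have [d1 p1] := differentiable_mulmxl e i dA.
have [d2 p2] := differentiable_mulmxr e i dA; have [d3 p3] := differentiable_mulmxl (- 1%:M) i d2.
have E : (fun x1 => bracket e (A x1)) = fun x1 => e *m A x1 + (- 1%:M) *m (A x1 *m e).
  by apply/funext => x1; rewrite mulNmx mul1mx.
rewrite E; split; first exact: differentiableD.
by rewrite partial_mxD// p1 p3 p2 mulNmx mul1mx.
Qed.

Lemma bracketDD m (a b c d : 'M[R]_m) : bracket a c = 0 -> bracket a d = bracket c b ->
  bracket (a + b) (c + d) = bracket b d.
Proof.
rewrite /bracket => /eqP; rewrite subr_eq0 => /eqP ac h.
rewrite !mulmxDl !mulmxDr ac; have := h.
have abel (p q r s t u v : 'M[R]_m) : q - r = s - t ->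
    p + q + (t + u) - (p + s + (r + v)) = u - v.
  by move=> /matrixP qr; apply/matrixP => y z; have := qr y z; rewrite !mxE; lra.
by move=> /abel ->.
Qed.

(** In the Maurer-Cartan equation the bracket of the two basis elements is 0 and the mixed brackets
    cancel by Jacobi, so only the bracket of the two k-parts survives. *)
Lemma system_eq i j x : D x -> i != j ->
  bracket (ebasis sg i) (pd j Xi_of x) - bracket (ebasis sg j) (pd i Xi_of x)
  - bracket (bracket (ebasis sg i) (Xi_of x)) (bracket (ebasis sg j) (Xi_of x)) = 0.
Proof.
move=> Dx ij; have dX x1 : D x1 -> differentiable Xi_of x1.
  by apply: smooth_differentiable; exact: smooth_Xi_of.
have E a b : pd a (mc Phi b) x = bracket (ebasis sg b) (pd a Xi_of x).
  rewrite (partial_eq_on a oD (fun x1 => @mc_bracket x1 b) Dx).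
  have [d1 <-] := partial_bracket a (ebasis sg b) (dX x Dx).
  by rewrite partial_mxD ?partial_cst ?add0r//; exact: differentiable_cst.
rewrite -!E (maurer_cartan oD sPhi lPhi)// -/(bracket _ _) !mc_bracket//.
have e0 := @bracket_ebasis_eq0 R n k sg i j sg_inj.
by rewrite (bracketDD e0 (jacobi (Xi_of x) e0)) subrr.
Qed.

Lemma xi_of_diag i x : D x -> xi_of x i (sg i) = 0.
Proof. by move=> Dx; rewrite mxE (mc_diag oD sPhi lPhi)// mulr0. Qed.

Lemma smooth_entries p q (f : 'I_p -> 'I_N) (g : 'I_q -> 'I_N) (A : 'rV[R]_n -> 'M[R]_N)
    (B : 'rV[R]_n -> 'M[R]_(p, q)) : smooth_on D A ->
  (forall x, D x -> forall a b, B x a b = A x (f a) (g b)) -> smooth_on D B.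
Proof.
move=> sA AB; apply/smooth_mxP => // a b.
apply: (@smooth_on_eq _ _ _ (fun x1 => A x1 (f a) (g b))) => //.
  by move=> x1 Dx1; rewrite AB.
by have /(smooth_mxP _ oD) := sA; apply.
Qed.

Lemma partial_entries p q (f : 'I_p -> 'I_N) (g : 'I_q -> 'I_N) (A : 'rV[R]_n -> 'M[R]_N)
    (B : 'rV[R]_n -> 'M[R]_(p, q)) i x a b : D x -> smooth_on D A ->
  (forall x, D x -> forall a b, B x a b = A x (f a) (g b)) ->
  pd i B x a b = pd i A x (f a) (g b).
Proof.
move=> Dx sA AB; have sB := smooth_entries sA AB.
rewrite (partial_mxE i a b (smooth_differentiable sB Dx)).
rewrite (partial_mxE i _ _ (smooth_differentiable sA Dx)).
by apply: (partial_eq_on i oD _ Dx) => x1 Dx1; rewrite AB.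
Qed.

Lemma smooth_kap i : smooth_on D (fun x => kap sg i (xi_of x)).
Proof.
by apply: smooth_entries (smooth_mc oD sPhi i) _ => x Dx a b; symmetry; exact: mc_kap.
Qed.

Lemma smooth_tau i : smooth_on D (fun x => tau sg i (xi_of x)).
Proof.
by apply: smooth_entries (smooth_mc oD sPhi i) _ => x Dx a b; symmetry; exact: mc_tau.
Qed.

(** The system is block diagonal; its two blocks are the integrability conditions for g_1 and
    g_2. *)
Lemma connection_flat i j x : D x ->
  pd j (fun x1 => kap sg i (xi_of x1)) x - pd i (fun x1 => kap sg j (xi_of x1)) x
  = bracket (kap sg i (xi_of x)) (kap sg j (xi_of x)) /\
  pd j (fun x1 => tau sg i (xi_of x1)) x - pd i (fun x1 => tau sg j (xi_of x1)) x
  = bracket (tau sg i (xi_of x)) (tau sg j (xi_of x)).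
Proof.
move=> Dx; have [<-|ij] := eqVneq i j; first by rewrite /bracket !subrr.
pose B l x1 := bracket (ebasis sg l) (Xi_of x1).
have sB l : smooth_on D (B l).
  apply: (@smooth_mx_eq _ _ _ _ _ (fun x1 => mc Phi l x1 - ebasis sg l)) => //.
    by move=> x1 Dx1; rewrite mc_bracket// addrC addKr.
  by apply: smooth_mxB => //; [exact: smooth_mc|exact: smooth_mx_cst].
have dXi := smooth_differentiable smooth_Xi_of Dx.
have := system_eq Dx ij.
have [_ <-] := partial_bracket j (ebasis sg i) dXi; have [_ <-] := partial_bracket i (ebasis sg j) dXi.
move/eqP; rewrite subr_eq0 => /eqP; rewrite -/(B i) -/(B j).
rewrite ![in RHS]bracket_ebasis bracket_diag => h.
have K l m a b : pd l (fun x1 => kap sg m (xi_of x1)) x a b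
    = pd l (B m) x (lshift _ a) (lshift _ b).
  by apply: partial_entries => // x1 Dx1 c d; rewrite /B bracket_ebasis block_mxEul.
have T l m a b : pd l (fun x1 => tau sg m (xi_of x1)) x a b
    = pd l (B m) x (rshift _ a) (rshift _ b).
  by apply: partial_entries => // x1 Dx1 c d; rewrite /B bracket_ebasis block_mxEdr.
split; apply/matrixP => a b; rewrite mxBE.
  by rewrite !K -mxBE h block_mxEul.
by rewrite !T -mxBE h block_mxEdr.
Qed.

Lemma kap_skew i (xi : 'M[R]_(n, n + k)) : (kap sg i xi)^T = - kap sg i xi.
Proof. by apply/matrixP => a b; rewrite !mxE -mulrN opprB. Qed.

Lemma tau_skew i (xi : 'M[R]_(n, n + k)) :
  tau sg i xi *m lorentz R (n + k) + lorentz R (n + k) *m (tau sg i xi)^T = 0.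
Proof.
apply/matrixP => a b; rewrite mxE mul_mx_diag lorentz_mulE 2!mxE [_^T _ _]mxE.
rewrite [tau sg i xi b a]mxE [(\row__ _) _ _]mxE [RHS]mxE -/(lsgn b).
by ring.
Qed.

(** Each block is integrated separately, starting from the identity; skewness of [kap] and [tau]
    keeps the solutions in the two groups. *)
Lemma gauge_exists q (r0 : R) : 0 < r0 -> ball q r0 `<=` D ->
  exists2 r : R, 0 < r <= r0 & exists g1 g2,
    trivializing_gauge (ball q r) (ebasis sg) Xi_of g1 g2.
Proof.
move=> r00 BD.
have [|i j x Bx|r1 /andP[r10 r1r] [g1 [sg1 g10 dg1]]] := @frobenius R n n q r0
    (fun i x => kap sg i (xi_of x)) r00.
- by move=> i; apply: smooth_on_subset (smooth_kap i).
- by have [-> _] := connection_flat i j (BD _ Bx).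
have [|i j x Bx|r2 /andP[r20 r2r] [g2 [sg2 g20 dg2]]] := @frobenius R n (n + k) q r0
    (fun i x => tau sg i (xi_of x)) r00.
- by move=> i; apply: smooth_on_subset (smooth_tau i).
- by have [_ ->] := connection_flat i j (BD _ Bx).
pose r := Num.min r1 r2; have r_gt0 : 0 < r by rewrite lt_min r10.
have b1 : ball q r `<=` ball q r1 by apply: le_ball; rewrite ge_min lexx.
have b2 : ball q r `<=` ball q r2 by apply: le_ball; rewrite ge_min lexx orbT.
exists r; first by rewrite r_gt0 ge_min r1r.
exists g1, g2.
have oB : open (ball q r) by exact: ball_open.
have {}sg1 : smooth_on (ball q r) g1 by exact: smooth_on_subset sg1.
have {}sg2 : smooth_on (ball q r) g2 by exact: smooth_on_subset sg2.
have qq : ball q r q by exact: ballxx.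
have dif1 x : ball q r x -> differentiable g1 x by exact: smooth_differentiable.
have dif2 x : ball q r x -> differentiable g2 x by exact: smooth_differentiable.
have G x : ball q r x -> orthogonal_group (g1 x) /\ lorentz_group (g2 x).
  move=> Bx; split.
    apply: mulmx1C; have /= -> := @constant_on_ball R n n n (fun x1 => g1 x1 *m (g1 x1)^T) q r _ _ x Bx.
    + by rewrite g10 trmx1 mulmx1.
    + by apply: smooth_mulmx => //; exact: smooth_trmx.
    + move=> l y By; have [d1 p1] := partial_trmx l (dif1 y By).
      rewrite (partialMmx l (dif1 y By) d1) p1 (dg1 _ (b1 _ By)).
      by rewrite trmx_mul kap_skew mulNmx mulmxN -mulmxA subrr.
  (* The equation dg = g tau preserves g I g^T; the relation g^T I g = I follows since one-sided
     inverses of square matrices are two-sided. *)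
  have h : g2 x *m lorentz R (n + k) *m (g2 x)^T = lorentz R (n + k).
    have /= -> := @constant_on_ball R n _ _ (fun x1 => g2 x1 *m lorentz R (n + k) *m (g2 x1)^T) q r _ _ x Bx.
    + by rewrite g20 trmx1 mulmx1 mul1mx.
    + apply: smooth_mulmx => //; last exact: smooth_trmx.
      by apply: smooth_mulmx => //; exact: smooth_mx_cst.
    + move=> l y By; have [d1 p1] := partial_trmx l (dif2 y By).
      have [d2 p2] := differentiable_mulmxr (lorentz R (n + k)) l (dif2 y By).
      rewrite (partialMmx l d2 d1) p1 p2 (dg2 _ (b2 _ By)) trmx_mul.
      rewrite -!mulmxA -mulmxDr !mulmxA -mulmxDl.
      by rewrite tau_skew mul0mx mulmx0.
  have : lorentz R (n + k) *m (g2 x)^T *m lorentz R (n + k) *m g2 x = 1%:M.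
    by apply: mulmx1C; rewrite !mulmxA h lorentz_sqr.
  move/(congr1 (mulmx (lorentz R (n + k)))); rewrite !mulmxA lorentz_sqr mul1mx mulmx1.
  by [].
split=> // x Bx i; rewrite pdE.
have [_ ->] := @differentiable_block _ _ _ _ g1 (fun=> 0) (fun=> 0) g2 i x (dif1 x Bx)
  (differentiable_cst _ _) (differentiable_cst _ _) (dif2 x Bx).
rewrite !partial_cst (dg1 _ (b1 _ Bx)) (dg2 _ (b2 _ Bx)) bracket_ebasis.
have -> : block_mx (g1 x *m kap sg i (xi_of x)) 0 0 (g2 x *m tau sg i (xi_of x))
   = block_mx (g1 x) 0 0 (g2 x) *m block_mx (kap sg i (xi_of x)) 0 0 (tau sg i (xi_of x)).
  by rewrite mulmx_block !mul0mx !mulmx0 !addr0 !add0r.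
rewrite mulKmx// unitmxE det_ublock unitrM -!unitmxE.
have [orth1 /lorentz_unit ->] := G x Bx; rewrite andbT.
by have [] := mulmx1_unit orth1.
Qed.

Lemma frame_coord (x : 'rV[R]_n) (y : 'cV[R]_N) : D x ->
  (forall l, mink (frame_e Phi l x) y = 0) -> y = Phi x *m col_mx 0 (dsubmx (linv (Phi x) *m y)).
Proof.
move=> Dx ye; rewrite -[LHS]mul1mx -(linvKr (lPhi Dx)) -mulmxA; congr (_ *m _).
rewrite -[LHS]vsubmxK; congr col_mx; apply/colP => l; rewrite mxE linv_mulE.
by rewrite [RHS]mxE (_ : mink _ _ = 0) ?mulr0// -[RHS](ye l); congr mink; apply/colP => s; rewrite !mxE.
Qed.

(** Differentiate (e_l, s) = 0: the normal part of d_i e_l is a multiple of u_l, and is zero unless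
    i = l. *)
Lemma frame_deriv (s : 'rV[R]_n -> 'cV[R]_N) i l x : D x -> differentiable s x ->
  (forall x1, D x1 -> forall j, mink (frame_e Phi j x1) (s x1) = 0) ->
  mink (frame_e Phi l x) (pd i s x)
  = (lsgn (sg l) * mink (frame_u Phi (sg l) x) (s x)) *+ (i == l).
Proof.
move=> Dx ds se; have dP := smooth_differentiable sPhi Dx.
have [d1 p1] := differentiable_mulmxr (delta_mx (lshift (n + k) l) 0 : 'cV_N) i dP.
have := partial_mink i d1 ds.
rewrite (@partial_eq_on R n _ D _ (fun=> 0) i x)//; last first.
  by move=> x1 Dx1; rewrite -colE; exact: se.
rewrite partial_cst p1 -!colE -/(frame_e Phi l x) => /eqP.
rewrite eq_sym addrC addr_eq0 => /eqP ->.
rewrite (frame_mc lPhi)// colE -mulmxA -colE mink_mulmxl big_split_ord/=.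
rewrite big1 ?add0r => [|j _]; last by rewrite -/(frame_e Phi j x) se// mulr0.
have E b : mc Phi i x (nidx b) (lshift (n + k) l) = - (lsgn b *+ ((i == l) && (b == sg l))).
  apply: (mulfI (lsgn_neq0 (nidx b : 'I_N) : lsgn _ != 0 :> R)).
  rewrite (mc_skew oD sPhi lPhi)// lsgn_lshift mul1r mcE// lsgn_nidx.
  by rewrite mulrN mulrnAr lsgn_sqr.
under eq_bigr do rewrite mxE -/(nidx _) E -/(frame_u Phi _ x).
rewrite (bigD1 (sg l))//= big1 ?addr0 => [|b /negbTE bl]; last by rewrite bl andbF oppr0 mul0r.
by rewrite eqxx andbT mulNr opprK mulrnAl.
Qed.

(** * The lift in the adapted frame *)

Variables (X : 'rV[R]_n -> 'cV[R]_N) (w : 'I_n -> 'rV[R]_n -> 'cV[R]_N).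
Variable rho : 'I_n -> 'rV[R]_n -> R.
Hypothesis sX : smooth_on D X.
Hypothesis X_cone : forall x, D x -> light_cone (X x).
Hypothesis Xe : forall x, D x -> forall l, mink (frame_e Phi l x) (X x) = 0.
Hypothesis Xu : forall x, D x -> forall b l, mink (frame_u Phi b x) (pd l X x) = 0.
Hypothesis wu : forall x, D x -> forall i, w i x = rho i x *: frame_u Phi (sg i) x.
Hypothesis Xw : forall x, D x -> forall i, mink (X x) (w i x) = -1.

(** The factor in d_l X = mu_l e_l. Since (X, w_l) = -1, it is 1/|v_l| up to sign, hence nonzero. *)
Let mu l x : R := lsgn (sg l) * mink (frame_u Phi (sg l) x) (X x).

Lemma rho_mu l x : D x -> rho l x * mu l x = - lsgn (sg l).
Proof.
by move=> Dx; have := Xw Dx l; rewrite wu// minkZr minkC mulrCA => ->; rewrite mulrN1.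
Qed.

Lemma mu_neq0 l x : D x -> mu l x != 0.
Proof.
move=> Dx; apply: contraTneq isT => m0; have := rho_mu l Dx.
by rewrite m0 mulr0 => /eqP; rewrite eq_sym oppr_eq0 (negbTE (lsgn_neq0 _)).
Qed.

Lemma pd_lift l x : D x -> pd l X x = mu l x *: frame_e Phi l x.
Proof.
move=> Dx; have dX := smooth_differentiable sX Dx.
rewrite -[LHS]mul1mx -(linvKr (lPhi Dx)) -mulmxA.
rewrite (_ : linv (Phi x) *m pd l X x = mu l x *: delta_mx (lshift (n + k) l) 0).
  by rewrite -scalemxAr -colE.
apply/colP => s; rewrite linv_mulE col_id mxZE mxE eqxx andbT.
rewrite -[s]splitK; case: (fintype.split s) => [j|b] /=.
  rewrite lsgn_lshift mul1r -/(frame_e Phi j x) frame_deriv//.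
  by rewrite (inj_eq (@lshift_inj _ _)) eq_sym mulr_natr; case: eqVneq => [->|].
rewrite -/(nidx b) -/(frame_u Phi b x) Xu// mulr0; case: eqP; rewrite ?mulr0// => h.
by have := congr1 (@fintype.split n (n + k)) h; rewrite split_l split_r.
Qed.

Lemma normal_frameP x y : D x ->
  (forall l, mink (frame_e Phi l x) y = 0) <-> Defs.normal_space X x y.
Proof.
move=> Dx; have dX := smooth_differentiable sX Dx; split=> [ye a|ny l].
  rewrite deriv_partial// mink_sumr big1// => l _.
  by rewrite minkZr pd_lift// minkZr minkC ye !mulr0.
have := ny (delta_mx 0 l); rewrite -pdD pd_lift// minkZr => /eqP.
by rewrite mulf_eq0 (negbTE (mu_neq0 l Dx)) minkC => /eqP.
Qed.

(** For a normal field s, the tangential part of d_i s is a multiple of e_i, that is of d_i X; the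
    relation [rho_mu] identifies the factor as - (s, w_i). *)
Lemma curvature_direction x i c : D x ->
  common_eigenspace D X (w i) x (c *: delta_mx 0 i).
Proof.
move=> Dx s [ss ns]; have ds := smooth_differentiable ss Dx.
have dX := smooth_differentiable sX Dx.
have DZ (h : 'rV[R]_n -> 'cV[R]_N) : differentiable h x -> 'D_(c *: delta_mx 0 i) h x = c *: pd i h x.
  move=> dh; rewrite deriv_partial// (bigD1 i)//= big1 ?addr0 => [|j /negbTE ji].
    by rewrite !mxE !eqxx mulr1.
  by rewrite !mxE ji andbF mulr0 scale0r.
have se x1 : D x1 -> forall j, mink (frame_e Phi j x1) (s x1) = 0.
  by move=> Dx1; apply/normal_frameP => //; exact: ns.
split.
  exists (mink (s x) (w i x) *: (c *: delta_mx 0 i)).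
  rewrite DZ// scalerA deriv_partial// (bigD1 i)//= big1 ?addr0 => [|j /negbTE ji].
    by rewrite !mxE !eqxx mulr1 scalerA.
  by rewrite !mxE ji andbF !mulr0 scale0r.
apply/normal_frameP => // l; rewrite !DZ// minkBr minkNr !minkZr.
rewrite !frame_deriv// wu// minkZr -/(mu l x).
have [->|_] := eqVneq i l; last by rewrite !mulr0n !mulr0 subr0 oppr0.
rewrite !mulr1n.
have := rho_mu l Dx.
move: (mu l x) (rho l x) => m r mr; rewrite (minkC (s x)).
set z := mink _ _; have -> : r * z * (c * m) = (r * m) * z * c by ring.
by rewrite mr; ring.
Qed.

Lemma principal_directions_frame : principal_directions D X w Phi.
Proof.
move=> x Dx i; exists ((mu i x)^-1 *: delta_mx 0 i); first exact: curvature_direction.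
have dX := smooth_differentiable sX Dx.
rewrite deriv_partial// (bigD1 i)//= big1 ?addr0 => [|j /negbTE ji].
  by rewrite !mxE !eqxx mulr1 pd_lift// scalerA mulVf ?mu_neq0// scale1r.
by rewrite !mxE ji andbF mulr0 scale0r.
Qed.

(** The normal component y of Phi^-1 X satisfies dy = - tau y while dg_2 = g_2 tau, so g_2 y is
    constant. It is null because X is null and both Phi and g_2 preserve the form. *)
Lemma recovers_gauge q (r : R) g1 g2 : 0 < r -> D = ball q r ->
  trivializing_gauge D (ebasis sg) Xi_of g1 g2 ->
  exists2 c : 'cV[R]_(n + k), light_cone c &
    forall x, D x -> X x = Phi x *m col_mx 0 (invmx (g2 x) *m c).
Proof.
move=> r0 DE [sg1 sg2 G dG].
pose y x := dsubmx (linv (Phi x) *m X x).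
have XE x : D x -> X x = Phi x *m col_mx 0 (y x) by move=> Dx; apply: frame_coord => // l; exact: Xe.
have sLX : smooth_on D (fun x => linv (Phi x) *m X x).
  by apply: smooth_mulmx => //; exact: smooth_linv.
have sy : smooth_on D y.
  apply/smooth_mxP => // b a; apply: (@smooth_on_eq _ _ _ (fun x => (linv (Phi x) *m X x) (nidx b) a)) => //.
    by move=> x _; rewrite [RHS]mxE.
  by have /(smooth_mxP _ oD) := sLX; apply.
(* X has only normal components y and d_l X is tangent; the normal components of d_l X read dy + tau
   y = 0. *)
have dy l x : D x -> pd l y x = - (tau sg l (xi_of x) *m y x).
  move=> Dx; apply/eqP; rewrite -addr_eq0; apply/eqP; apply/colP => b.
  have d0 := smooth_differentiable (smooth_mx_cst (0 : 'cV[R]_n) oD) Dx.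
  have dyx := smooth_differentiable sy Dx; have dP := smooth_differentiable sPhi Dx.
  have dcol : differentiable (fun x1 => col_mx (0 : 'cV[R]_n) (y x1)) x.
    apply/differentiable_mxP => s a; rewrite -[s]splitK; case: (fintype.split s) => t /=.
      have -> : (fun x1 => col_mx 0 (y x1) (lshift (n + k) t) a) = fun=> 0.
        by apply/funext => x1; rewrite col_mxEu mxE.
      exact: differentiable_cst.
    have -> : (fun x1 => col_mx 0 (y x1) (rshift n t) a) = fun x1 => y x1 t a.
      by apply/funext => x1; rewrite col_mxEd.
    exact: (differentiable_mxP y x).1 dyx t a.
  have := Xu Dx b l; rewrite (partial_eq_on l oD XE Dx) (partialMmx l dP dcol).
  rewrite (frame_mc lPhi)// -mulmxA -mulmxDr => /(congr1 ( *%R (lsgn (nidx b : 'I_N)))).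
  rewrite mulr0 -[X in mink _ X](col_id 0) -linv_mulE [linv _ *m _]mulmxA (linvK (lPhi Dx)) mul1mx mxE.
  rewrite (partial_mxE l _ _ dcol).
  have -> : (fun x1 => col_mx 0 (y x1) (nidx b) 0) = fun x1 => y x1 b 0.
    by apply/funext => x1; rewrite col_mxEd.
  move=> h; rewrite mxE addrC [RHS]mxE -[RHS]h (partial_mxE l _ _ dyx); congr (_ + _).
  rewrite [RHS]mxE big_split_ord/= big1 ?add0r => [|j _]; last by rewrite col_mxEu [X in _ * X]mxE mulr0.
  by rewrite [LHS]mxE; apply: eq_bigr => c _; rewrite col_mxEd mc_tau.
have dg2 l x : D x -> pd l g2 x = g2 x *m tau sg l (xi_of x).
  move=> Dx; have [orth1 lor2] := G x Dx; have := dG x Dx l; rewrite pdE.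
  have [_ ->] := @differentiable_block _ _ _ _ g1 (fun=> 0) (fun=> 0) g2 l x
    (smooth_differentiable sg1 Dx) (differentiable_cst _ _) (differentiable_cst _ _)
    (smooth_differentiable sg2 Dx).
  move/(congr1 (mulmx (block_mx (g1 x) 0 0 (g2 x)))); rewrite mulKVmx.
    rewrite bracket_ebasis mulmx_block !mul0mx !mulmx0 !addr0 !add0r.
    by move=> /eq_block_mx[].
  rewrite unitmxE det_ublock unitrM -!unitmxE (lorentz_unit lor2) andbT.
  by have [] := mulmx1_unit orth1.
have cst x : D x -> g2 x *m y x = g2 q *m y q.
  rewrite DE => Bx.
  apply: (@constant_on_ball R n _ _ (fun x1 => g2 x1 *m y x1) q r) => //; rewrite -DE.
    exact: smooth_mulmx.
  move=> l x1 Dx1; rewrite (partialMmx l (smooth_differentiable sg2 Dx1) (smooth_differentiable sy Dx1)).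
  by rewrite dg2// dy// mulmxN mulmxA subrr.
have Dq : D q by rewrite DE; exact: ballxx.
have g2u x : D x -> g2 x \in unitmx by move=> Dx; have [_ /lorentz_unit] := G x Dx.
exists (g2 q *m y q); last by move=> x Dx; rewrite -(cst x)// mulKmx ?g2u// -XE.
have [X0 XX] := X_cone Dq; split.
  apply: contraNneq X0 => h; rewrite XE// -[y q](mulKmx (g2u q Dq)) h mulmx0.
  by rewrite col_mx0 mulmx0.
have [_ /lorentz_groupP ->] := G q Dq.
have /lorentz_groupP P := lPhi Dq; rewrite -XX XE// P !minkE [RHS]big_split_ord/=.
rewrite [X in _ = X + _]big1 ?add0r => [|j _]; last by rewrite col_mxEu [X in _ * X]mxE mulr0.
by apply: eq_bigr => b _; rewrite col_mxEd lsgn_nidx.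
Qed.

End AdaptedFrame.

(** * Existence of adapted co-ordinates *)

Section AdaptedChart.
Context {R : realType} {n k : nat}.
Local Notation N := (n + (n + k))%N.
Variable sg : 'I_n -> 'I_(n + k).

Definition sg_perp : set 'M[R]_N :=
  [set Z | exists2 xi : 'M[R]_(n, n + k), forall i, xi i (sg i) = 0 & Z = pmat xi].

(** The conclusion common to both cases, with |(w_i, w_i)| written as the sign of the slot times
    (w_i, w_i). *)
Definition adapted (D : set 'rV[R]_n) (X : 'rV[R]_n -> 'cV[R]_N)
    (w : 'I_n -> 'rV[R]_n -> 'cV[R]_N) (Xi Phi : 'rV[R]_n -> 'M[R]_N) : Prop :=
  [/\ solves_system D (ebasis sg) sg_perp Xi,
      lorentz_frame D Phi,
      [/\ principal_directions D X w Phi,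
          forall x, D x -> forall i, frame_u Phi (sg i) x
            = (Num.sqrt (lsgn (sg i) * mink (w i x) (w i x)))^-1 *: w i x &
          forall x, D x -> forall b c, (forall i, sg i != b) -> (forall i, sg i != c) ->
            forall l, mink (partial l (frame_u Phi b) x) (frame_u Phi c x) = 0],
      forall x, D x -> forall i,
        invmx (Phi x) *m partial i Phi x = ebasis sg i + bracket (ebasis sg i) (Xi x) &
      recovers_lift D (ebasis sg) Xi Phi X].

Variables (O : set 'rV[R]_n) (X : 'rV[R]_n -> 'cV[R]_N) (w : 'I_n -> 'rV[R]_n -> 'cV[R]_N).
Hypotheses (oO : open O) (sX : smooth_on O X).
Hypothesis posX : forall x, O x -> forall a : 'rV[R]_n, a != 0 ->
  0 < mink ('D_a X x) ('D_a X x).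
Hypothesis flatX : flat_metric O (induced_metric X).
Hypothesis sw : forall i, smooth_on O (w i).
Hypothesis w_normal : forall x, O x -> forall i, normal X x (w i x).
Hypothesis w_neq : forall x, O x -> forall i j, i != j -> w i x <> w j x.
Hypothesis w_eigen : forall x, O x -> forall i,
  exists2 a : 'cV_n, a != 0 & principal X x (w i x) a.
Hypothesis sg_inj : injective sg.
Hypothesis w_sign : forall x, O x -> forall i, 0 < lsgn (sg i) * mink (w i x) (w i x).
Hypothesis flat_compl : flat_connection O (curvature_normals_complement X w).
Hypothesis X_cone : forall x, O x -> light_cone (X x).
Hypothesis X_normal : forall x, O x -> normal X x (X x).
Hypothesis Xw : forall x, O x -> forall i, mink (X x) (w i x) = -1.

Theorem adapted_chart x0 : O x0 ->
  exists (d : R) (U : set 'rV[R]_n) (psi phi : 'rV[R]_n -> 'rV[R]_n),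
  [/\ 0 < d, open U, U x0 & U `<=` O] /\
  [/\ smooth_on U psi, smooth_on (ball (psi x0) d) phi,
      forall y, ball (psi x0) d y -> U (phi y) /\ psi (phi y) = y,
      forall x, U x -> ball (psi x0) d (psi x) /\ phi (psi x) = x &
      let D := ball (psi x0) d in
      (forall y, D y -> forall i,
         common_eigenspace D (X \o phi) (w i \o phi) y (delta_mx 0 i)) /\
      exists Xi Phi, adapted D (X \o phi) (fun i => w i \o phi) Xi Phi].
Proof.
move=> Ox0; have [r [Phi0 [om [[r0 rO sPhi0 som] H]]]] :=
  adapted_frame oO sX posX flatX sw w_normal w_neq w_eigen sg_inj w_sign flat_compl Ox0.
have [|d0 [U0 [psi [phi [[d00 oU0 U0x0 U0B] [spsi sphi phiK psiK mcE0]]]]]] :=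
  adapted_coordinates (om := om) sg_inj r0 sPhi0 som.
  by move=> x /H[h1 h2 h3 _ _]; split.
set q := psi x0 in sphi phiK psiK mcE0 *.
set D0 := ball q d0 in sphi phiK psiK mcE0 *; have oD0 : open D0 by exact: ball_open.
set B := ball x0 r in rO sPhi0 som H U0B *; have oB : open B by exact: ball_open.
have phiB y : D0 y -> B (phi y) by move=> /phiK[/U0B].
pose Phi := Phi0 \o phi.
have sPhi : smooth_on D0 Phi by exact: smooth_comp sPhi0 sphi.
have lPhi y : D0 y -> lorentz_group (Phi y) by move=> /phiB/H[].
have dphi y : D0 y -> differentiable phi y by exact: smooth_differentiable.
have frame0 y l t : D0 y -> pd l (fun x1 => col t (Phi x1)) y
    = \sum_j pd l phi y 0 j *: pd j (fun x1 => col t (Phi0 x1)) (phi y).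
  move=> Dy; have dP0 := smooth_differentiable sPhi0 (phiB y Dy).
  rewrite pd_col; last exact: smooth_differentiable Dy.
  rewrite /Phi partial_comp_mx//; last exact: dphi.
  rewrite linear_sum; apply: eq_bigr => j _; rewrite pd_col//.
  by apply/colP => s; rewrite mxE [RHS]mxE [LHS]mxE [in RHS]mxE.
have par y : D0 y -> forall l b c, (forall i, sg i != b) -> (forall i, sg i != c) ->
    mink (pd l (frame_u Phi b) y) (frame_u Phi c y) = 0.
  move=> Dy l b c hb hc; rewrite frame0// mink_suml big1// => j _.
  by have [_ _ _ _ [h _ _]] := H _ (phiB y Dy); rewrite minkZl h ?mulr0.
have mcpar y : D0 y -> forall l b c, (forall i, sg i != b) -> (forall i, sg i != c) ->
    mc Phi l y (nidx b) (nidx c) = 0.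
  move=> Dy l b c hb hc; rewrite /mc linv_mulE -pd_col; last exact: smooth_differentiable Dy.
  by rewrite minkC par ?mulr0.
(* The gauge is obtained on a possibly smaller ball, so the co-ordinate domain U0 is cut down to
   match. *)
have [r1 /andP[r10 r1d] [g1 [g2 hg]]] :=
  gauge_exists oD0 sPhi lPhi sg_inj mcE0 mcpar d00 (@subset_refl _ _).
set D := ball q r1 in hg *; have oD : open D by exact: ball_open.
have DD : D `<=` D0 by exact: le_ball.
pose U := U0 `&` [set x | D (psi x)].
have oU : open U.
  rewrite openE => x [U0x Dx]; have cpsi := smooth_continuous spsi U0x.
  apply: filterI; first exact: open_nbhs_nbhs.
  by apply: cpsi; exact: open_nbhs_nbhs.
have UO x : U x -> O x by move=> [/U0B/rO].
have phiO y : D y -> O (phi y) by move=> /DD/phiB/rO.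
exists r1, U, psi, phi; split; first by split=> //; split=> //; exact: ballxx.
have sphiD : smooth_on D phi by exact: smooth_on_subset sphi.
have sX' : smooth_on D (X \o phi) by exact: smooth_comp sX sphiD.
have sPhiD : smooth_on D Phi by exact: smooth_on_subset sPhi.
have lPhiD y : D y -> lorentz_group (Phi y) by move=> /DD; exact: lPhi.
have Xe y : D y -> forall l, mink (frame_e Phi l y) ((X \o phi) y) = 0.
  move=> Dy l; rewrite minkC; apply: normal_tangent (X_normal (phiO y Dy)) _.
  by have [_ _ _ _ [_ _ h]] := H _ (phiB y (DD _ Dy)); exact: h.
have Xu y : D y -> forall b l, mink (frame_u Phi b y) (pd l (X \o phi) y) = 0.
  move=> Dy b l; have dX := smooth_differentiable sX (phiO y Dy).
  rewrite partial_comp_mx//; last exact/dphi/DD.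
  rewrite mink_sumr big1// => j _; rewrite minkZr.
  have [_ _ _ _ [_ h _]] := H _ (phiB y (DD _ Dy)).
  by rewrite ((normal_partialP _ _ _).1 (h b)) ?mulr0.
pose rh i y := rho w sg i (phi y).
have rh0 i y : D y -> 0 < rh i y by move=> /phiO Oy; apply: rho_gt0 Oy.
have uE y : D y -> forall i, frame_u Phi (sg i) y = (rh i y)^-1 *: w i (phi y).
  by move=> Dy i; have [_ _ _ h _] := H _ (phiB y (DD _ Dy)); exact: h.
have wu y : D y -> forall i, (w i \o phi) y = rh i y *: frame_u Phi (sg i) y.
  by move=> Dy i; rewrite uE// scalerA mulfV ?scale1r// gt_eqF// rh0.
have Xw' y : D y -> forall i, mink ((X \o phi) y) ((w i \o phi) y) = -1.
  by move=> Dy i; exact/Xw/phiO.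
have mcED y : D y -> forall l j b,
  mc Phi l y (lshift (n + k) j) (nidx b) = ((l == j) && (b == sg j))%:R by move=> /DD/mcE0.
have mcparD y : D y -> forall l b c, (forall i, sg i != b) -> (forall i, sg i != c) ->
    mc Phi l y (nidx b) (nidx c) = 0 by move=> /DD/mcpar.
split=> //.
- by apply: smooth_on_subset spsi => x [].
- by move=> y Dy; have [U0y yE] := phiK y (DD _ Dy); split=> //; split=> //=; rewrite yE.
- by move=> x [U0x Dx]; have [_ ->] := psiK x U0x.
move=> D1; rewrite -/D in D1 *; split.
  move=> y Dy i; rewrite -[delta_mx 0 i]scale1r.
  exact: (curvature_direction oD sPhiD lPhiD mcED sX' Xe Xu wu Xw').
exists (Xi_of Phi sg), Phi; split.
- split.
  + exact: smooth_Xi_of.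
  + by move=> y Dy; exists (xi_of Phi sg y) => // i; apply: xi_of_diag Dy => //; exact: lPhiD.
  + move=> y Dy i j ij; rewrite !pdE.
    exact: (system_eq oD sPhiD lPhiD sg_inj mcED mcparD).
- by split.
- split.
  + exact: (principal_directions_frame oD sPhiD lPhiD mcED sX' Xe Xu wu Xw').
  + by move=> y Dy i; rewrite uE.
  + by move=> y Dy b c hb hc l; rewrite pdE; apply: par => //; exact: DD.
- move=> y Dy i; rewrite pdE (lorentz_invmx (lPhiD y Dy)) -/(mc Phi i y).
  exact: (mc_bracket oD sPhiD lPhiD sg_inj mcED mcparD).
- split; first by exists g1, g2.
  move=> h1 h2 hh; have XcD y : D y -> light_cone ((X \o phi) y) by move=> /phiO; exact: X_cone.
  exact: (recovers_gauge oD sPhiD lPhiD mcED mcparD sX' XcD Xe Xu r10 (erefl D) hh).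
Qed.

End AdaptedChart.

(** * Curvature normals of a lift to the light-cone *)

Section Lift.
Context {R : realType} {n k : nat}.
Local Notation N := (n + (n + k))%N.
Implicit Types (x : 'rV[R]_n).
Variables (O : set 'rV[R]_n) (X : 'rV[R]_n -> 'cV[R]_N).
Hypotheses (oO : open O) (sX : smooth_on O X).

Lemma partial_mxZ p q (s : 'rV[R]_n -> R) (A : 'rV[R]_n -> 'M[R]_(p, q)) i x :
  differentiable s x -> differentiable A x ->
  pd i (fun x1 => s x1 *: A x1) x = pd i s x *: A x + s x *: pd i A x.
Proof.
move=> ds dA; have dsA : differentiable (fun x1 => s x1 *: A x1) x.
  apply/differentiable_mxP => a b; have dAab := (differentiable_mxP A x).1 dA a b.
  have -> : (fun x1 => (s x1 *: A x1) a b) = fun x1 => s x1 * A x1 a b.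
    by apply/funext => x1; rewrite mxE.
  exact: differentiableM.
apply/matrixP => a b; have dAab := (differentiable_mxP A x).1 dA a b.
rewrite (partial_mxE i a b dsA).
have -> : (fun x1 => (s x1 *: A x1) a b) = fun x1 => s x1 * A x1 a b.
  by apply/funext => x1; rewrite mxE.
by rewrite (partialM i ds dAab) mxE !mxZE (partial_mxE i a b dA).
Qed.

(** X = s (f + t0) with f + t0 null and orthogonal to df, so the metric of X is s^2 (df, df); this
    is positive because df is orthogonal to the timelike t0. *)
Lemma lift_metric (t0 : 'cV[R]_N) (f : 'rV[R]_n -> 'cV[R]_N) : mink t0 t0 = -1 ->
  smooth_on O f -> (forall x, O x -> mink (f x) t0 = 0 /\ mink (f x) (f x) = 1) ->
  (forall x, O x -> forall a, 'D_a f x = 0 -> a = 0) ->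
  (forall x, O x -> exists r : R, f x + t0 = r *: X x) ->
  forall x, O x -> forall a : 'rV[R]_n, a != 0 -> 0 < mink ('D_a X x) ('D_a X x).
Proof.
move=> tt sf ff immf lift x Ox a a0.
(* Pairing f + t0 = r X with t0 gives r (X, t0) = -1; this expression for 1/r is manifestly
   smooth. *)
pose s x1 : R := - mink (X x1) t0.
have st : smooth_on O (fun=> t0) by exact: smooth_mx_cst.
have ss : smooth_on O s by apply: smoothN => //; exact: smooth_mink.
have sE x1 : O x1 -> s x1 != 0 /\ X x1 = s x1 *: (f x1 + t0).
  move=> Ox1; have [r fr] := lift x1 Ox1; have [f0 f1] := ff x1 Ox1.
  have rs : r * s x1 = 1.
    have := congr1 (fun y => mink y t0) fr.
    by rewrite minkDl minkZl f0 tt add0r /s mulrN => <-; rewrite opprK.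
  have s0 : s x1 != 0 by apply: contra_eqN rs => /eqP ->; rewrite mulr0 eq_sym oner_eq0.
  by split=> //; rewrite fr scalerA mulrC rs scale1r.
have dfx := smooth_differentiable sf Ox; have dsx := smooth_differentiable ss Ox.
have dft : differentiable (fun x1 => f x1 + t0) x by apply: differentiableD => //; exact: differentiable_cst.
have pX i : pd i X x = pd i s x *: (f x + t0) + s x *: pd i f x.
  rewrite (partial_eq_on i oO (fun x1 Ox1 => (sE x1 Ox1).2) Ox) (partial_mxZ i dsx dft).
  by rewrite partial_mxD ?partial_cst ?addr0//; exact: differentiable_cst.
have dX := smooth_differentiable sX Ox.
have DX : 'D_a X x = (\sum_i a 0 i * pd i s x) *: (f x + t0) + s x *: 'D_a f x.
  rewrite !deriv_partial// scaler_suml scaler_sumr -big_split; apply: eq_bigr => i _ /=.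
  by rewrite pX scalerDr !scalerA [s x * _]mulrC.
have [f0 f1] := ff x Ox.
have tdf : mink ('D_a f x) t0 = 0.
  rewrite deriv_partial// mink_suml big1// => i _; rewrite minkZl.
  have := partial_mink i dfx (smooth_differentiable st Ox).
  rewrite (@partial_eq_on R n _ O _ (fun=> 0) i x)//; last by move=> x1 /ff[].
  by rewrite !partial_cst mink0r addr0 => <-; rewrite mulr0.
have fdf : mink ('D_a f x) (f x) = 0.
  rewrite deriv_partial// mink_suml big1// => i _; rewrite minkZl.
  have := partial_mink i dfx dfx.
  rewrite (@partial_eq_on R n _ O _ (fun=> (1 : R)) i x)//; last by move=> x1 /ff[].
  rewrite partial_cst [mink (f x) _]minkC -mulr2n => /eqP.
  by rewrite eq_sym mulrn_eq0/= => /eqP ->; rewrite mulr0.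
have fp : 0 < mink ('D_a f x) ('D_a f x).
  apply: (@timelike_orthogonal _ _ t0) => //; first by rewrite tt oppr_lt0.
  by apply: contra_neq a0; exact: immf.
have [s0 _] := sE x Ox.
rewrite DX minkDl !minkDr !minkZl !minkZr minkDl !minkDr f0 f1 tt (minkC t0) f0.
rewrite [mink (_ + _) _]minkC !minkDr tdf fdf !addr0 !add0r subrr !mulr0 !add0r.
by rewrite mulrA mulr_gt0// lt_def sqr_ge0 mulf_neq0.
Qed.

Hypothesis posX : forall x, O x -> forall a : 'rV[R]_n, a != 0 ->
  0 < mink ('D_a X x) ('D_a X x).
Hypothesis X_cone : forall x, O x -> light_cone (X x).

Lemma lift_normal x : O x -> normal X x (X x).
Proof.
move=> Ox; apply/normal_partialP => l; have dX := smooth_differentiable sX Ox.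
have := partial_mink l dX dX.
rewrite (@partial_eq_on R n _ O _ (fun=> 0) l x)//; last by move=> x1 /X_cone[].
rewrite partial_cst [mink (pd l X x) _]minkC -mulr2n => /eqP.
by rewrite eq_sym mulrn_eq0/= => /eqP.
Qed.

(** Differentiate (X, dX b) = 0, as X is itself a normal field. *)
Lemma lift_hess x a b : O x ->
  mink (X x) (hess X x a b) = - mink (dX X x *m a) (dX X x *m b).
Proof.
move=> Ox; rewrite [RHS](_ : _ = - \sum_l a l 0 * mink (pd l X x) (dX X x *m b)); last first.
  by congr (- _); rewrite mink_mulmxl; apply: eq_bigr => l _; rewrite col_dX.
rewrite minkC mink_hess -sumrN; apply: eq_bigr => l _.
rewrite (weingarten oO sX l b oO (@subset_refl _ O) Ox (smooth_differentiable sX Ox) lift_normal).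
by rewrite mulrN opprK minkC.
Qed.

(** A normal vector v at x extends to the normal section obtained by projecting the constant v, on
    which the shape operator can be evaluated. *)
Lemma eigenspace_principal (w : 'rV[R]_n -> 'cV[R]_N) x (a : 'rV[R]_n) : O x ->
  common_eigenspace O X w x a -> principal X x (w x) a^T.
Proof.
move=> Ox ea v nv b; pose s x1 := normal_part X x1 v.
have ss : smooth_on O s.
  apply: smooth_mxB => //; first exact: smooth_mx_cst.
  by apply: smooth_mulmx => //; [exact: smooth_proj_tan|exact: smooth_mx_cst].
have sx : s x = v by rewrite /s /normal_part (normal_proj0 Ox nv) subr0.
have ns x1 : O x1 -> normal X x1 (s x1) by move=> Ox1; exact: (normal_nor sX posX).
have [|_ h] := ea s.
  by split=> // x1 Ox1; apply/(normal_spaceP sX) => //; exact: ns.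
have ds := smooth_differentiable ss Ox.
have := (normal_spaceP sX _ Ox).1 h b.
rewrite sx (dXE sX a Ox) minkBl minkNl minkZl => /eqP; rewrite subr_eq0 => /eqP <-.
rewrite deriv_partial// mink_suml minkC mink_hess -sumrN; apply: eq_bigr => l _.
by rewrite minkZl (weingarten oO sX l b oO (@subset_refl _ O) Ox ds ns) sx mulrN opprK [a^T _ _]mxE minkC.
Qed.

(** Test the principal condition with X itself as normal vector. *)
Lemma lift_curvature_normal x z a : O x -> a != 0 -> principal X x z a ->
  mink (X x) z = -1.
Proof.
move=> Ox a0 pa; have := pa _ (lift_normal Ox) a; rewrite lift_hess//.
have := gram_pos sX posX Ox a0; move: (mink (dX X x *m a) _) => g g0 /eqP.
have g1 : g != 0 by rewrite gt_eqF.
by move=> /eqP h; apply: (mulIf g1); rewrite -h mulN1r.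
Qed.

(** For k = 0 the slot [lshift k i] of the last spacelike v_i would be the timelike one; this
    excludes that conflict in the first case. *)
Lemma codim_pos (w : 'I_n -> 'cV[R]_N) x : O x -> (0 < n)%N ->
  (forall i, normal X x (w i)) -> (forall i, mink (X x) (w i) = -1) ->
  (forall i j, i != j -> mink (w i) (w j) = 0) -> (forall i, 0 < mink (w i) (w i)) ->
  (0 < k)%N.
Proof.
move=> Ox n0 nw Xw ww wp; rewrite lt0n; apply/eqP => k0.
(* For k = 0 the tangent space and the w_i would fill the whole space, but [z]
   is timelike and orthogonal to them. *)
pose z := X x + \sum_i (mink (w i) (w i))^-1 *: w i.
have zw i : mink z (w i) = 0.
  rewrite minkDl Xw mink_suml (bigD1 i)//= big1 ?addr0 => [|j ji].
    by rewrite minkZl mulVf ?gt_eqF// addNr.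
  by rewrite minkZl (ww j i ji) mulr0.
have zE y : mink y z = mink y (X x) + \sum_i (mink (w i) (w i))^-1 * mink y (w i).
  by rewrite minkDr mink_sumr; congr (_ + _); apply: eq_bigr => i _; rewrite minkZr.
have zz : mink z z < 0.
  rewrite zE big1 ?addr0 => [|i _]; last by rewrite zw mulr0.
  rewrite minkC zE (X_cone Ox).2 add0r (bigD1 (Ordinal n0))//= Xw mulrN1 ltr_wnDr//.
    by rewrite sumr_le0// => i _; rewrite Xw mulrN1 oppr_le0 invr_ge0 ltW.
  by rewrite oppr_lt0 invr_gt0.
have nz : normal X x z.
  move=> a; rewrite minkDl (lift_normal Ox) add0r mink_suml big1// => i _.
  by rewrite minkZl nw mulr0.
pose W : 'M[R]_(N, n) := \matrix_(s, i) w i s 0.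
have colW i : col i W = w i by apply/colP => s; rewrite !mxE.
pose Q := row_mx (dX X x) W.
have Ql j : col (lshift n j) Q = dX X x *m delta_mx j 0.
  by rewrite -colE; apply/colP => s; rewrite [LHS]mxE row_mxEl [RHS]mxE.
have Qr j : col (rshift n j) Q = w j by rewrite -colW; apply/colP => s; rewrite [LHS]mxE row_mxEr [RHS]mxE.
(* [M *m Q] is block diagonal and invertible, so M has rank 2n, which is full for k = 0; then M z =
   0 forces z = 0. *)
pose M := Q^T *m lorentz R N.
have GU : M *m Q \in unitmx.
  have -> : M *m Q = block_mx (gram X x) 0 0 (diag_mx (\row_i mink (w i) (w i))).
    apply/matrixP => s t; rewrite /M mink_cols -[s]splitK -[t]splitK.
    case: (fintype.split s) => a; case: (fintype.split t) => b /=; rewrite ?Ql ?Qr.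
    - by rewrite block_mxEul /gram mink_cols -!colE.
    - by rewrite block_mxEur minkC nw mxE.
    - by rewrite block_mxEdl nw mxE.
    - rewrite block_mxEdr !mxE; case: eqVneq => [->|ab]; rewrite ?mulr1n//.
      by rewrite ww// mulr0n.
  rewrite unitmxE det_ublock unitrM -!unitmxE (gram_unit sX posX)//= unitmxE det_diag unitfE.
  by apply/prodf_neq0 => i _; rewrite mxE gt_eqF.
have Mz : M *m z = 0.
  apply/colP => s; rewrite [RHS]mxE /M mink_cols col_id minkC -[s]splitK.
  by case: (fintype.split s) => a /=; rewrite ?Ql ?Qr ?zw// nz.
have : row_full M.
  have := mxrankM_maxl M Q; rewrite mxrank_unit// => rM.
  by rewrite /row_full eqn_leq rank_leq_col (leq_trans _ rM)// k0 addn0.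
move=> /row_fullP[B BM]; move: zz; rewrite -[z]mul1mx -BM -mulmxA Mz mulmx0 mink0l ltxx.
by [].
Qed.

End Lift.

(** * Change of co-ordinates *)

Section Charts.
Context {R : realType} {n : nat} {M : topologicalType}.
Implicit Types (c : chart R n M) (x : 'rV[R]_n).

(** The image is the preimage of V under the inverse chart, within the open set [cimg c]. *)
Lemma open_chart_image c (V : set M) : is_chart c -> open V ->
  open (cmap c @` (cdom c `&` V)).
Proof.
move=> [oc oi _ cinvc cK] oV; rewrite openE => x [p [cp Vp] <-].
have ip : cimg c (cmap c p) by exists p.
have h : {for cmap c p, continuous (cinv c)}.
  by move: cinvc; rewrite continuous_open_subspace// => /(_ (cmap c p)); apply; rewrite inE.
have n1 : \forall y \near cmap c p, cimg c y by exact: open_nbhs_nbhs.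
have n2 : \forall y \near cmap c p, V (cinv c y).
  by apply: h; rewrite cK//; exact: open_nbhs_nbhs.
apply: filterS2 n1 n2 => y [p' cp' <-]; rewrite cK// => Vp'.
by exists p'.
Qed.

Definition rechart c (U : set 'rV[R]_n) (psi phi : 'rV[R]_n -> 'rV[R]_n) : chart R n M :=
  Chart (cdom c `&` cmap c @^-1` U) (psi \o cmap c) (cinv c \o phi).

Variables (A : set (chart R n M)) (c : chart R n M) (q : 'rV[R]_n) (d : R).
Variables (U : set 'rV[R]_n) (psi phi : 'rV[R]_n -> 'rV[R]_n).
Hypotheses (hM : smooth_manifold A) (Ac : A c) (oU : open U) (UO : U `<=` cimg c).
Hypotheses (spsi : smooth_on U psi) (sphi : smooth_on (ball q d) phi).
Hypothesis phiK : forall y, ball q d y -> U (phi y) /\ psi (phi y) = y.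
Hypothesis psiK : forall x, U x -> ball q d (psi x) /\ phi (psi x) = x.

Local Notation c' := (rechart c U psi phi).

Lemma cimg_rechart : cimg c' = ball q d.
Proof.
have [_ _ hc _ _] := hM; have [_ _ _ _ cK] := hc c Ac.
apply/seteqP; split=> [y [p [cp Up] <-]|y By]; first by have [] := psiK Up.
have [Uy yE] := phiK By; have [p cp pE] := UO Uy.
by exists p => /=; rewrite pE//; split=> //=; rewrite pE.
Qed.

Lemma rechart_chart : is_chart c'.
Proof.
have [_ _ hc _ _] := hM; have [oc oi cm ci cK] := hc c Ac.
have cmc p : cdom c p -> {for p, continuous (cmap c)}.
  by move=> cp; move: cm; rewrite continuous_open_subspace// => /(_ p); apply; rewrite inE.
have cic x : cimg c x -> {for x, continuous (cinv c)}.
  by move=> cx; move: ci; rewrite continuous_open_subspace// => /(_ x); apply; rewrite inE.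
have odom : open (cdom c').
  rewrite openE => p [cp Up]; apply: filterI; first exact: open_nbhs_nbhs.
  by apply: cmc => //; exact: open_nbhs_nbhs.
split=> //; rewrite ?cimg_rechart; first exact: ball_open.
- rewrite continuous_open_subspace// => p; rewrite inE => -[cp Up].
  apply: continuous_comp; first exact: cmc.
  exact: smooth_continuous spsi Up.
- rewrite continuous_open_subspace; last exact: ball_open.
  move=> y; rewrite inE => By; have [Uy _] := phiK By.
  apply: continuous_comp; first exact: smooth_continuous sphi By.
  by apply: cic; exact: UO.
- by move=> p [cp Up] /=; have [_ ->] := psiK Up; exact: cK.
Qed.

(** Transitions to and from the atlas factor through those of [c], composed with [phi] or [psi]. *)
Lemma rechart_coordinates : coordinates A c'.
Proof.
have hc' := rechart_chart; have [_ _ hc _ tr] := hM; split=> // c2 Ac2.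
have [oc oi cm ci cK] := hc c Ac; have [oc2 oi2 cm2 ci2 cK2] := hc c2 Ac2.
have [oc' oi' cm' ci' cK'] := hc'.
split.
  apply: (@smooth_comp _ _ _ _ (cmap c @` (cdom c `&` cdom c2)) _ _ (cmap c2 \o cinv c) phi).
  - exact: open_chart_image.
  - exact: open_chart_image (hc c Ac) oc2.
  - move=> y [p [[cp Up] c2p] <-] /=; have [_ ->] := psiK Up.
    by exists p.
  - exact: tr.
  - apply: smooth_on_subset sphi => y [p [[cp Up] c2p] <-] /=.
    by have [] := psiK Up.
apply: (@smooth_comp _ _ _ _ U _ _ psi (cmap c \o cinv c2)) => //.
- exact: open_chart_image (hc c2 Ac2) oc'.
- by move=> y [p [c2p [cp Up]] <-] /=; rewrite cK2.
- apply: smooth_on_subset (tr _ _ Ac2 Ac) => y [p [c2p [cp Up]] <-].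
  by exists p.
Qed.

End Charts.

(** * Adapted charts of a flat lift *)

Section FlatLift.
Context {R : realType} {n k : nat}.
Local Notation N := (n + (n + k))%N.
Variables (n_gt0 : (0 < n)%N) (M : topologicalType) (A : set (chart R n M)).
Hypothesis hM : smooth_manifold A.
Variables (t0 : 'cV[R]_N) (f F : M -> 'cV[R]_N) (v : 'I_n -> M -> 'cV[R]_N).
Hypothesis ht0 : mink t0 t0 = -1.
Hypotheses (hf : spherical_immersion A t0 f) (hF : flat_lift A t0 f F).
Hypotheses (hv : uniform_multiplicity_one A F v) (hperp : flat_complement A F v).

Section InChart.
Variable c : chart R n M.
Hypothesis Ac : A c.

Local Notation O := (cimg c).
Local Notation X := (F \o cinv c).
Local Notation w := (fun i => v i \o cinv c).

Lemma open_cimg : open O.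
Proof. by have [_ _ hc _ _] := hM; have [] := hc c Ac. Qed.

Lemma smooth_lift : smooth_on O X.
Proof. by have [h _ _ _] := hF; exact: h. Qed.

Lemma lift_cone x : O x -> light_cone (X x).
Proof. by move=> _; have [_ h _ _] := hF; exact: h. Qed.

Lemma lift_immersion x : O x -> forall a : 'rV[R]_n, a != 0 ->
  0 < mink ('D_a X x) ('D_a X x).
Proof.
have [sf ff immf] := hf; have [_ _ lift _] := hF.
apply: (lift_metric open_cimg smooth_lift ht0 (sf c Ac)).
- by move=> x1 _; have [h1 h2] := ff (cinv c x1).
- by move=> x1 Ox1 a; exact: immf.
- by move=> x1 _; exact: lift.
Qed.

Lemma curvature_normal x : O x -> forall i, normal X x (w i x).
Proof.
move=> Ox i; have [_ _ h] := hv; have [h1 _] := h c Ac x Ox i.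
exact/(normal_spaceP smooth_lift).
Qed.

Lemma curvature_eigen x : O x -> forall i, exists2 a : 'cV_n, a != 0 & principal X x (w i x) a.
Proof.
move=> Ox i; have [_ _ h] := hv; have [_ [a a0 ea]] := h c Ac x Ox i.
exists a^T; first by rewrite -(inj_eq trmx_inj) trmxK trmx0.
apply: (eigenspace_principal open_cimg smooth_lift lift_immersion (w := w i)) => //.
by rewrite ea; exists 1; rewrite scale1r.
Qed.

Lemma lift_curvature x : O x -> forall i, mink (X x) (w i x) = -1.
Proof.
move=> Ox i; have [a a0 pa] := curvature_eigen Ox i.
exact: (lift_curvature_normal open_cimg smooth_lift lift_immersion lift_cone Ox a0 pa).
Qed.

Lemma curvature_neq x : O x -> forall i j, i != j -> w i x <> w j x.
Proof. by move=> _ i j ij; have [_ h _] := hv; exact: h. Qed.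

Lemma curvature_orthogonal x i j : O x -> i != j -> mink (w i x) (w j x) = 0.
Proof.
move=> Ox ij; have [_ _ _ flatF] := hF.
exact: (curvature_normals_orthogonal open_cimg smooth_lift lift_immersion (flatF c Ac)
  curvature_normal curvature_neq curvature_eigen).
Qed.

End InChart.

(** The premise [M] supplies the point at which the dimensions are counted. *)
Lemma lift_codim : (forall i p, 0 < mink (v i p) (v i p)) -> M -> (0 < k)%N.
Proof.
move=> vp p; have [_ _ hc cov _] := hM; have [c Ac cp] := cov p.
have Ox : cimg c (cmap c p) by exists p.
apply: (codim_pos (open_cimg Ac) (smooth_lift Ac) (lift_immersion Ac) (lift_cone (c := c))
  (w := fun i => v i (cinv c (cmap c p))) Ox n_gt0).
- by move=> i; exact: (curvature_normal Ac Ox).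
- by move=> i; exact: (lift_curvature Ac Ox).
- by move=> i j ij; exact: (curvature_orthogonal Ac Ox ij).
- by move=> i; exact: vp.
Qed.

(** Every other v_i is orthogonal to the timelike v_n and nonzero, as (F, v_i) = -1, hence
    spacelike. *)
Lemma timelike_curvature : (forall (i : 'I_n) p, i.+1 = n -> mink (v i p) (v i p) < 0) ->
  forall (i : 'I_n) p, 0 < eps R i * mink (v i p) (v i p).
Proof.
move=> vn i p; rewrite /eps; case: eqP => [/vn vi|ni]; first by rewrite mulN1r oppr_gt0.
rewrite mul1r; have [_ _ hc cov _] := hM; have [c Ac cp] := cov p.
have Ox : cimg c (cmap c p) by exists p.
have [_ _ _ _ cK] := hc c Ac.
have nP : (n.-1 < n)%N by rewrite prednK.
pose l := Ordinal nP; have lE : l.+1 = n by rewrite /= prednK.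
apply: (@timelike_orthogonal _ _ (v l p)); first exact: vn.
  have := curvature_orthogonal (i := i) (j := l) Ac Ox; rewrite /= cK//; apply.
  by apply: contra_not_neq ni => ->.
have := lift_curvature Ac Ox i; rewrite /= cK// => Fv.
by apply: contra_eq_neq Fv => ->; rewrite mink0r eq_sym oppr_eq0 oner_neq0.
Qed.

Theorem adapted_lift (sg : 'I_n -> 'I_(n + k)) : injective sg ->
  (forall i p, 0 < lsgn (sg i) * mink (v i p) (v i p)) ->
  forall p, exists c : chart R n M,
  [/\ line_of_curvature_coordinates A F v c, cdom c p &
      exists Xi Phi, adapted sg (cimg c) (F \o cinv c) (fun i => v i \o cinv c) Xi Phi].
Proof.
move=> sg_inj v_sign p; have [_ _ hc cov _] := hM; have [c Ac cp] := cov p.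
have Ox : cimg c (cmap c p) by exists p.
have [_ _ _ flatF] := hF; have [sv _ _] := hv.
have [d [U [psi [phi [[d0 oU Ux UO] [spsi sphi phiK psiK [eigen [Xi [Phi ad]]]]]]]]] :=
  adapted_chart (open_cimg Ac) (smooth_lift Ac) (lift_immersion Ac) (flatF c Ac)
    (fun i => sv i c Ac) (curvature_normal Ac) (@curvature_neq c) (curvature_eigen Ac) sg_inj
    (fun x _ i => v_sign i (cinv c x)) (hperp Ac) (@lift_cone c)
    (fun x Ox1 => lift_normal (open_cimg Ac) (smooth_lift Ac) (@lift_cone c) Ox1)
    (lift_curvature Ac) Ox.
exists (rechart c U psi phi).
have iE := cimg_rechart hM Ac UO phiK psiK.
split.
- split; first exact: (rechart_coordinates hM Ac oU UO spsi sphi phiK psiK).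
  by rewrite iE => x Dx i; exact: eigen.
- by split.
- by exists Xi, Phi; rewrite iE.
Qed.

End FlatLift.

(** * The two maximal abelian subalgebras *)

Lemma ebasisE (R : realType) (n k : nat) (sg : 'I_n -> 'I_(n + k)) i :
  ebasis sg i = delta_mx (lshift (n + k) i) (nidx (sg i))
    - lsgn (sg i) *: delta_mx (nidx (sg i)) (lshift (n + k) i) :> 'M[R]_(n + (n + k)).
Proof.
apply/matrixP => s t; rewrite mxBE mxZE -[s]splitK -[t]splitK.
case: (fintype.split s) => a; case: (fintype.split t) => b /=.
- by rewrite block_mxEul !mxE /nidx !eq_shift andbF !mulr0 subr0.
- by rewrite block_mxEur !mxE /nidx !eq_shift !mulr0 subr0.
- rewrite block_mxEdl mxNE lorentz_mulE !mxE /nidx !eq_shift sub0r andbC.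
  by case: (eqVneq a (sg i)) => [->|_]; rewrite ?mulr0.
- by rewrite block_mxEdr !mxE /nidx !eq_shift andbF !mulr0 subr0.
Qed.

Lemma lsgn_lshift_pos (R : realType) (n k : nat) (i : 'I_n) : (0 < k)%N ->
  lsgn (lshift k i) = 1 :> R.
Proof. by move=> k0; rewrite /lsgn; case: eqP => //= h; have := ltn_ord i; lia. Qed.

Lemma lsgn_kidx (R : realType) (n k : nat) (i : 'I_n) : lsgn (kidx k i) = eps R i.
Proof. by rewrite /lsgn /eps /= -addnS addnC eqn_add2r. Qed.

Lemma ebasis_a (R : realType) (n k : nat) : (0 < k)%N ->
  ebasis (fun i : 'I_n => lshift k i) = a_basis R k.
Proof.
by move=> k0; apply/funext => i; rewrite ebasisE lsgn_lshift_pos// scale1r.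
Qed.

Lemma ebasis_b (R : realType) (n k : nat) : ebasis (@kidx n k) = b_basis R k.
Proof. by apply/funext => i; rewrite ebasisE lsgn_kidx. Qed.

Lemma kidx_inj (n k : nat) : injective (@kidx n k).
Proof. by move=> i j /cast_ord_inj/rshift_inj. Qed.

Theorem theorem4p2 (R : realType) (n k : nat) (n_gt0 : (0 < n)%N)
  (M : topologicalType) (A : set (chart R n M)) (hM : smooth_manifold A)
  (t0 : 'cV[R]_(n + (n + k))) (ht0 : mink t0 t0 = -1)
  (f F : M -> 'cV[R]_(n + (n + k))) (v : 'I_n -> M -> 'cV[R]_(n + (n + k)))
  (hf : spherical_immersion A t0 f) (hcf : conformally_flat A f)
  (hF : flat_lift A t0 f F) (hN : flat_normal_bundle A F)
  (hv : uniform_multiplicity_one A F v) (hperp : flat_complement A F v) :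
  ((forall (i : 'I_n) (p : M), 0 < mink (v i p) (v i p)) ->
   forall p : M, exists c : chart R n M,
     let D := cimg c in
     let X := F \o cinv c in
     let w := fun i => v i \o cinv c in
     [/\ line_of_curvature_coordinates A F v c, cdom c p &
       exists Xi Phi : 'rV[R]_n -> 'M[R]_(n + (n + k)),
       [/\ solves_system D (a_basis R k) (@a_perp R n k) Xi,
           lorentz_frame D Phi,
           [/\ principal_directions D X w Phi,
               forall x, D x -> forall i : 'I_n,
                 frame_u Phi (lshift k i) x
                 = (Num.sqrt (mink (w i x) (w i x)))^-1 *: w i x &
               forall x, D x -> forall i j : 'I_(n + k), (n <= i)%N -> (n <= j)%N ->
                 forall l : 'I_n,
                   mink (partial l (frame_u Phi i) x) (frame_u Phi j x) = 0],
           forall x, D x -> forall i : 'I_n,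
             invmx (Phi x) *m partial i Phi x
             = a_basis R k i + bracket (a_basis R k i) (Xi x) &
           recovers_lift D (a_basis R k) Xi Phi X]])
  /\
  ((forall (i : 'I_n) (p : M), i.+1 = n -> mink (v i p) (v i p) < 0) ->
   forall p : M, exists c : chart R n M,
     let D := cimg c in
     let X := F \o cinv c in
     let w := fun i => v i \o cinv c in
     [/\ line_of_curvature_coordinates A F v c, cdom c p &
       exists Xi Phi : 'rV[R]_n -> 'M[R]_(n + (n + k)),
       [/\ solves_system D (b_basis R k) (@b_perp R n k) Xi,
           lorentz_frame D Phi,
           [/\ principal_directions D X w Phi,
               forall x, D x -> forall i : 'I_n,
                 frame_u Phi (kidx k i) x
                 = (Num.sqrt `|mink (w i x) (w i x)|)^-1 *: w i x &
               forall x, D x -> forall i j : 'I_(n + k), (i < k)%N -> (j < k)%N ->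
                 forall l : 'I_n,
                   mink (partial l (frame_u Phi i) x) (frame_u Phi j x) = 0],
           forall x, D x -> forall i : 'I_n,
             invmx (Phi x) *m partial i Phi x
             = b_basis R k i + bracket (b_basis R k i) (Xi x) &
           recovers_lift D (b_basis R k) Xi Phi X]]).
Proof.
split=> [v_pos p|v_neg p].
  have k0 := lift_codim n_gt0 hM ht0 hf hF hv v_pos p.
  have sgE i : lsgn (lshift k i) = 1 :> R by exact: lsgn_lshift_pos.
  have [|i p1|c [lc cp [Xi [Phi [sys fr [pd fu fc] mcE rec]]]]] :=
    @adapted_lift R n k M A hM t0 f F v ht0 hf hF hv hperp (fun i => lshift k i) _ _ p.
  - exact: lshift_inj.
  - by rewrite sgE mul1r.
  move: sys mcE rec; rewrite ebasis_a// => sys mcE rec.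
  exists c => D X w; split=> //; exists Xi, Phi; split=> //; split=> //.
    by move=> x Dx i; rewrite fu// sgE mul1r.
  (* An index at least n is no [lshift k m], so it is a complement slot. *)
  move=> x Dx i j ni nj l; apply: fc => // m; rewrite -val_eqE /= neq_ltn.
    by rewrite (leq_trans (ltn_ord m) ni).
  by rewrite (leq_trans (ltn_ord m) nj).
have v_sign i p1 : 0 < lsgn (kidx k i) * mink (v i p1) (v i p1).
  by rewrite lsgn_kidx; exact: (timelike_curvature n_gt0 hM ht0 hf hF hv v_neg).
have [|i p1|c [lc cp [Xi [Phi [sys fr [pd fu fc] mcE rec]]]]] :=
  @adapted_lift R n k M A hM t0 f F v ht0 hf hF hv hperp (@kidx n k) _ _ p.
- exact: kidx_inj.
- exact: v_sign.
move: sys mcE rec; rewrite ebasis_b => sys mcE rec.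
exists c => D X w; split=> //; exists Xi, Phi; split=> //; split=> //.
  move=> x Dx i; rewrite fu//; congr ((Num.sqrt _)^-1 *: _).
  (* The sign of the slot makes the product positive, so it equals the absolute value of (w_i,
     w_i). *)
  rewrite -[LHS]gtr0_norm; last exact: v_sign.
  by rewrite normrM /lsgn; case: ifP => _; rewrite ?normrN normr1 mul1r.
(* An index below k is no [kidx k m], so it is a complement slot. *)
move=> x Dx i j ni nj l; apply: fc => // m; rewrite -val_eqE /= neq_ltn.
  by rewrite (leq_trans ni (leq_addr _ _)) orbT.
by rewrite (leq_trans nj (leq_addr _ _)) orbT.
Qed.
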